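(* Let $(T(t))_{t\ge0}$ be a $C_0$-semigroup on a complex Banach space $X$, with generator $A$ and exponential growth bound $\omega_0$, let $T_1$ and $T_2$ be bounded operators on $X$, and let $\omega>\max(\omega_0,0)$ be fixed. Suppose $x\in X$ is such that (i) $T_1T(\cdot)T_2x\in L^p(\mathbb R_+,X)$ for some real $p\ge1$, and (ii) $T_1R(\cdot,A)T_2x$ extends to an analytic function $G$ on an open set $\Omega$ containing $\overline{\mathbb C}_+$. Then $$T_1T(\cdot)R(\omega,A)T_2x\in L^p(\mathbb R_+,X)\cap C_0(\mathbb R_+,X).$$ If, in addition, $M:\mathbb R_+\to[2,\infty)$ is continuous and increasing, $\Omega=\Omega_M$, and for some $C,\alpha,\beta\ge0$ we have $$\|G(\lambda)\|\le C(1+|\operatorname{Im}\lambda|)^\alpha M(|\operatorname{Im}\lambda|)^\beta,\qquad\lambda\in\Omega_M,$$ then $$T_1T(\cdot)R(\omega,A)T_2x\in L^p(\mathbb R_+,w,X),$$ where $w(t)=w_{M,\log}(kt)$ for some $k>0$.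
   Context: $\mathbb R_+=[0,\infty)$, $\mathbb C_+=\{\operatorname{Re}\lambda>0\}$, $\overline{\mathbb C}_+$ its closure. $R(\lambda,A)=(\lambda-A)^{-1}$; it is defined for $\operatorname{Re}\lambda>\omega_0$. For a continuous increasing $M:\mathbb R_+\to[2,\infty)$, $$M_{\log}(s)=M(s)\,[\log(1+M(s))+\log(1+s)],\qquad \Omega_M=\Big\{\lambda\in\mathbb C:\operatorname{Re}\lambda>-\frac1{M(|\operatorname{Im}\lambda|)}\Big\},$$ $M_{\log}^{-1}$ is the inverse of the strictly increasing unbounded continuous function $M_{\log}$, and $$w_{M,\log}(t)=\begin{cases}M_{\log}^{-1}(t),&t\ge M_{\log}(1),\\ 1,&0\le t\le M_{\log}(1).\end{cases}$$ $g\in L^p(\mathbb R_+,w,X)$ means $g\cdot w\in L^p(\mathbb R_+,X)$. $C_0(\mathbb R_+,X)$ is the space of continuous functions $\mathbb R_+\to X$ tending to $0$ at infinity. *)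

(* Defs.v *)
From HB Require Import structures.
From mathcomp Require Import all_boot all_order all_algebra.
From mathcomp Require Import all_classical all_reals all_analysis.
From mathcomp Require Import complex.

Set Implicit Arguments.
Unset Strict Implicit.
Unset Printing Implicit Defensive.

Import Order.TTheory GRing.Theory Num.Theory.
Import numFieldNormedType.Exports.

Local Open Scope classical_set_scope.
Local Open Scope complex_scope.
Local Open Scope ring_scope.

Definition Rplus (R : realType) : set R := [set t | 0 <= t].
Arguments Rplus : clear implicits.

(* The norm of a normed space over R[i] takes its values in R[i] (with zero
   imaginary part); [rnorm] reads it as an element of R. *)
Definition rnorm (R : realType) (X : normedModType R[i]) (x : X) : R :=
  complex.Re `|x|.

Definition bounded_operator (R : realType) (X : normedModType R[i])
    (S : X -> X) : Prop :=
  exists c : R, forall x, rnorm (S x) <= c * rnorm x.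

(* Semigroups are indexed by all of R, but only the operators [T t] with
   [0 <= t] are ever constrained or used. *)
Definition C0_semigroup (R : realType) (X : normedModType R[i])
    (T : R -> {linear X -> X}) : Prop :=
  [/\ forall t, 0 <= t -> bounded_operator (T t),
      forall x, T 0 x = x,
      forall s t, 0 <= s -> 0 <= t -> forall x, T (s + t) x = T s (T t x)
    & forall x, T t x @[t --> (0 : R)^'+] --> x].

Definition diff_quotient (R : realType) (X : normedModType R[i])
    (T : R -> {linear X -> X}) (x : X) (t : R) : X :=
  (t^-1)%:C *: (T t x - x).

Definition generator_dom (R : realType) (X : normedModType R[i])
    (T : R -> {linear X -> X}) : set X :=
  [set x | cvg (diff_quotient T x t @[t --> (0 : R)^'+])].

Definition generator (R : realType) (X : normedModType R[i])
    (T : R -> {linear X -> X}) (x : X) : X :=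
  lim (diff_quotient T x t @[t --> (0 : R)^'+]).

(* R(lam, A) = (lam - A)^-1, as a total function; its value at y is junk when
   y is not in the range of lam - A, which cannot happen for lam in the
   resolvent set of A. *)
Definition resolvent (R : realType) (X : normedModType R[i])
    (T : R -> {linear X -> X}) (lam : R[i]) (y : X) : X :=
  get [set x | generator_dom T x /\ lam *: x - generator T x = y].

(* The growth bound may be -oo, hence the extended reals. *)
Definition growth_bound (R : realType) (X : normedModType R[i])
    (T : R -> {linear X -> X}) : \bar R :=
  ereal_inf [set a%:E | a in [set a : R |
    exists c : R, forall t, 0 <= t ->
      forall x, rnorm (T t x) <= c * expR (a * t) * rnorm x]].

(* Holomorphy: [derivable G lam 1] is the existence of the limit of
   h^-1 *: (G (lam + h) - G lam) as the complex number h tends to 0. *)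
Definition analytic_on (R : realType) (X : normedModType R[i])
    (Om : set (R[i])^o) (G : (R[i])^o -> X) : Prop :=
  forall lam, Om lam -> derivable G lam 1.

Definition right_half_plane (R : realType) : set (R[i])^o :=
  [set lam | 0 < complex.Re lam].
Arguments right_half_plane : clear implicits.

Definition simple_function (R : realType) (X : normedModType R[i])
    (s : R -> X) : Prop :=
  finite_set (range s) /\ forall y, measurable (s @^-1` [set y]).

Definition strongly_measurable (R : realType) (X : normedModType R[i])
    (D : set R) (f : R -> X) : Prop :=
  exists s : nat -> R -> X, (forall n, simple_function (s n)) /\
    {ae @lebesgue_measure R, forall t, D t -> s n t @[n --> \oo] --> f t}.

(* The Bochner space L^p(R_+, X); values of f at negative reals are ignored. *)
Definition in_Lp (R : realType) (X : normedModType R[i]) (p : R)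
    (f : R -> X) : Prop :=
  strongly_measurable (Rplus R) f /\
  (\int[@lebesgue_measure R]_(t in Rplus R) (rnorm (f t) `^ p)%:E < +oo)%E.

Definition in_weighted_Lp (R : realType) (X : normedModType R[i]) (p : R)
    (w : R -> R) (f : R -> X) : Prop :=
  in_Lp p (fun t => (w t)%:C *: f t).

Definition in_C0 (R : realType) (X : normedModType R[i]) (f : R -> X) : Prop :=
  {within Rplus R, continuous f} /\ f t @[t --> +oo] --> (0 : X).

Definition M_log (R : realType) (M : R -> R) (s : R) : R :=
  M s * (ln (1 + M s) + ln (1 + s)).

Definition M_log_inv (R : realType) (M : R -> R) (t : R) : R :=
  get [set s | 0 <= s /\ M_log M s = t].

Definition w_M_log (R : realType) (M : R -> R) (t : R) : R :=
  if M_log M 1 <= t then M_log_inv M t else 1.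

Definition Omega (R : realType) (M : R -> R) : set (R[i])^o :=
  [set lam | - (M `|complex.Im lam|)^-1 < complex.Re lam].

(* Main.v *)
Require Import Defs.
From HB Require Import structures.
From mathcomp Require Import all_boot all_order all_algebra.
From mathcomp Require Import all_classical all_reals all_analysis.
From mathcomp Require Import measurable_realfun complex ring lra.
Set Implicit Arguments.
Unset Strict Implicit.
Unset Printing Implicit Defensive.
Import Order.TTheory GRing.Theory Num.Theory.
Import numFieldNormedType.Exports.
Local Open Scope classical_set_scope.
Local Open Scope complex_scope.
Local Open Scope ring_scope.

(** Write [f t = T1 (T t (T2 x))], [h t = |f t|], let [g] be the orbit of the
    theorem, and let [F] be the Laplace transform of [f]. Then
    [g t = exp (omega t) (F omega - int_0^t exp (- omega s) f s ds)], so that [g]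
    is an exponential average of [f] over [[t, +oo[].

    Vector-valued integrals are only used weakly. Composing with complex
    functionals of norm at most one leaves Lebesgue integrals of real and
    imaginary parts, and bounds that are uniform in the functional are bounds
    of norms by the Hahn-Banach theorem ([functional_norm_le]). The formula for
    [g] comes from [weak_integral]: there is a vector on which functionals take
    the value of the Laplace transform of the orbit, and it is the value of the
    resolvent ([resolvent_laplace_resolvent]).

    First assertion: [|g t|] is at most a multiple of the integral of
    [kern omega t s * h s] over [s], where
    [kern rho t s = rho / (1 + rho |t - s|) ^ 2]. Rows and columns of this
    kernel have bounded integrals, and Schur's test ([schur]) gives [L^p];
    applied to the tail of [h], Jensen's inequality gives the limit [0].

    Second assertion: this is the contour method of Newman and Korevaar. Let
    [F] also denote the analytic extension, which coincides with the transform
    in the whole right half-plane ([unique_continuation]). Cauchy's formula at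
    [omega] is applied to
    [exp (t z) (F z - int_0^t exp (- z s) f s ds) chi z] on a rectangle of
    height [2 r] whose left side lies on the imaginary axis; the factor
    [chi z = ((z ^ 2 + r ^ 2) / (omega ^ 2 + r ^ 2)) ^ m] is [1] at [omega] and
    vanishes at [+- i r]. On the other three sides only the transform of [f]
    beyond [t] is involved, and its product with [chi] is at most a multiple of
    the integral of [h s / (1 + r |t - s|) ^ 2]. On the left side the transform
    of the restriction of [f] to [[0, t]] is entire and is moved to the left
    half-plane, with a bound of the same kind, while [F] is moved to the line
    [Re z = - 1 / (2 M r)], where it has the assumed growth and
    [exp (t z)] is small ([contour_estimate]).

    At [r = w t], that is [M_log M r = k t], the contribution of [F] becomes
    [O(t ^ -2)] after multiplication by [r] ([remainder_le]). Hence [w t |g t|]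
    is bounded by the integral of [kern (w t) t s * h s], up to a function in
    every [L^p]. The weight at most quadruples over an interval of length one,
    which bounds the columns of this kernel too ([kern_column]), and Schur's
    test applies again. *)

(** * Moduli and complex differentiability *)

Section Modulus.
Context {R : realType}.

Lemma rnormE (X : normedModType R[i]) (x : X) : `|x| = (rnorm x)%:C.
Proof. by rewrite /rnorm RRe_real// ger0_real. Qed.

Lemma rnorm_ge0 (X : normedModType R[i]) (x : X) : 0 <= rnorm x.
Proof. by rewrite -lecR -rnormE normr_ge0. Qed.

Lemma rnormD (X : normedModType R[i]) (x y : X) : rnorm (x + y) <= rnorm x + rnorm y.
Proof. by rewrite -lecR rmorphD /= -!rnormE ler_normD. Qed.

Lemma rnormN (X : normedModType R[i]) (x : X) : rnorm (- x) = rnorm x.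
Proof. by rewrite /rnorm normrN. Qed.

Lemma rnorm0 (X : normedModType R[i]) : rnorm (0 : X) = 0.
Proof. by rewrite /rnorm normr0. Qed.

Lemma rnorm_eq0 (X : normedModType R[i]) (x : X) : rnorm x = 0 -> x = 0.
Proof. by move=> x0; apply/eqP; rewrite -normr_eq0 rnormE x0. Qed.

Lemma rnorm_distC (X : normedModType R[i]) (x y : X) : rnorm (x - y) = rnorm (y - x).
Proof. by rewrite -rnormN opprB. Qed.

Definition cabs (z : R[i]) : R := complex.Re `|z|.

Lemma cabsE z : `|z| = (cabs z)%:C.
Proof. by rewrite /cabs RRe_real// ger0_real. Qed.

Lemma rnormZ (X : normedModType R[i]) a (x : X) : rnorm (a *: x) = cabs a * rnorm x.
Proof. by apply: complexI; rewrite rmorphM /= -!rnormE normrZ cabsE. Qed.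

Lemma cabs_ge0 z : 0 <= cabs z. Proof. by rewrite -lecR -cabsE normr_ge0. Qed.
Lemma cabsD z w : cabs (z + w) <= cabs z + cabs w.
Proof. by rewrite -lecR rmorphD /= -!cabsE ler_normD. Qed.
Lemma cabsN z : cabs (- z) = cabs z. Proof. by rewrite /cabs normrN. Qed.
Lemma cabsB z w : cabs (z - w) <= cabs z + cabs w.
Proof. by rewrite -(cabsN w) cabsD. Qed.
Lemma cabsM z w : cabs (z * w) = cabs z * cabs w.
Proof. by apply: complexI; rewrite rmorphM /= -!cabsE normrM. Qed.
Lemma cabsV z : cabs z^-1 = (cabs z)^-1.
Proof. by apply: complexI; rewrite fmorphV /= -!cabsE normfV. Qed.
Lemma cabsX z n : cabs (z ^+ n) = cabs z ^+ n.
Proof. by apply: complexI; rewrite rmorphXn /= -!cabsE normrX. Qed.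
Lemma cabs0 : cabs 0 = 0. Proof. by rewrite /cabs normr0. Qed.
Lemma cabs1 : cabs 1 = 1. Proof. by rewrite /cabs normr1. Qed.
Lemma cabs_eq0 z : cabs z = 0 -> z = 0.
Proof. by move=> z0; apply/eqP; rewrite -normr_eq0 cabsE z0. Qed.
Lemma cabs_gt0 z : z != 0 -> 0 < cabs z.
Proof. by move=> z0; rewrite -ltcR -cabsE normr_gt0. Qed.
Lemma cabs_real r : cabs r%:C = `|r|.
Proof. by apply: complexI; rewrite -cabsE normc_def /= expr0n addr0 sqrtr_sqr. Qed.
Lemma cabsi : cabs 'i = 1.
Proof. by apply: complexI; rewrite -cabsE normc_def /= expr0n add0r expr1n sqrtr1. Qed.

Lemma cabs_def z : cabs z = Num.sqrt (complex.Re z ^+ 2 + complex.Im z ^+ 2).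
Proof. by apply: complexI; rewrite -cabsE normc_def. Qed.

Lemma cabs_sqr z : cabs z ^+ 2 = complex.Re z ^+ 2 + complex.Im z ^+ 2.
Proof. by rewrite cabs_def sqr_sqrtr// addr_ge0// sqr_ge0. Qed.

Lemma Re_le_cabs z : `|complex.Re z| <= cabs z.
Proof. by rewrite -lecR -cabsE normc_ge_Re. Qed.

Lemma Im_le_cabs z : `|complex.Im z| <= cabs z.
Proof.
rewrite cabs_def -sqrtr_sqr ler_sqrt ?addr_ge0 ?sqr_ge0//.
by rewrite lerDr sqr_ge0.
Qed.

Lemma cabs_le_ReIm z : cabs z <= `|complex.Re z| + `|complex.Im z|.
Proof.
rewrite {1}[z]complexE (le_trans (cabsD _ _))// cabsM cabsi mul1r.
by rewrite !cabs_real.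
Qed.

Lemma ReD (z w : R[i]) : complex.Re (z + w) = complex.Re z + complex.Re w.
Proof. by case: z; case: w. Qed.
Lemma ImD (z w : R[i]) : complex.Im (z + w) = complex.Im z + complex.Im w.
Proof. by case: z; case: w. Qed.
Lemma ReN (z : R[i]) : complex.Re (- z) = - complex.Re z. Proof. by case: z. Qed.
Lemma ImN (z : R[i]) : complex.Im (- z) = - complex.Im z. Proof. by case: z. Qed.
Lemma ReM (z w : R[i]) : complex.Re (z * w) =
  complex.Re z * complex.Re w - complex.Im z * complex.Im w.
Proof. by case: z; case: w. Qed.
Lemma ImM (z w : R[i]) : complex.Im (z * w) =
  complex.Re z * complex.Im w + complex.Im z * complex.Re w.
Proof. by case: z => a b; case: w => c d; rewrite /= addrC [b * c]mulrC [a * d]mulrC [c * b]mulrC. Qed.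

Lemma complex_eq (z w : R[i]) : complex.Re z = complex.Re w ->
  complex.Im z = complex.Im w -> z = w.
Proof. by case: z => a b; case: w => c d /= -> ->. Qed.

End Modulus.

Section Differentiability.
Context {R : realType}.

(** Increments of [F] are complex, and so are the gauges of its norm; this form
    of differentiability only involves real ones. *)
Lemma derivable_epsP (X : normedModType R[i]) (F : (R[i])^o -> X) (z : R[i]) :
  derivable F z 1 <-> exists d : X, forall e : R, 0 < e ->
    exists2 r : R, 0 < r & forall w : R[i], cabs (w - z) < r ->
      rnorm (F w - F z - (w - z) *: d) <= e * cabs (w - z).
Proof.
split.
- move=> /cvg_ex[/= d /cvgrPdist_le dF]; exists d => e e0.
  have e0' : 0 < e%:C by rewrite ltcR.
  have [/= r r0 H] := dF _ e0'.
  exists (complex.Re r).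
    by move: r0; rewrite ltcE => /andP[].
  move=> w wz; have [->|wz0] := eqVneq w z.
    by rewrite !subrr scale0r subrr rnorm0 cabs0 mulr0.
  have wz0' : w - z != 0 by rewrite subr_eq0.
  have := H (w - z); rewrite /= sub0r normrN => /(_ _ wz0').
  rewrite cabsE ltcE/= => H'.
  have {}H' : `|d - (w - z)^-1 *: (F ((w - z) *: 1 + z) - F z)| <= e%:C.
    apply: H'; rewrite wz andbT; move: r0; rewrite ltcE/= => /andP[/eqP<-//].
  have -> : F w - F z - (w - z) *: d =
      - ((w - z) *: (d - (w - z)^-1 *: (F ((w - z) *: 1 + z) - F z))).
    rewrite scalerBr scalerA divff// scale1r opprB.
    by rewrite (_ : (w - z) *: 1 + z = w) // /GRing.scale/= mulr1 subrK.
  rewrite rnormN rnormZ mulrC ler_wpM2r ?cabs_ge0//.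
  by rewrite -lecR -rnormE.
- move=> [d H]; apply/cvg_ex; exists d => /=; apply/cvgrPdist_le => /= e e0.
  have er : e = (complex.Re e)%:C.
    by rewrite RRe_real// gtr0_real.
  have e0' : 0 < complex.Re e by rewrite -ltcR -er.
  have [r r0 {}H] := H _ e0'.
  exists r%:C => /=; first by rewrite ltcR.
  move=> w /=; rewrite sub0r normrN cabsE ltcR => wr w0.
  have := H (w + z); rewrite addrK => /(_ wr) {}H.
  have -> : d - w^-1 *: (F (w *: 1 + z) - F z) =
     - (w^-1 *: (F (w + z) - F z - w *: d)).
    rewrite (_ : w *: 1 + z = w + z); last by rewrite /GRing.scale/= mulr1.
    by rewrite [in RHS]scalerBr scalerA mulVf// scale1r opprB.
  rewrite normrN rnormE er lecR rnormZ cabsV ler_pdivrMl ?cabs_gt0//.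
  by rewrite mulrC.
Qed.

End Differentiability.

(** * Complex-valued integrals of a real variable *)

Section ComplexIntegral.
Context {R : realType}.
Local Notation mu := (@lebesgue_measure R).
Implicit Types (D : set R) (f g : R -> R[i]).

Definition cint D f : R[i] :=
  (\int[mu]_(x in D) complex.Re (f x)) +i* (\int[mu]_(x in D) complex.Im (f x)).

Definition cintegrable D f : Prop :=
  mu.-integrable D (EFin \o (fun x => complex.Re (f x))) /\
  mu.-integrable D (EFin \o (fun x => complex.Im (f x))).

Lemma integrableRD D (a b : R -> R) : measurable D ->
  mu.-integrable D (EFin \o a) -> mu.-integrable D (EFin \o b) ->
  mu.-integrable D (EFin \o (fun x => a x + b x)).
Proof.
move=> mD ia ib; have := @integrableD _ _ _ mu D mD _ _ ia ib.
by apply: eq_integrable => // x _.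
Qed.

Lemma integrableRZ D (k : R) (a : R -> R) : measurable D ->
  mu.-integrable D (EFin \o a) -> mu.-integrable D (EFin \o (fun x => k * a x)).
Proof.
move=> mD ia; have := @integrableZl _ _ _ mu D mD k _ ia.
by apply: eq_integrable => // x _.
Qed.

Lemma integrableRB D (a b : R -> R) : measurable D ->
  mu.-integrable D (EFin \o a) -> mu.-integrable D (EFin \o b) ->
  mu.-integrable D (EFin \o (fun x => a x - b x)).
Proof.
move=> mD ia ib; have := @integrableB _ _ _ mu D mD _ _ ia ib.
by apply: eq_integrable => // x _.
Qed.

Lemma eq_cint D f g : {in D, f =1 g} -> cint D f = cint D g.
Proof.
by move=> fg; congr (_ +i* _); apply: eq_Rintegral => x xD; rewrite fg.
Qed.

Lemma eq_cintegrable D f g : measurable D -> {in D, f =1 g} ->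
  cintegrable D f -> cintegrable D g.
Proof.
by move=> mD fg [i1 i2]; split; [move: i1|move: i2];
  apply: eq_integrable => // x xD /=; rewrite fg.
Qed.

Lemma cintegrableD D f g : measurable D -> cintegrable D f -> cintegrable D g ->
  cintegrable D (fun x => f x + g x).
Proof.
move=> mD [f1 f2] [g1 g2]; split.
- by under eq_fun do rewrite ReD; exact: integrableRD.
- by under eq_fun do rewrite ImD; exact: integrableRD.
Qed.

Lemma cintegrableZ D (k : R[i]) f : measurable D -> cintegrable D f ->
  cintegrable D (fun x => k * f x).
Proof.
move=> mD [f1 f2]; split.
- by under eq_fun do rewrite ReM; apply: integrableRB => //; exact: integrableRZ.
- by under eq_fun do rewrite ImM; apply: integrableRD => //; exact: integrableRZ.
Qed.

Lemma cintegrableB D f g : measurable D -> cintegrable D f -> cintegrable D g ->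
  cintegrable D (fun x => f x - g x).
Proof.
move=> mD fi gi; have := cintegrableD mD fi (cintegrableZ (-1) mD gi).
by apply: eq_cintegrable => // x _; rewrite mulN1r.
Qed.

Lemma cintD D f g : measurable D -> cintegrable D f -> cintegrable D g ->
  cint D (fun x => f x + g x) = cint D f + cint D g.
Proof.
move=> mD [f1 f2] [g1 g2]; apply: complex_eq => /=.
- by under eq_Rintegral do rewrite ReD; rewrite RintegralD// -[LHS]/(_ + _).
- by under eq_Rintegral do rewrite ImD; rewrite RintegralD// -[LHS]/(_ + _).
Qed.

Lemma cintZ D (k : R[i]) f : measurable D -> cintegrable D f ->
  cint D (fun x => k * f x) = k * cint D f.
Proof.
move=> mD [f1 f2]; apply: complex_eq.
- rewrite ReM /=; under eq_Rintegral do rewrite ReM.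
  by rewrite RintegralB// ?RintegralZl//; exact: integrableRZ.
- rewrite ImM /=; under eq_Rintegral do rewrite ImM.
  by rewrite RintegralD// ?RintegralZl//; exact: integrableRZ.
Qed.

Lemma cintB D f g : measurable D -> cintegrable D f -> cintegrable D g ->
  cint D (fun x => f x - g x) = cint D f - cint D g.
Proof.
move=> mD fi gi; rewrite -mulN1r -cintZ// -cintD//; last exact: cintegrableZ.
by apply: eq_cint => x _; rewrite mulN1r.
Qed.

(** Rotating the integral onto the positive axis reduces the triangle
    inequality to the monotonicity of a real integral. *)
Lemma cabs_cint_le D f (b : R -> R) : measurable D -> cintegrable D f ->
  mu.-integrable D (EFin \o b) -> (forall x, D x -> cabs (f x) <= b x) ->
  cabs (cint D f) <= \int[mu]_(x in D) b x.
Proof.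
move=> mD fi bi fb; set z := cint D f.
have [->|z0] := eqVneq z 0.
  rewrite cabs0; apply: Rintegral_ge0 => x Dx.
  exact: le_trans (cabs_ge0 _) (fb x Dx).
have z0' := cabs_gt0 z0.
have key : cabs z * cabs z = complex.Re (cint D (fun x => z^* * f x)).
  rewrite cintZ// -/z -expr2 cabs_sqr ReM; case: (z) => a c /=.
  by rewrite mulNr opprK -!expr2.
rewrite -(ler_pM2l z0') key /= -RintegralZl//.
apply: le_Rintegral => //.
- by case: (cintegrableZ z^* mD fi).
- exact: integrableRZ.
- move=> x Dx; apply: le_trans (ler_norm _) _.
  apply: le_trans (Re_le_cabs _) _; rewrite cabsM.
  have -> : cabs z^* = cabs z by rewrite /cabs normcJ.
  by rewrite ler_pM2l// fb.
Qed.

Lemma le_cintegrable D f (b : R -> R) : measurable D ->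
  measurable_fun D (fun x => complex.Re (f x)) ->
  measurable_fun D (fun x => complex.Im (f x)) ->
  mu.-integrable D (EFin \o b) -> (forall x, D x -> cabs (f x) <= b x) ->
  cintegrable D f.
Proof.
move=> mD m1 m2 bi fb; split; apply: (@le_integrable _ _ _ mu D mD _ _ _ _ bi).
- exact/measurable_EFinP.
- move=> x Dx /=; rewrite lee_fin (le_trans (Re_le_cabs _))//.
  by rewrite (le_trans (fb x Dx))// ler_norm.
- exact/measurable_EFinP.
- move=> x Dx /=; rewrite lee_fin (le_trans (Im_le_cabs _))//.
  by rewrite (le_trans (fb x Dx))// ler_norm.
Qed.

Lemma fine_mu_itv (a b : R) : a <= b -> fine (mu `[a, b]) = b - a.
Proof.
move=> ab; rewrite lebesgue_measure_itv/= lte_fin; case: ltgtP ab => //= -> _; by rewrite subrr.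
Qed.

Lemma cst_integrable_itv (a b k : R) : mu.-integrable `[a, b] (EFin \o cst k).
Proof.
by apply: continuous_compact_integrable;
  [exact: segment_compact|apply: continuous_subspaceT => x; exact: cvg_cst].
Qed.

Lemma cintegrable_cst (a b : R) (k : R[i]) : cintegrable `[a, b] (fun=> k).
Proof. by split; exact: cst_integrable_itv. Qed.

Lemma cint_cst (a b : R) (k : R[i]) : a <= b ->
  cint `[a, b] (fun=> k) = (b - a)%:C * k.
Proof.
move=> ab; apply: complex_eq; rewrite /= !Rintegral_cst// fine_mu_itv// ?ReM ?ImM/=.
  by rewrite mul0r subr0 mulrC.
by rewrite mul0r addr0 mulrC.
Qed.

Lemma cabs_cint_itv_le (a b k : R) f : a <= b -> cintegrable `[a, b] f ->
  (forall x, a <= x <= b -> cabs (f x) <= k) ->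
  cabs (cint `[a, b] f) <= k * (b - a).
Proof.
move=> ab fi fk; rewrite -fine_mu_itv// -Rintegral_cst//.
apply: cabs_cint_le => //; exact: cst_integrable_itv.
Qed.

Lemma cintegrableS D D' f : measurable D -> measurable D' -> D' `<=` D ->
  cintegrable D f -> cintegrable D' f.
Proof. by move=> mD mD' DD [f1 f2]; split; exact: (@integrableS _ _ _ mu D). Qed.

Lemma Rintegral_itv_split (a m b : R) (f : R -> R) : a <= m -> m <= b ->
  mu.-integrable `[a, b] (EFin \o f) ->
  \int[mu]_(x in `[a, b]) f x =
    \int[mu]_(x in `[a, m]) f x + \int[mu]_(x in `[m, b]) f x.
Proof.
move=> am mb fi; apply/eqP; rewrite addrC -subr_eq; apply/eqP.
rewrite Rintegral_itvB//= ?Rintegral_itv_obnd_cbnd//.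
by apply: integrableS fi => // x /=; rewrite !in_itv/= => /andP[mx ->];
  rewrite (le_trans am (ltW mx)).
Qed.

Lemma cint_itv_split (a m b : R) f : a <= m -> m <= b ->
  cintegrable `[a, b] f ->
  cint `[a, b] f = cint `[a, m] f + cint `[m, b] f.
Proof.
by move=> am mb [f1 f2]; apply: complex_eq; rewrite /= (@Rintegral_itv_split a m b).
Qed.

End ComplexIntegral.

(** * The theorems of Goursat and Cauchy on rectangles *)

Section Rectangles.
Context {R : realType}.
Local Notation mu := (@lebesgue_measure R).
Implicit Types (F G : R[i] -> R[i]).

Definition holo F (z : R[i]) : Prop := derivable (F : (R[i])^o -> (R[i])^o) z 1.

Lemma holo_epsP F z : holo F z <-> exists d : R[i], forall e : R, 0 < e ->
    exists2 r : R, 0 < r & forall w : R[i], cabs (w - z) < r ->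
      cabs (F w - F z - (w - z) * d) <= e * cabs (w - z).
Proof. exact: (@derivable_epsP _ (R[i])^o). Qed.

Lemma holo_cst (k z : R[i]) : holo (fun=> k) z.
Proof. exact: derivable_cst. Qed.

Lemma holo_id (z : R[i]) : holo id z.
Proof. exact: derivable_id. Qed.

Lemma holoD F G z : holo F z -> holo G z -> holo (fun w => F w + G w) z.
Proof. exact: derivableD. Qed.

Lemma holoB F G z : holo F z -> holo G z -> holo (fun w => F w - G w) z.
Proof. exact: derivableB. Qed.

Lemma holoM F G z : holo F z -> holo G z -> holo (fun w => F w * G w) z.
Proof. exact: derivableM. Qed.

Lemma holoX F n z : holo F z -> holo (fun w => F w ^+ n) z.
Proof.
move=> Fz; elim: n => [|n IH]; first exact: holo_cst.
by under eq_fun do rewrite exprS; exact: holoM.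
Qed.

Lemma holoV F z : F z != 0 -> holo F z -> holo (fun w => (F w)^-1) z.
Proof. exact: derivableV. Qed.

Lemma holo_continuous F z : holo F z -> forall e : R, 0 < e ->
  exists2 r : R, 0 < r & forall w, cabs (w - z) < r -> cabs (F w - F z) <= e.
Proof.
move=> /holo_epsP[d H] e e0; have [r r0 {}H] := H 1 ltr01.
have dp : 0 < 1 + cabs d by rewrite ltr_wpDr// cabs_ge0.
exists (Num.min r (e / (1 + cabs d))); first by rewrite lt_min r0 divr_gt0.
move=> w; rewrite lt_min => /andP[wr we].
have -> : F w - F z = (F w - F z - (w - z) * d) + (w - z) * d by ring.
apply: le_trans (cabsD _ _) _; rewrite cabsM.
apply: le_trans (lerD (H w wr) (lexx _)) _.
rewrite mulrC -mulrDr -ler_pdivlMr//; exact: ltW.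
Qed.

Lemma ball_segment (f : R -> R) (x : R) : (forall e, 0 < e -> exists2 r, 0 < r &
    forall y, `|y - x| < r -> `|f y - f x| <= e) -> {for x, continuous f}.
Proof.
move=> H; apply/cvgrPdist_le => e e0; have [r r0 {}H] := H e e0.
by exists r => //= y; rewrite /= distrC => /H; rewrite distrC.
Qed.

Lemma holo_hslice_integrable F (a b c : R) :
  (forall x, a <= x <= b -> holo F (x +i* c)) ->
  cintegrable `[a, b] (fun x => F (x +i* c)).
Proof.
move=> H; split; apply: continuous_compact_integrable;
  try exact: segment_compact; apply: continuous_in_subspaceT => x;
  rewrite inE/= in_itv/= => /H /holo_continuous Fx; apply: ball_segment => e e0;
  have [r r0 {}Fx] := Fx e e0; exists r => // y yx;
  rewrite -?ReN -?ReD -?ImN -?ImD.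
- apply: le_trans (Re_le_cabs _) _; apply: Fx.
  have -> : (y +i* c) - (x +i* c) = (y - x)%:C by apply: complex_eq; rewrite /= ?subrr.
  by rewrite cabs_real.
- apply: le_trans (Im_le_cabs _) _; apply: Fx.
  have -> : (y +i* c) - (x +i* c) = (y - x)%:C by apply: complex_eq; rewrite /= ?subrr.
  by rewrite cabs_real.
Qed.

Lemma holo_vslice_integrable F (a c d : R) :
  (forall y, c <= y <= d -> holo F (a +i* y)) ->
  cintegrable `[c, d] (fun y => F (a +i* y)).
Proof.
move=> H; split; apply: continuous_compact_integrable;
  try exact: segment_compact; apply: continuous_in_subspaceT => x;
  rewrite inE/= in_itv/= => /H /holo_continuous Fx; apply: ball_segment => e e0;
  have [r r0 {}Fx] := Fx e e0; exists r => // y yx;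
  rewrite -?ReN -?ReD -?ImN -?ImD.
- apply: le_trans (Re_le_cabs _) _; apply: Fx.
  have -> : (a +i* y) - (a +i* x) = 'i * (y - x)%:C by apply: complex_eq; rewrite /= ; ring.
  by rewrite cabsM cabsi mul1r cabs_real.
- apply: le_trans (Im_le_cabs _) _; apply: Fx.
  have -> : (a +i* y) - (a +i* x) = 'i * (y - x)%:C by apply: complex_eq; rewrite /= ; ring.
  by rewrite cabsM cabsi mul1r cabs_real.
Qed.

(** The contour integral along the boundary of [a, b] x [c, d]. *)
Definition rint F (a b c d : R) : R[i] :=
  cint `[a, b] (fun x => F (x +i* c)) - cint `[a, b] (fun x => F (x +i* d))
  + 'i * (cint `[c, d] (fun y => F (b +i* y)) - cint `[c, d] (fun y => F (a +i* y))).

Definition rintegrable F (a b c d : R) : Prop :=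
  [/\ cintegrable `[a, b] (fun x => F (x +i* c)),
      cintegrable `[a, b] (fun x => F (x +i* d)),
      cintegrable `[c, d] (fun y => F (b +i* y))
    & cintegrable `[c, d] (fun y => F (a +i* y))].

Lemma holo_rintegrable F (a b c d : R) : a <= b -> c <= d ->
  (forall x y, a <= x <= b -> c <= y <= d ->
    [|| x == a, x == b, y == c | y == d] -> holo F (x +i* y)) ->
  rintegrable F a b c d.
Proof.
move=> ab cd H; split.
- by apply: holo_hslice_integrable => x xab; apply: H; rewrite ?lexx ?eqxx ?orbT.
- by apply: holo_hslice_integrable => x xab; apply: H; rewrite ?lexx ?eqxx ?orbT ?cd.
- by apply: holo_vslice_integrable => x xab; apply: H; rewrite ?lexx ?eqxx ?orbT ?ab.
- by apply: holo_vslice_integrable => x xab; apply: H; rewrite ?lexx ?eqxx ?orbT ?ab.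
Qed.

Lemma rintD F G a b c d : rintegrable F a b c d -> rintegrable G a b c d ->
  rint (fun z => F z + G z) a b c d = rint F a b c d + rint G a b c d.
Proof. by move=> [? ? ? ?] [? ? ? ?]; rewrite /rint !cintD//; ring. Qed.

Lemma rintZ F k a b c d : rintegrable F a b c d ->
  rint (fun z => k * F z) a b c d = k * rint F a b c d.
Proof. by move=> [? ? ? ?]; rewrite /rint !cintZ//; ring. Qed.

Lemma rintegrableZ F k a b c d : rintegrable F a b c d ->
  rintegrable (fun z => k * F z) a b c d.
Proof. by move=> [? ? ? ?]; split; exact: cintegrableZ. Qed.

Lemma cabs_rint_le F (a b c d k : R) : a <= b -> c <= d ->
  rintegrable F a b c d ->
  (forall x y, a <= x <= b -> c <= y <= d ->
    [|| x == a, x == b, y == c | y == d] -> cabs (F (x +i* y)) <= k) ->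
  cabs (rint F a b c d) <= 2 * k * ((b - a) + (d - c)).
Proof.
move=> ab cd [i1 i2 i3 i4] Fk.
have -> : 2 * k * (b - a + (d - c)) =
  (k * (b - a) + k * (b - a)) + (k * (d - c) + k * (d - c)) by ring.
rewrite /rint; apply: le_trans (cabsD _ _) _; rewrite cabsM cabsi mul1r.
apply: lerD; apply: le_trans (cabsB _ _) _; apply: lerD;
  apply: cabs_cint_itv_le => // x xab; apply: Fk; rewrite ?eqxx ?orbT ?lexx ?ab ?cd//.
Qed.

Lemma rint_affine (p q : R[i]) a b c d : a <= b -> c <= d ->
  rint (fun z => p + q * z) a b c d = 0.
Proof.
move=> ab cd.
have H F : (forall z, holo F z) -> rintegrable F a b c d.
  by move=> FH; apply: holo_rintegrable.
rewrite (@rintD (fun=> p) (fun z => q * z)); last 2 first.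
- by apply: H => z; exact: holo_cst.
- by apply: H => z; apply: holoM; [exact: holo_cst|exact: holo_id].
rewrite rintZ; last by apply: H; exact: holo_id.
have -> : rint id a b c d = 0.
  have [? ? ? ?] := H id holo_id.
  rewrite /rint -cintB// -cintB//.
  rewrite (@eq_cint _ _ _ (fun=> 'i * (c - d)%:C)); last first.
    by move=> x _; apply: complex_eq => /=; ring.
  rewrite [X in _ + 'i * X](@eq_cint _ _ _ (fun=> (b - a)%:C)); last first.
    by move=> x _; apply: complex_eq => /=; ring.
  by rewrite !cint_cst//; apply: complex_eq => /=; ring.
by rewrite /rint !subrr mulr0 addr0 mulr0 addr0.
Qed.

Lemma rint_splitx F a m b c d : a <= m -> m <= b ->
  cintegrable `[a, b] (fun x => F (x +i* c)) ->
  cintegrable `[a, b] (fun x => F (x +i* d)) ->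
  rint F a b c d = rint F a m c d + rint F m b c d.
Proof.
by move=> am mb i1 i2; rewrite /rint !(@cint_itv_split _ a m b)//; ring.
Qed.

Lemma rint_splity F a b c m d : c <= m -> m <= d ->
  cintegrable `[c, d] (fun y => F (a +i* y)) ->
  cintegrable `[c, d] (fun y => F (b +i* y)) ->
  rint F a b c d = rint F a b c m + rint F a b m d.
Proof.
by move=> am mb i1 i2; rewrite /rint !(@cint_itv_split _ c m d)//; ring.
Qed.

End Rectangles.

Section Goursat.
Context {R : realType}.
Local Notation mu := (@lebesgue_measure R).
Implicit Types (F G : R[i] -> R[i]).

Lemma rint_quarter F a b c d (e : R) : a <= b -> c <= d ->
  (forall x y, a <= x <= b -> c <= y <= d -> holo F (x +i* y)) ->
  let l := (b - a) / 2 in let m := (d - c) / 2 in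
  e * ((b - a) + (d - c)) ^+ 2 < cabs (rint F a b c d) ->
  exists2 p : R * R, (p.1 = a \/ p.1 = a + l) /\ (p.2 = c \/ p.2 = c + m) &
    e * (l + m) ^+ 2 < cabs (rint F p.1 (p.1 + l) p.2 (p.2 + m)).
Proof.
move=> ab cd H l m Hlt; apply: contrapT => Hn.
have N p : (p.1 = a \/ p.1 = a + l) /\ (p.2 = c \/ p.2 = c + m) ->
    cabs (rint F p.1 (p.1 + l) p.2 (p.2 + m)) <= e * (l + m) ^+ 2.
  by move=> Hp; rewrite leNgt; apply/negP => Hlt'; apply: Hn; exists p.
have l0 : 0 <= l by rewrite /l divr_ge0// subr_ge0.
have m0 : 0 <= m by rewrite /m divr_ge0// subr_ge0.
have bE : b = a + l + l by rewrite /l; field.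
have dE : d = c + m + m by rewrite /m; field.
have := Hlt; rewrite ltNge => /negP; apply.
rewrite (@rint_splitx _ _ _ (a + l)); last 4 first.
- by rewrite lerDl.
- by rewrite bE lerDl.
- by apply: holo_hslice_integrable => x xab; apply: H; rewrite ?lexx.
- by apply: holo_hslice_integrable => x xab; apply: H; rewrite ?lexx ?cd.
have al : a <= a + l <= b by rewrite bE !lerDl l0 /=.
rewrite (@rint_splity _ _ a (a + l) c (c + m)); last 4 first.
- by rewrite lerDl.
- by rewrite dE lerDl.
- by apply: holo_vslice_integrable => y ycd; apply: H; rewrite ?lexx.
- by apply: holo_vslice_integrable => y ycd; apply: H; rewrite ?lexx.
rewrite (@rint_splity _ _ (a + l) b c (c + m)); last 4 first.
- by rewrite lerDl.
- by rewrite dE lerDl.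
- by apply: holo_vslice_integrable => y ycd; apply: H; rewrite ?lexx.
- by apply: holo_vslice_integrable => y ycd; apply: H; rewrite ?lexx ?ab.
have -> : e * (b - a + (d - c)) ^+ 2 =
    (e * (l + m) ^+ 2 + e * (l + m) ^+ 2) + (e * (l + m) ^+ 2 + e * (l + m) ^+ 2).
  by rewrite bE dE; ring.
rewrite bE dE.
apply: le_trans (cabsD _ _) _; apply: lerD; apply: le_trans (cabsD _ _) _;
  apply: lerD.
- by apply: (N (a, c)); split; left.
- by apply: (N (a, c + m)); split; [left|right].
- by apply: (N (a + l, c)); split; [right|left].
- by apply: (N (a + l, c + m)); split; right.
Qed.

(** The left end points increase and stay below all right end points, so their
    supremum lies in every segment. *)
Lemma nested_segments (u : nat -> R) (l : R) : 0 <= l ->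
  (forall n, u n.+1 = u n \/ u n.+1 = u n + l / 2 ^+ n.+1) ->
  exists x, forall n, u n <= x <= u n + l / 2 ^+ n.
Proof.
move=> l0 Hu.
have p2 n : 0 <= l / 2 ^+ n by rewrite divr_ge0// exprn_ge0.
have hS n : l / 2 ^+ n = l / 2 ^+ n.+1 + l / 2 ^+ n.+1.
  by rewrite exprS invfM; field; rewrite expf_neq0.
have up n k : u n <= u (n + k)%N.
  elim: k => [|k IH]; first by rewrite addn0.
  rewrite addnS (le_trans IH)//.
  by case: (Hu (n + k)%N) => ->; rewrite ?lerDl.
have dn n k : u (n + k)%N + l / 2 ^+ (n + k) <= u n + l / 2 ^+ n.
  elim: k => [|k IH]; first by rewrite addn0.
  rewrite addnS (le_trans _ IH)// [in leRHS]hS addrA.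
  by case: (Hu (n + k)%N) => ->; rewrite ?lerD2r ?lerDl// -addrA -?hS lerD2l ?lerDl.
have bd n k : u k <= u n + l / 2 ^+ n.
  have [nk|kn] := leqP n k.
    rewrite -(subnKC nk); apply: le_trans (dn n (k - n)%N).
    by rewrite lerDl.
  rewrite (le_trans (up k (n - k)%N))// (subnKC (ltnW kn)) lerDl//.
have hs : has_sup (range u).
  split; first by exists (u 0%N), 0%N.
  by exists (u 0%N + l / 2 ^+ 0) => _ [k _ <-]; exact: bd.
exists (sup (range u)) => n; apply/andP; split.
  by apply: ub_le_sup; [exact: hs.2|exists n].
by apply: ge_sup; [exact: hs.1|move=> _ [k _ <-]; exact: bd].
Qed.

Lemma small_halving (l e : R) : 0 < e -> exists n, l / 2 ^+ n < e.
Proof.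
move=> e0; have [n Hn] : exists n : nat, l / e < n%:R.
  exists (Num.truncn `|l / e|).+1; apply: le_lt_trans (ler_norm _) _.
  exact: truncnS_gt.
exists n; rewrite ltr_pdivrMr ?exprn_gt0// mulrC -ltr_pdivrMr//.
apply: lt_trans Hn _; rewrite -natrX ltr_nat.
exact: ltn_expl.
Qed.

(** The contour integral of the first order expansion vanishes, and only that
    of the remainder is left. *)
Lemma rint_first_order F (a b c d x y e r : R) (d0 : R[i]) :
  a <= x <= b -> c <= y <= d ->
  (forall x y, a <= x <= b -> c <= y <= d -> holo F (x +i* y)) ->
  (forall w, cabs (w - (x +i* y)) < r ->
     cabs (F w - F (x +i* y) - (w - (x +i* y)) * d0) <= e / 2 * cabs (w - (x +i* y))) ->
  0 < e -> (b - a) + (d - c) < r ->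
  cabs (rint F a b c d) <= e * ((b - a) + (d - c)) ^+ 2.
Proof.
move=> /andP[x1 x2] /andP[y1 y2] H Hd0 e0 lr.
have ab := le_trans x1 x2; have cd := le_trans y1 y2.
pose p := F (x +i* y) - (x +i* y) * d0.
pose rem w := F w - (p + d0 * w).
have FE : F = fun w => (p + d0 * w) + rem w.
  by apply/funext => w; rewrite /rem addrC subrK.
have Haff z : holo (fun w => p + d0 * w) z.
  by apply: holoD; [exact: holo_cst|apply: holoM; [exact: holo_cst|exact: holo_id]].
have Hrem x' y' : a <= x' <= b -> c <= y' <= d -> holo rem (x' +i* y').
  by move=> xab ycd; apply: holoB; [exact: H|exact: Haff].
have irem : rintegrable rem a b c d.
  by apply: holo_rintegrable => // x' y' xab ycd _; exact: Hrem.
rewrite FE rintD//; last first.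
  by apply: holo_rintegrable => // x' y' _ _ _; exact: Haff.
rewrite rint_affine// add0r.
set s := (b - a) + (d - c).
have -> : e * s ^+ 2 = 2 * (e / 2 * s) * s by field.
apply: cabs_rint_le => // x' y' /andP[xa xb] /andP[ya yb] _.
have xy : cabs ((x' +i* y') - (x +i* y)) <= s.
  by apply: le_trans (cabs_le_ReIm _) _; apply: lerD; rewrite /= ler_norml; lra.
rewrite /rem (_ : F _ - _ = F (x' +i* y') - F (x +i* y) - ((x' +i* y') - (x +i* y)) * d0).
  apply: le_trans (Hd0 _ (le_lt_trans xy lr)) _.
  by rewrite ler_pM2l// divr_gt0.
by rewrite /p; ring.
Qed.

(** If the contour integral were larger than [e] times the square of the
    size, repeated quartering would give rectangles with the same property
    shrinking to a point, where the first order expansion forbids it. *)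
Theorem goursat F a b c d : a <= b -> c <= d ->
  (forall x y, a <= x <= b -> c <= y <= d -> holo F (x +i* y)) ->
  rint F a b c d = 0.
Proof.
move=> ab cd H; set l := b - a; set m := d - c.
have l0 : 0 <= l by rewrite subr_ge0.
have m0 : 0 <= m by rewrite subr_ge0.
have p2 k n : 0 <= k -> 0 <= k / 2 ^+ n :> R.
  by move=> k0; rewrite divr_ge0// exprn_ge0.
suff key e : 0 < e -> cabs (rint F a b c d) <= e * (l + m) ^+ 2.
  apply: cabs_eq0; apply/le_anti; rewrite cabs_ge0 andbT.
  apply/ler_addgt0Pr => e e0; rewrite add0r.
  have q0 : 0 < 1 + (l + m) ^+ 2 by rewrite ltr_wpDr// sqr_ge0.
  apply: le_trans (key (e / (1 + (l + m) ^+ 2)) _) _; first by rewrite divr_gt0.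
  rewrite mulrAC -mulrA ger_pMr// ler_pdivrMr// mul1r lerDr ler01//.
move=> e0; rewrite leNgt; apply/negP => Hbad.
(* A rectangle of generation [n] is given by its lower left corner. *)
pose bad n (p : R * R) := e * (l / 2 ^+ n + m / 2 ^+ n) ^+ 2 <
  cabs (rint F p.1 (p.1 + l / 2 ^+ n) p.2 (p.2 + m / 2 ^+ n)).
pose inside n (p : R * R) := [/\ a <= p.1, p.1 + l / 2 ^+ n <= b, c <= p.2
  & p.2 + m / 2 ^+ n <= d].
pose T := {q : nat * (R * R) | bad q.1 q.2 /\ inside q.1 q.2}.
have hS k n : k / 2 ^+ n / 2 = k / 2 ^+ n.+1 :> R.
  by rewrite exprS invfM; field; rewrite expf_neq0.
have hS2 k n : k / 2 ^+ n.+1 + k / 2 ^+ n.+1 = k / 2 ^+ n :> R.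
  by rewrite -hS; field; rewrite expf_neq0.
have step (q : T) : {q' : T | (sval q').1 = (sval q).1.+1 /\
   ((sval q').2.1 = (sval q).2.1 \/
    (sval q').2.1 = (sval q).2.1 + l / 2 ^+ (sval q).1.+1) /\
   ((sval q').2.2 = (sval q).2.2 \/
    (sval q').2.2 = (sval q).2.2 + m / 2 ^+ (sval q).1.+1)}.
  case: q => -[n [u v]] [/= Hb [/= i1 i2 i3 i4]].
  apply: cid.
  have := @rint_quarter F u (u + l / 2 ^+ n) v (v + m / 2 ^+ n) e.
  have -> : u + l / 2 ^+ n - u = l / 2 ^+ n by ring.
  have -> : v + m / 2 ^+ n - v = m / 2 ^+ n by ring.
  rewrite !lerDl !p2// => /(_ isT isT).
  have Hin : forall x y, u <= x <= u + l / 2 ^+ n -> v <= y <= v + m / 2 ^+ n ->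
      holo F (x +i* y).
    move=> x y /andP[x1 x2] /andP[y1 y2]; apply: H.
      by rewrite (le_trans i1 x1) (le_trans x2).
    by rewrite (le_trans i3 y1) (le_trans y2).
  move=> /(_ Hin Hb)[p [p1 p2']]; rewrite !hS => Hp.
  have in' : inside n.+1 p.
    have q1 := p2 l n.+1 l0; have q2 := p2 m n.+1 m0.
    have e1 := hS2 l n; have e2 := hS2 m n; rewrite /inside.
    split.
    - by case: p1 => ->; lra.
    - by case: p1 => ->; lra.
    - by case: p2' => ->; lra.
    - by case: p2' => ->; lra.
  by exists (exist _ (n.+1, p) (conj Hp in')); rewrite /= -!hS.
have [q0 q00] : {q : T | sval q = (0%N, (a, c))}.
  suff P0 : bad 0%N (a, c) /\ inside 0%N (a, c).
    by exists (exist _ (0%N, (a, c)) P0).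
  have aE : a + l = b by rewrite /l; ring.
  have cE : c + m = d by rewrite /m; ring.
  by split; rewrite /bad /inside /= expr0 !divr1 aE cE.
pose q n := iter n (fun t : T => sval (step t)) q0.
pose u n := (sval (q n)).2.1; pose v n := (sval (q n)).2.2.
have q1 n : (sval (q n)).1 = n.
  elim: n => [|n IH]; first by rewrite /q/= q00.
  rewrite /q iterS -/(q n); case: (step (q n)) => q' [/= -> _].
  by rewrite IH.
have [x Hx] : exists x, forall n, u n <= x <= u n + l / 2 ^+ n.
  apply: nested_segments => // n; rewrite /u /q iterS -/(q n).
  by case: (step (q n)) => q' [/= _ [+ _]]; rewrite q1.
have [y Hy] : exists y, forall n, v n <= y <= v n + m / 2 ^+ n.
  apply: nested_segments => // n; rewrite /v /q iterS -/(q n).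
  by case: (step (q n)) => q' [/= _ [_ +]]; rewrite q1.
have badn n : bad n (u n, v n) /\ inside n (u n, v n).
  rewrite /u /v -{1 4}(q1 n); case: (q n) => -[k [u' v']] /= [].
  by split.
have Fz : holo F (x +i* y).
  have [_ [/= i1 i2 i3 i4]] := badn 0%N.
  by have /andP[x1 x2] := Hx 0%N; have /andP[y1 y2] := Hy 0%N; apply: H; lra.
have [d0 Hd0] := (holo_epsP F _).1 Fz.
have [r r0 {}Hd0] := Hd0 (e / 2) (divr_gt0 e0 (ltr0n _ 2)).
have [n Hn] := small_halving (l + m) r0.
have [Hb [/= i1 i2 i3 i4]] := badn n.
have /andP[x1 x2] := Hx n; have /andP[y1 y2] := Hy n.
move: Hb; rewrite /bad /=; apply/negP; rewrite -leNgt.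
have Hin x' y' : u n <= x' <= u n + l / 2 ^+ n -> v n <= y' <= v n + m / 2 ^+ n ->
    holo F (x' +i* y').
  move=> /andP[xa xb] /andP[ya yb]; apply: H.
    by rewrite (le_trans i1 xa) (le_trans xb i2).
  by rewrite (le_trans i3 ya) (le_trans yb i4).
have ul : u n + l / 2 ^+ n - u n = l / 2 ^+ n by rewrite addrC addKr.
have vm : v n + m / 2 ^+ n - v n = m / 2 ^+ n by rewrite addrC addKr.
have := @rint_first_order F _ _ _ _ x y e r d0 (Hx n) (Hy n) Hin Hd0 e0.
by rewrite ul vm; apply; rewrite -mulrDl.
Qed.

Lemma rint_shrink q (a b c d a' b' c' d' x0 y0 : R) :
  a <= a' -> a' < x0 -> x0 < b' -> b' <= b ->
  c <= c' -> c' < y0 -> y0 < d' -> d' <= d ->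
  (forall x y, a <= x <= b -> c <= y <= d -> (x != x0) || (y != y0) ->
     holo q (x +i* y)) ->
  rint q a b c d = rint q a' b' c' d'.
Proof.
move=> aa ax xb contour_ratio cc cy yd dd H.
have [a'b a'b' ab'] : [/\ a' <= b, a' <= b' & a <= b'] by split; lra.
have [c'd c'd' cd'] : [/\ c' <= d, c' <= d' & c <= d'] by split; lra.
have hs y : c <= y <= d -> y != y0 -> forall a1 b1, a <= a1 -> b1 <= b ->
    cintegrable `[a1, b1] (fun x => q (x +i* y)).
  move=> ycd yy a1 b1 a1a b1b; apply: holo_hslice_integrable => x /andP[xa xb'].
  by apply: H; rewrite ?yy ?orbT// (le_trans a1a xa) (le_trans xb').
have vs x : a <= x <= b -> x != x0 -> forall c1 d1, c <= c1 -> d1 <= d ->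
    cintegrable `[c1, d1] (fun y => q (x +i* y)).
  move=> xab xx c1 d1 c1c d1d; apply: holo_vslice_integrable => y /andP[yc yd'].
  by apply: H; rewrite ?xx// (le_trans c1c yc) (le_trans yd').
have G a1 b1 c1 d1 : a <= a1 -> a1 <= b1 -> b1 <= b -> c <= c1 -> c1 <= d1 ->
    d1 <= d -> (forall x y, a1 <= x <= b1 -> c1 <= y <= d1 -> (x != x0) || (y != y0)) ->
    rint q a1 b1 c1 d1 = 0.
  move=> h1 h2 h3 h4 h5 h6 h7; apply: goursat => // x y xab ycd.
  apply: H; last exact: h7.
    by case/andP: xab => u v; rewrite (le_trans h1 u) (le_trans v).
  by case/andP: ycd => u v; rewrite (le_trans h4 u) (le_trans v).
have [lc ld] : c <= c <= d /\ c <= d <= d by split; lra.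
have [la' lb'] : a <= a' <= b /\ a <= b' <= b by split; lra.
have [lc' ld'] : c <= c' <= d /\ c <= d' <= d by split; lra.
have yc : c != y0 by rewrite lt_eqF// (le_lt_trans cc).
have yd1 : d != y0 by rewrite gt_eqF// (lt_le_trans yd).
have xa : a' != x0 by rewrite lt_eqF.
have xb1 : b' != x0 by rewrite gt_eqF.
rewrite (@rint_splitx _ _ a a' b) //; [|exact: hs|exact: hs].
rewrite (G a a' c d) ?add0r//; last 2 first.
- by case/andP: lc.
- by move=> x y /andP[_ xa'] _; rewrite lt_eqF// (le_lt_trans xa').
rewrite (@rint_splitx _ _ a' b' b) //; [|exact: hs|exact: hs].
rewrite (G b' b c d) ?addr0//; last 2 first.
- by case/andP: lc.
- by move=> x y /andP[xa' _] _; rewrite gt_eqF// (lt_le_trans xb).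
rewrite (@rint_splity _ _ _ _ c c' d)//; [|exact: vs|exact: vs].
rewrite (G a' b' c c') ?add0r//; last first.
  by move=> x y _ /andP[_ ya']; rewrite (lt_eqF (le_lt_trans ya' cy)) orbT.
rewrite (@rint_splity _ _ _ _ c' d' d)//; [|exact: vs|exact: vs].
rewrite (G a' b' d' d) ?addr0//.
by move=> x y _ /andP[ya' _]; rewrite (gt_eqF (lt_le_trans yd ya')) orbT.
Qed.

(** The quotient [(F z - F z0) / (z - z0)] is bounded near [z0], so that its
    contour integral over a small square around [z0] is small; outside of that
    square the quotient is holomorphic. *)
Theorem cauchy_rectangle F (a b c d x0 y0 : R) : a < x0 < b -> c < y0 < d ->
  (forall x y, a <= x <= b -> c <= y <= d -> holo F (x +i* y)) ->
  rint (fun z => F z / (z - (x0 +i* y0))) a b c d =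
  F (x0 +i* y0) * rint (fun z => (z - (x0 +i* y0))^-1) a b c d.
Proof.
move=> /andP[ax xb] /andP[cy yd] H; set z0 := x0 +i* y0.
pose q z := (F z - F z0) / (z - z0).
have zne x y : (x != x0) || (y != y0) -> (x +i* y) - z0 != 0.
  move=> xy; rewrite subr_eq0 eq_complex/= negb_and; exact: xy.
have Hinv x y : (x != x0) || (y != y0) -> holo (fun z => (z - z0)^-1) (x +i* y).
  move=> xy; apply: holoV; first exact: zne.
  by apply: holoB; [exact: holo_id|exact: holo_cst].
have Hq x y : a <= x <= b -> c <= y <= d -> (x != x0) || (y != y0) -> holo q (x +i* y).
  move=> xab ycd xy; apply: holoM; last exact: Hinv.
  by apply: holoB; [exact: H|exact: holo_cst].
have [ab cd] : a <= b /\ c <= d by split; lra.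
have bdry x y : [|| x == a, x == b, y == c | y == d] -> (x != x0) || (y != y0).
  case/or4P => /eqP ->; apply/orP.
  - by left; rewrite lt_eqF.
  - by left; rewrite gt_eqF.
  - by right; rewrite lt_eqF.
  - by right; rewrite gt_eqF.
have q0 : rint q a b c d = 0; last first.
  have iq : rintegrable q a b c d.
    by apply: holo_rintegrable => // x y xab ycd /bdry; exact: Hq.
  have iv : rintegrable (fun z => (z - z0)^-1) a b c d.
    by apply: holo_rintegrable => // x y xab ycd /bdry; exact: Hinv.
  rewrite -rintZ// -[RHS]add0r -q0 -rintD//; last exact: rintegrableZ.
  by congr (rint _ a b c d); apply/funext => z; rewrite /q mulrBl subrK.
have [r r0 [k Hk]] : exists2 r, 0 < r & exists k, forall z, cabs (z - z0) < r -> cabs (q z) <= k.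
  have /holo_epsP[d0 /(_ _ ltr01)[r r0 Hr]] : holo F z0 by apply: H; lra.
  exists r => //; exists (1 + cabs d0) => z zr; rewrite /q.
  have [->|zz0] := eqVneq z z0.
    by rewrite subrr mul0r cabs0 addr_ge0// cabs_ge0.
  have zz := cabs_gt0 (_ : z - z0 != 0); rewrite subr_eq0 in zz.
  rewrite cabsM cabsV ler_pdivrMr ?zz//.
  have -> : F z - F z0 = (F z - F z0 - (z - z0) * d0) + (z - z0) * d0 by ring.
  apply: le_trans (cabsD _ _) _; rewrite [leRHS]mulrDl; apply: lerD; first exact: Hr.
  by rewrite cabsM mulrC.
apply: cabs_eq0; apply/le_anti; rewrite cabs_ge0 andbT.
apply/ler_addgt0Pr => e e0; rewrite add0r.
have k0 : 0 <= k.
  by apply: le_trans (cabs_ge0 _) (Hk z0 _); rewrite subrr cabs0.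
pose M := Num.min (Num.min (x0 - a) (b - x0)) (Num.min (y0 - c) (d - y0)).
(* The perimeter of the square is [8 h], and the quotient is at most [k]. *)
pose h := Num.min (Num.min M (r / 3)) (e / (8 * (k + 1))).
have M0 : 0 < M by rewrite !lt_min !subr_gt0 ax xb cy yd.
have h0 : 0 < h.
  rewrite lt_min; apply/andP; split; last by rewrite divr_gt0// mulr_gt0// ltr_wpDl.
  by rewrite lt_min M0 divr_gt0.
have [h1 h2 h3 h4] : [/\ h <= x0 - a, h <= b - x0, h <= y0 - c & h <= d - y0].
  have hM : h <= M by rewrite /h ge_min ge_min lexx.
  by split; apply: le_trans hM _; rewrite !ge_min lexx ?orbT.
have hr : h <= r / 3 by rewrite /h ge_min ge_min lexx !orbT.
have he : h <= e / (8 * (k + 1)) by rewrite /h ge_min lexx orbT.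
clearbody h M.
have [xl xr] : x0 - h < x0 /\ x0 < x0 + h by rewrite ltrBlDr !ltrDl.
have [yl yr] : y0 - h < y0 /\ y0 < y0 + h by rewrite ltrBlDr !ltrDl.
rewrite (@rint_shrink q a b c d (x0 - h) (x0 + h) (y0 - h) (y0 + h) x0 y0)//; last 4 first.
- by rewrite lerBrDr -lerBrDl.
- by rewrite -lerBrDl.
- by rewrite lerBrDr -lerBrDl.
- by rewrite -lerBrDl.
have Hq' x y : x0 - h <= x <= x0 + h -> y0 - h <= y <= y0 + h ->
    (x != x0) || (y != y0) -> holo q (x +i* y).
  move=> /andP[xa' xb'] /andP[ya' yb']; apply: Hq.
    by apply/andP; split; lra.
  by apply/andP; split; lra.
apply: (@le_trans _ _ (2 * k * ((x0 + h - (x0 - h)) + (y0 + h - (y0 - h))))).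
  have [xlr ylr] := (ltW (lt_trans xl xr), ltW (lt_trans yl yr)).
  apply: cabs_rint_le => //.
    apply: holo_rintegrable => // x y xab ycd bd; apply: Hq' => //.
    case/or4P: bd => /eqP ->.
    - by rewrite (lt_eqF xl).
    - by rewrite (gt_eqF xr).
    - by rewrite (lt_eqF yl) orbT.
    - by rewrite (gt_eqF yr) orbT.
  move=> x y /andP[xa' xb'] /andP[ya' yb'] _; apply: Hk.
  apply: le_lt_trans (cabs_le_ReIm _) _ => /=.
  have xh : `|x - x0| <= h by rewrite ler_norml; lra.
  have yh : `|y - y0| <= h by rewrite ler_norml; lra.
  by lra.
have -> : 2 * k * ((x0 + h - (x0 - h)) + (y0 + h - (y0 - h))) = h * (8 * k) by ring.
apply: le_trans (_ : h * (8 * (k + 1)) <= _).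
  by rewrite ler_pM2l//; lra.
by rewrite -ler_pdivlMr// mulr_gt0// ltr_wpDl.
Qed.

Lemma ge_Rintegral_itv (f : R -> R) (a b k : R) : a <= b ->
  mu.-integrable `[a, b] (EFin \o f) -> (forall x, a <= x <= b -> k <= f x) ->
  k * (b - a) <= \int[mu]_(x in `[a, b]) f x.
Proof.
move=> ab fi fk; rewrite -fine_mu_itv// -Rintegral_cst//.
by apply: le_Rintegral => //; exact: cst_integrable_itv.
Qed.

(** All four sides contribute positively to the imaginary part; the bottom
    side alone gives the stated bound. *)
Lemma winding_ge (a b c d x0 y0 : R) : a < x0 -> c < y0 < d -> y0 - c <= b - x0 ->
  1 / 2 <= cabs (rint (fun z : R[i] => (z - (x0 +i* y0))^-1) a b c d).
Proof.
move=> ax /andP[cy yd] cb; set z0 := x0 +i* y0; set q := fun z => (z - z0)^-1.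
set s := y0 - c; have s0 : 0 < s by rewrite subr_gt0.
have xb : x0 < b by rewrite -subr_gt0; exact: lt_le_trans cb.
have zne x y : (x != x0) || (y != y0) -> (x +i* y) - z0 != 0.
  move=> xy; rewrite subr_eq0 eq_complex/= negb_and; exact: xy.
have Hinv x y : (x != x0) || (y != y0) -> holo q (x +i* y).
  move=> xy; apply: holoV; first exact: zne.
  by apply: holoB; [exact: holo_id|exact: holo_cst].
have [ab cd] : a <= b /\ c <= d by split; lra.
have [[_ i1] [_ i2] [i3 _] [i4 _]] : rintegrable q a b c d.
  apply: holo_rintegrable => // x y xab ycd; case/or4P => /eqP ->; apply: Hinv.
  - by rewrite lt_eqF.
  - by rewrite gt_eqF.
  - by rewrite (lt_eqF cy) orbT.
  - by rewrite (gt_eqF yd) orbT.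
apply: le_trans (Im_le_cabs _); apply: le_trans (ler_norm _).
have IE : complex.Im (rint q a b c d) =
  \int[mu]_(x in `[a, b]) complex.Im (q (x +i* c)) -
  \int[mu]_(x in `[a, b]) complex.Im (q (x +i* d)) +
  (\int[mu]_(y in `[c, d]) complex.Re (q (b +i* y)) -
   \int[mu]_(y in `[c, d]) complex.Re (q (a +i* y))).
  by rewrite /rint /= mul0r mul1r add0r.
have qRe x y : complex.Re (q (x +i* y)) = (x - x0) / ((x - x0) ^+ 2 + (y - y0) ^+ 2).
  by [].
have qIm x y : complex.Im (q (x +i* y)) = (y0 - y) / ((x - x0) ^+ 2 + (y - y0) ^+ 2).
  by rewrite /q /= -mulNr opprB.
have sq x y : 0 <= ((x - x0) ^+ 2 + (y - y0) ^+ 2)^-1.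
  by rewrite invr_ge0 addr_ge0// sqr_ge0.
rewrite IE.
have J1 : 1 / 2 <= \int[mu]_(x in `[a, b]) complex.Im (q (x +i* c)).
  have xsb : x0 + s <= b by rewrite -lerBrDl.
  have ips : forall a' b', a <= a' -> b' <= b -> mu.-integrable `[a', b'] (EFin \o (fun x => complex.Im (q (x +i* c)))).
    move=> a' b' aa contour_ratio; apply: (@integrableS _ _ _ mu `[a, b]) => // x/=.
    by rewrite !in_itv/= => /andP[? ?]; lra.
  have pos a' b' : 0 <= \int[mu]_(x in `[a', b']) complex.Im (q (x +i* c)).
    by apply: Rintegral_ge0 => x _; rewrite qIm mulr_ge0// ltW.
  rewrite (@Rintegral_itv_split _ a x0 b)//; [|lra|lra].
  rewrite (@Rintegral_itv_split _ x0 (x0 + s) b)//; [|lra|apply: ips; lra].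
  rewrite -[1 / 2]add0r; apply: lerD; first exact: pos.
  rewrite -[_ / 2]addr0; apply: lerD; last exact: pos.
  apply: le_trans (@ge_Rintegral_itv _ x0 (x0 + s) ((2 * s)^-1) _ _ _).
  - by rewrite (_ : (2 * s)^-1 * _ = 1 / 2)//; field; rewrite gt_eqF.
  - by lra.
  - by apply: ips; lra.
  - move=> x /andP[x1 x2]; rewrite qIm -/s.
    have D0 : 0 < (x - x0) ^+ 2 + (c - y0) ^+ 2.
      by rewrite ltr_wpDl ?sqr_ge0// exprn_even_gt0//= lt_eqF// subr_lt0.
    rewrite ler_pdivlMr// mulrC ler_pdivrMr ?mulr_gt0//.
    have : (x - x0) ^+ 2 <= s ^+ 2 by apply: lerXn2r;
      [rewrite nnegrE subr_ge0|rewrite nnegrE ltW|rewrite lerBlDl].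
    rewrite (_ : (c - y0) ^+ 2 = s ^+ 2); last by rewrite /s; ring.
    by lra.
have J2 : \int[mu]_(x in `[a, b]) complex.Im (q (x +i* d)) <= 0.
  rewrite -oppr_ge0 -mulN1r -RintegralZl//.
  by apply: Rintegral_ge0 => x _; rewrite qIm mulN1r -mulNr mulr_ge0// opprB subr_ge0 ltW.
have J3 : 0 <= \int[mu]_(y in `[c, d]) complex.Re (q (b +i* y)).
  by apply: Rintegral_ge0 => x _; rewrite qRe mulr_ge0// subr_ge0 ltW.
have J4 : \int[mu]_(y in `[c, d]) complex.Re (q (a +i* y)) <= 0.
  rewrite -oppr_ge0 -mulN1r -RintegralZl//.
  by apply: Rintegral_ge0 => x _; rewrite qRe mulN1r -mulNr mulr_ge0// opprB subr_ge0 ltW.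
apply: (@le_trans _ _ (1 / 2 - 0 + (0 - 0))); first by rewrite !subr0 addr0.
by apply: lerD; apply: lerB.
Qed.

End Goursat.

(** * The complex exponential and Laplace transforms *)

Section ComplexExponential.
Context {R : realType}.

Definition cexp (z : R[i]) : R[i] :=
  (expR (complex.Re z) * cos (complex.Im z)) +i* (expR (complex.Re z) * sin (complex.Im z)).

Lemma cexp0 : cexp 0 = 1.
Proof. by rewrite /cexp /= expR0 cos0 sin0 mulr1 mulr0. Qed.

Lemma cexpD z w : cexp (z + w) = cexp z * cexp w.
Proof.
apply: complex_eq; rewrite ?ReM ?ImM /cexp !ReD !ImD expRD /=.
  by rewrite cosD; ring.
by rewrite sinD; ring.
Qed.

Lemma cabs_cexp z : cabs (cexp z) = expR (complex.Re z).
Proof.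
rewrite cabs_def /cexp /= !exprMn -mulrDr cos2Dsin2 mulr1 sqrtr_sqr ger0_norm//.
Qed.

Lemma expR_sub1_le (a : R) : expR a - 1 <= a * expR a.
Proof.
have := expR_ge1Dx (- a); rewrite -(ler_pM2r (expR_gt0 a)) expRN mulVf ?gt_eqF ?expR_gt0//.
by rewrite mulrDl mulNr mul1r; lra.
Qed.

Lemma expR_ge1_norm (a : R) : 1 <= expR `|a|.
Proof. by apply: le_trans (expR_ge1Dx _); rewrite lerDl. Qed.

Lemma norm_expR_sub1 (a : R) : `|expR a - 1| <= `|a| * expR `|a|.
Proof.
have := expR_sub1_le a; have := expR_ge1Dx a; have := expR_ge1_norm a.
case: (ger0P a) => a0 h1 h2 h3.
  by rewrite ger0_norm//; lra.
rewrite ltr0_norm; last by rewrite subr_lt0 expR_lt1.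
apply: le_trans (_ : - a <= _); first by lra.
by rewrite ler_peMr//; lra.
Qed.

Lemma norm_expR_sub2 (a : R) : `|expR a - 1 - a| <= `|a| ^+ 2 * expR `|a|.
Proof.
have := expR_sub1_le a; have := expR_ge1Dx a => h1 h2.
rewrite ger0_norm; last by lra.
apply: le_trans (_ : a * (expR a - 1) <= _); first by lra.
apply: le_trans (ler_norm _) _; rewrite normrM expr2 -mulrA ler_wpM2l//.
exact: norm_expR_sub1.
Qed.

Lemma mvt_bound (f df : R -> R) (x k : R) :
  (forall y, is_derive y (1 : R) f (df y)) -> f 0 = 0 ->
  (forall y, `|y| <= `|x| -> `|df y| <= k) -> `|f x| <= k * `|x|.
Proof.
move=> fdf f0 dfk.
have cf a b : {within `[a, b], continuous f}.
  apply: continuous_subspaceT => y; apply: differentiable_continuous.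
  by apply/derivable1_diffP; have := fdf y; case.
have [x0|x0] := lerP 0 x.
  have [c] := MVT_segment x0 (fun y _ => fdf y) (cf _ _).
  rewrite in_itv/= f0 !subr0 => /andP[c0 cx] ->.
  by rewrite normrM ler_wpM2r// dfk// !ger0_norm.
have [c] := MVT_segment (ltW x0) (fun y _ => fdf y) (cf _ _).
rewrite in_itv/= f0 !sub0r => /andP[c0 cx] E.
rewrite -normrN E normrM normrN ler_wpM2r// dfk//.
by rewrite !ler0_norm ?lerN2// ltW.
Qed.

Lemma norm_sin_le (b : R) : `|sin b| <= `|b|.
Proof.
rewrite -[leRHS]mul1r; apply: (mvt_bound (df := cos)) => //; first exact: sin0.
by move=> y _; exact: cos_max.
Qed.

Lemma norm_cos_sub1 (b : R) : `|cos b - 1| <= `|b| * `|b|.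
Proof.
apply: (mvt_bound (f := fun y => cos y - 1) (df := fun y => - sin y)).
- by move=> y; apply: is_derive_eq; rewrite subr0.
- by rewrite cos0 subrr.
- move=> y yb; rewrite normrN; exact: le_trans (norm_sin_le _) yb.
Qed.

Lemma norm_cos_sub1' (b : R) : `|cos b - 1| <= `|b|.
Proof.
rewrite -[leRHS]mul1r.
apply: (mvt_bound (f := fun y => cos y - 1) (df := fun y => - sin y)).
- by move=> y; apply: is_derive_eq; rewrite subr0.
- by rewrite cos0 subrr.
- by move=> y yb; rewrite normrN; exact: sin_max.
Qed.

Lemma norm_sin_sub (b : R) : `|sin b - b| <= `|b| * `|b|.
Proof.
apply: (mvt_bound (f := fun y => sin y - y) (df := fun y => cos y - 1)).
- by rewrite sin0 subrr.
- move=> y yb; exact: le_trans (norm_cos_sub1' _) yb.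
Qed.

(** Second order Taylor estimate, from the real one and from those of [cos]
    and [sin] through
    [exp (a + ib) - 1 - a - ib = (exp a - 1)(exp (ib) - 1)
       + (exp a - 1 - a) + (exp (ib) - 1 - ib)]. *)
Lemma cexp_taylor2 z : cabs (cexp z - 1 - z) <= 5 * cabs z ^+ 2 * expR (cabs z).
Proof.
set a := complex.Re z; set b := complex.Im z; set r := cabs z.
have ar : `|a| <= r by exact: Re_le_cabs.
have br : `|b| <= r by exact: Im_le_cabs.
have r0 : 0 <= r by exact: cabs_ge0.
have er : expR `|a| <= expR r by rewrite ler_expR.
have er1 : 1 <= expR r by apply: le_trans (expR_ge1_norm a) er.
pose e1 : R[i] := (expR a - 1)%:C; pose e2 : R[i] := (cos b - 1) +i* sin b.
pose e3 : R[i] := (expR a - 1 - a)%:C; pose e4 : R[i] := (cos b - 1) +i* (sin b - b).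
have -> : cexp z - 1 - z = e1 * e2 + e3 + e4.
  by apply: complex_eq; rewrite ?ReD ?ImD ?ReN ?ImN ?ReM ?ImM /e1 /e2 /e3 /e4 /cexp /= -/a -/b; ring.
have q1 : cabs e1 <= r * expR r.
  rewrite cabs_real; apply: le_trans (norm_expR_sub1 _) _.
  by apply: ler_pM => //; exact: expR_ge0.
have q2 : cabs e2 <= 2 * r.
  apply: le_trans (cabs_le_ReIm _) _ => /=; rewrite mulr2n mulrDl mul1r.
  apply: lerD; apply: le_trans br; [exact: norm_cos_sub1'|exact: norm_sin_le].
have rr : `|b| * `|b| <= r ^+ 2 by rewrite expr2; apply: ler_pM.
have q3 : cabs e3 <= r ^+ 2 * expR r.
  rewrite cabs_real; apply: le_trans (norm_expR_sub2 _) _.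
  apply: ler_pM; rewrite ?exprn_ge0 ?expR_ge0//.
  by apply: lerXn2r; rewrite ?nnegrE.
have q4 : cabs e4 <= 2 * r ^+ 2.
  apply: le_trans (cabs_le_ReIm _) _ => /=; rewrite mulr2n mulrDl mul1r.
  by apply: lerD; apply: le_trans rr; [exact: norm_cos_sub1|exact: norm_sin_sub].
have q12 : cabs (e1 * e2) <= 2 * r ^+ 2 * expR r.
  rewrite cabsM (_ : 2 * r ^+ 2 * expR r = (r * expR r) * (2 * r)); last by ring.
  by apply: ler_pM => //; exact: cabs_ge0.
have q5 : 2 * r ^+ 2 <= 2 * r ^+ 2 * expR r.
  by rewrite ler_peMr// mulr_ge0// exprn_ge0.
apply: le_trans (cabsD _ _) _.
apply: le_trans (lerD (le_trans (cabsD _ _) (lerD q12 q3)) (le_trans q4 q5)) _.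
by rewrite le_eqVlt; apply/orP; left; apply/eqP; ring.
Qed.

Lemma holo_cexp z : holo cexp z.
Proof.
apply/holo_epsP; exists (cexp z) => e e0.
set k := 5 * expR 1 * cabs (cexp z) + 1.
have k0 : 0 < k.
  by rewrite ltr_wpDl// mulr_ge0 ?cabs_ge0// mulr_ge0// expR_ge0.
exists (Num.min 1 (e / k)); first by rewrite lt_min ltr01 divr_gt0.
move=> w; set h := w - z; rewrite lt_min => /andP[h1 hk].
have -> : w = z + h by rewrite /h addrC subrK.
have -> : cexp (z + h) - cexp z - h * cexp z = cexp z * (cexp h - 1 - h).
  by rewrite cexpD; ring.
rewrite cabsM; apply: le_trans (ler_wpM2l (cabs_ge0 _) (cexp_taylor2 h)) _.
have e1 : expR (cabs h) <= expR 1 by rewrite ler_expR ltW.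
apply: (@le_trans _ _ (cabs (cexp z) * (5 * cabs h ^+ 2 * expR 1))).
  by rewrite ler_wpM2l ?cabs_ge0// ler_wpM2l// mulr_ge0// exprn_ge0// cabs_ge0.
rewrite (_ : _ * _ = cabs h * (5 * expR 1 * cabs (cexp z)) * cabs h); last by ring.
rewrite ler_wpM2r ?cabs_ge0//.
apply: (@le_trans _ _ (cabs h * k)).
  by rewrite ler_wpM2l ?cabs_ge0// lerDl.
by rewrite -ler_pdivlMr// ltW.
Qed.

Lemma holo_comp (F G : R[i] -> R[i]) z : holo F z -> holo G (F z) ->
  holo (fun w => G (F w)) z.
Proof.
move=> /derivable1_diffP dF /derivable1_diffP dG; apply/derivable1_diffP.
exact: (@differentiable_comp _ (R[i])^o (R[i])^o (R[i])^o F G z dF dG).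
Qed.

End ComplexExponential.

Opaque cexp.

Section Laplace.
Context {R : realType}.
Local Notation mu := (@lebesgue_measure R).

Definition cmeasurable (D : set R) (f : R -> R[i]) : Prop :=
  measurable_fun D (fun x => complex.Re (f x)) /\
  measurable_fun D (fun x => complex.Im (f x)).

Lemma cmeasurableM D f g : cmeasurable D f -> cmeasurable D g ->
  cmeasurable D (fun x => f x * g x).
Proof.
move=> [f1 f2] [g1 g2]; split.
- by under eq_fun do rewrite ReM; apply: measurable_funB; exact: measurable_funM.
- by under eq_fun do rewrite ImM; apply: measurable_funD; exact: measurable_funM.
Qed.

Lemma cmeasurable_real D (f : R -> R) : measurable_fun D f ->
  cmeasurable D (fun x => (f x)%:C).
Proof. by move=> mf; split => //=; exact: measurable_cst. Qed.

Lemma cmeasurable_cexp D f : cmeasurable D f -> cmeasurable D (fun x => cexp (f x)).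
Proof.
move=> [f1 f2].
have m1 : measurable_fun D (fun x => expR (complex.Re (f x))).
  apply: (measurableT_comp _ f1); apply: continuous_measurable_fun.
  exact: continuous_expR.
split; apply: measurable_funM => //; apply: (measurableT_comp _ f2);
  apply: continuous_measurable_fun; [exact: continuous_cos|exact: continuous_sin].
Qed.

Lemma cmeasurable_kernel D (l : R[i]) : cmeasurable D (fun s : R => cexp (- (s%:C * l))).
Proof.
apply: cmeasurable_cexp; split.
- by apply: (eq_measurable_fun (fun s => - complex.Re l * s)) => [s _|];
    rewrite ?ReN ?ReM /=; [ring|exact: mulrl_measurable].
- by apply: (eq_measurable_fun (fun s => - complex.Im l * s)) => [s _|];
    rewrite ?ImN ?ImM /=; [ring|exact: mulrl_measurable].
Qed.

Definition laplace (D : set R) (u : R -> R[i]) (l : R[i]) : R[i] :=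
  cint D (fun s => cexp (- (s%:C * l)) * u s).

Section Domination.
Variables (D : set R) (u : R -> R[i]) (h : R -> R) (s0 : R).
Hypotheses (mD : measurable D) (D0 : forall s, D s -> 0 <= s)
  (mu_ : cmeasurable D u) (uh : forall s, D s -> cabs (u s) <= h s)
  (hi : forall s1, s0 < s1 ->
     mu.-integrable D (EFin \o (fun s => expR (- (s1 * s)) * h s))).

Lemma cabs_kernel (l : R[i]) (s : R) : cabs (cexp (- (s%:C * l))) = expR (- (complex.Re l * s)).
Proof. by rewrite cabs_cexp ReN ReM /= mul0r subr0 mulrC. Qed.

Lemma laplace_integrable l : s0 < complex.Re l ->
  cintegrable D (fun s => cexp (- (s%:C * l)) * u s).
Proof.
move=> /hi bi; have [m1 m2] := cmeasurableM (cmeasurable_kernel D l) mu_.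
apply: (le_cintegrable mD m1 m2 bi) => s Ds; rewrite cabsM cabs_kernel.
by rewrite ler_wpM2l ?expR_ge0 ?uh.
Qed.

Lemma sqr_le_expR (x : R) : 0 <= x -> x ^+ 2 <= 4 * expR x.
Proof.
move=> x0; have := expR_ge1Dx (x / 2) => h1.
have -> : expR x = expR (x / 2) ^+ 2 by rewrite expr2 -expRD; congr expR; field.
rewrite -[4]/((2 * 2)%:R) natrM -expr2 -exprMn.
by apply: lerXn2r; rewrite ?nnegrE//; lra.
Qed.

(** Differentiation under the integral sign: the difference between the
    increment and its linear part is the transform of [u] against a kernel of
    size [|k|^2 s^2 exp (- (Re l - |k|) s)], and the factor [s^2] costs an
    arbitrarily small part of the exponential decay. *)
Lemma holo_laplace l : s0 < complex.Re l -> holo (laplace D u) l.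
Proof.
move=> ls; set x := complex.Re l; set eta := (x - s0) / 4.
have eta0 : 0 < eta by rewrite divr_gt0// subr_gt0.
have es : s0 < x - 2 * eta by rewrite /eta; lra.
have es1 : s0 < x - eta by lra.
have mk (w : R[i]) : cmeasurable D (fun s => cexp (- (s%:C * w)) * u s).
  exact: cmeasurableM (cmeasurable_kernel D w) mu_.
have di : cintegrable D (fun s => (- s)%:C * (cexp (- (s%:C * l)) * u s)).
  have [m1 m2] : cmeasurable D (fun s => (- s)%:C * (cexp (- (s%:C * l)) * u s)).
    apply: cmeasurableM => //; apply: cmeasurable_real.
    apply: measurable_funTS; apply: continuous_measurable_fun.
    exact: opp_continuous.
  apply: (@le_cintegrable _ _ _ (fun s => eta^-1 * (expR (- ((x - eta) * s)) * h s))) => //.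
    by apply: integrableRZ => //; exact: hi.
  move=> s Ds; rewrite cabsM cabs_real normrN ger0_norm ?D0// cabsM cabs_kernel mulrA.
  rewrite mulrA; apply: ler_pM; rewrite ?cabs_ge0 ?mulr_ge0 ?expR_ge0 ?D0 ?uh//.
  rewrite (_ : - ((x - eta) * s) = eta * s + - (x * s)); last by ring.
  rewrite expRD mulrA ler_wpM2r ?expR_ge0// ler_pdivlMl//.
  by apply: le_trans (expR_ge1Dx _); rewrite lerDr.
apply/holo_epsP; exists (cint D (fun s => (- s)%:C * (cexp (- (s%:C * l)) * u s))) => e e0.
pose J := \int[mu]_(s in D) (expR (- ((x - 2 * eta) * s)) * h s).
have J0 : 0 <= J.
  apply: Rintegral_ge0 => s Ds; rewrite mulr_ge0 ?expR_ge0//.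
  exact: le_trans (cabs_ge0 _) (uh Ds).
pose K := 20 / eta ^+ 2 * J + 1.
have K0 : 0 < K by rewrite ltr_wpDl// mulr_ge0// divr_ge0// exprn_ge0// ltW.
exists (Num.min eta (e / K)); first by rewrite lt_min eta0 divr_gt0.
move=> w; set k := w - l; rewrite lt_min => /andP[ke kK].
have wE : w = l + k by rewrite /k addrC subrK.
have xk : s0 < complex.Re w.
  rewrite wE ReD -/x; have := Re_le_cabs k; rewrite ler_norml => /andP[k1 k2].
  by move: k1 ke es; lra.
rewrite /laplace -cintB//; [|exact: laplace_integrable|exact: laplace_integrable].
rewrite -cintZ// -cintB//; last 2 first.
- by apply: cintegrableB => //; exact: laplace_integrable.
- exact: cintegrableZ.
pose E s := cexp (- (s%:C * l)) * u s * (cexp (- (s%:C * k)) - 1 - (- (s%:C * k))).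
rewrite (@eq_cint _ _ _ E); last first.
  move=> s _; rewrite /E (_ : - (s%:C * w) = - (s%:C * l) + - (s%:C * k)).
    by rewrite cexpD rmorphN /=; ring.
  by rewrite wE; ring.
apply: (@le_trans _ _ (\int[mu]_(s in D)
   ((20 / eta ^+ 2 * cabs k ^+ 2) * (expR (- ((x - 2 * eta) * s)) * h s)))).
  apply: cabs_cint_le => //.
  - apply: (@eq_cintegrable _ _ (fun s => (cexp (- (s%:C * w)) * u s
        - cexp (- (s%:C * l)) * u s) - k * ((- s)%:C * (cexp (- (s%:C * l)) * u s)))) => //.
      move=> s _; rewrite /E (_ : - (s%:C * w) = - (s%:C * l) + - (s%:C * k)).
        by rewrite cexpD rmorphN /=; ring.
      by rewrite wE; ring.
    apply: cintegrableB => //; last exact: cintegrableZ.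
    by apply: cintegrableB => //; exact: laplace_integrable.
  - by apply: integrableRZ => //; exact: hi.
  - move=> s Ds; rewrite /E !cabsM cabs_kernel -/x.
    have s_ge0 := D0 Ds.
    have ck : cabs (- (s%:C * k)) = s * cabs k.
      by rewrite cabsN cabsM cabs_real ger0_norm.
    have := cexp_taylor2 (- (s%:C * k)); rewrite ck => T2.
    rewrite (_ : 20 / _ * _ * (_ * h s) =
      expR (- (x * s)) * h s * (20 / eta ^+ 2 * cabs k ^+ 2 * expR (2 * eta * s))); last first.
      rewrite (_ : - ((x - 2 * eta) * s) = - (x * s) + 2 * eta * s); last by ring.
      by rewrite expRD; ring.
    apply: ler_pM; rewrite ?cabs_ge0 ?mulr_ge0 ?expR_ge0 ?cabs_ge0//.
      by rewrite ler_wpM2l ?expR_ge0 ?uh.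
    apply: le_trans T2 _.
    have sk : expR (s * cabs k) <= expR (eta * s).
      by rewrite ler_expR mulrC ler_wpM2r// ltW.
    have s2 : s ^+ 2 <= 4 / eta ^+ 2 * expR (eta * s).
      have := sqr_le_expR (mulr_ge0 (ltW eta0) s_ge0).
      rewrite exprMn mulrC -ler_pdivlMr ?exprn_gt0// => /le_trans; apply.
      by rewrite le_eqVlt; apply/orP; left; apply/eqP; ring.
    rewrite (_ : 5 * (s * cabs k) ^+ 2 * expR (s * cabs k) =
      (5 * cabs k ^+ 2) * (s ^+ 2 * expR (s * cabs k))); last by ring.
    rewrite (_ : 20 / eta ^+ 2 * cabs k ^+ 2 * expR (2 * eta * s) =
      (5 * cabs k ^+ 2) * (4 / eta ^+ 2 * expR (eta * s) * expR (eta * s))); last first.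
      rewrite (_ : 2 * eta * s = eta * s + eta * s); last by ring.
      by rewrite expRD; field; rewrite gt_eqF.
    rewrite ler_wpM2l ?mulr_ge0 ?exprn_ge0 ?cabs_ge0//.
    by apply: ler_pM; rewrite ?exprn_ge0 ?expR_ge0.
rewrite RintegralZl//; last exact: hi.
rewrite -/J (_ : _ * J = cabs k * (20 / eta ^+ 2 * J) * cabs k); last by ring.
rewrite ler_wpM2r ?cabs_ge0//.
apply: (@le_trans _ _ (cabs k * K)).
  by rewrite ler_wpM2l ?cabs_ge0// lerDl.
by rewrite -ler_pdivlMr// ltW.
Qed.

End Domination.
End Laplace.

(** * Unique continuation and the contour estimate *)

Section UniqueContinuation.
Context {R : realType}.
Implicit Types (F : R[i] -> R[i]).

Lemma cabs_triangle (z w : R[i]) : `|cabs z - cabs w| <= cabs (z - w).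
Proof.
have sub (p q : R[i]) : cabs p - cabs q <= cabs (p - q).
  by rewrite lerBlDr -{1}(subrK q p) cabsD.
rewrite ler_norml sub andbT lerNl opprB; apply: le_trans (sub _ _) _.
by rewrite -cabsN opprB.
Qed.

Lemma holo_hslice_bounded F (a b c : R) : a <= b ->
  (forall x, a <= x <= b -> holo F (x +i* c)) ->
  exists k, forall x, a <= x <= b -> cabs (F (x +i* c)) <= k.
Proof.
move=> ab H; have [|m _ Hm] := @EVT_max R (fun x => cabs (F (x +i* c))) a b ab.
  apply: continuous_in_subspaceT => x; rewrite inE/= in_itv/= => /H /holo_continuous Fx.
  apply: ball_segment => e e0; have [r r0 {}Fx] := Fx e e0; exists r => // y yx.
  apply: le_trans (cabs_triangle _ _) _; apply: Fx.
  have -> : (y +i* c) - (x +i* c) = (y - x)%:C by apply: complex_eq; rewrite /= ?subrr.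
  by rewrite cabs_real.
by exists (cabs (F (m +i* c))) => x xab; apply: Hm; rewrite in_itv.
Qed.

Lemma holo_vslice_bounded F (a c d : R) : c <= d ->
  (forall y, c <= y <= d -> holo F (a +i* y)) ->
  exists k, forall y, c <= y <= d -> cabs (F (a +i* y)) <= k.
Proof.
move=> cd H; have [|m _ Hm] := @EVT_max R (fun y => cabs (F (a +i* y))) c d cd.
  apply: continuous_in_subspaceT => x; rewrite inE/= in_itv/= => /H /holo_continuous Fx.
  apply: ball_segment => e e0; have [r r0 {}Fx] := Fx e e0; exists r => // y yx.
  apply: le_trans (cabs_triangle _ _) _; apply: Fx.
  have -> : (a +i* y) - (a +i* x) = 'i * (y - x)%:C by apply: complex_eq; rewrite /= ; ring.
  by rewrite cabsM cabsi mul1r cabs_real.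
by exists (cabs (F (a +i* m))) => x xab; apply: Hm; rewrite in_itv.
Qed.

Lemma holo_boundary_bounded F (a b c d : R) : a <= b -> c <= d ->
  (forall x y, a <= x <= b -> c <= y <= d -> holo F (x +i* y)) ->
  exists2 k, 0 <= k & forall x y, a <= x <= b -> c <= y <= d ->
    [|| x == a, x == b, y == c | y == d] -> cabs (F (x +i* y)) <= k.
Proof.
move=> ab cd H.
have [|k1 H1] := @holo_hslice_bounded F a b c ab.
  by move=> x xab; apply: H; rewrite ?lexx ?cd.
have [|k2 H2] := @holo_hslice_bounded F a b d ab.
  by move=> x xab; apply: H; rewrite ?lexx ?cd.
have [|k3 H3] := @holo_vslice_bounded F a c d cd.
  by move=> y ycd; apply: H; rewrite ?lexx ?ab.
have [|k4 H4] := @holo_vslice_bounded F b c d cd.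
  by move=> y ycd; apply: H; rewrite ?lexx ?ab.
exists (`|k1| + `|k2| + `|k3| + `|k4|).
  by rewrite !addr_ge0.
move=> x y xab ycd; have n1 := ler_norm k1; have n2 := ler_norm k2.
have n3 := ler_norm k3; have n4 := ler_norm k4.
have m1 := normr_ge0 k1; have m2 := normr_ge0 k2.
have m3 := normr_ge0 k3; have m4 := normr_ge0 k4.
case/or4P => /eqP E; subst.
- by apply: le_trans (H3 y ycd) _; lra.
- by apply: le_trans (H4 y ycd) _; lra.
- by apply: le_trans (H1 x xab) _; lra.
- by apply: le_trans (H2 x xab) _; lra.
Qed.

Lemma expR_decay_le0 (x k g : R) : 0 < g ->
  (forall n : nat, x <= k * expR (- (n%:R * g))) -> x <= 0.
Proof.
move=> g0 H; rewrite leNgt; apply/negP => x0.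
have [n Hn] : exists n : nat, `|k| / (x * g) < n%:R.
  exists (Num.truncn `| `|k| / (x * g)|).+1; apply: le_lt_trans (ler_norm _) _.
  exact: truncnS_gt.
move: Hn; rewrite ltr_pdivrMr ?mulr_gt0// mulrCA => Hn.
have := H n; rewrite expRN ler_pdivlMr ?expR_gt0// => Hx.
have Hn' : x * (1 + n%:R * g) <= k.
  apply: le_trans Hx; rewrite ler_wpM2l ?(ltW x0)//; exact: expR_ge1Dx.
have := le_trans Hn' (ler_norm k); rewrite mulrDr mulr1 mulrCA => Hk.
rewrite mulrCA in Hn; have := lt_le_trans Hn (le_trans _ Hk).
by rewrite lerDr (ltW x0) ltxx => /(_ isT).
Qed.

(** Up to the factor [2 a] the exponent is [x ^ 2 - a ^ 2 - s], by completing the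
    square; on the part of the boundary left of [a], either [s] is the large
    constant [(2 a) ^ 2] or [x] is half of [x0]. *)
Lemma unique_continuation_gap (a x0 x s : R) : 0 < x0 -> x0 <= a -> x0 / 2 <= x ->
  x <= a -> s = (2 * a) ^+ 2 \/ x = x0 / 2 /\ 0 <= s ->
  (x - a) + (2 * a)^-1 * ((x - a) ^+ 2 - s) <=
  (x0 - a) + (2 * a)^-1 * (x0 - a) ^+ 2 - 3 * x0 ^+ 2 / (8 * a).
Proof.
move=> x00 x0a xl xa Hs; have a0 : 0 < a by exact: lt_le_trans x0a.
have a2 : 0 < 2 * a by rewrite mulr_gt0.
rewrite -(ler_pM2l a2).
have -> : 2 * a * (x - a + (2 * a)^-1 * ((x - a) ^+ 2 - s)) = x ^+ 2 - a ^+ 2 - s.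
  by field; rewrite gt_eqF.
have -> : 2 * a * (x0 - a + (2 * a)^-1 * (x0 - a) ^+ 2 - 3 * x0 ^+ 2 / (8 * a)) =
    (x0 / 2) ^+ 2 - a ^+ 2.
  by field; rewrite gt_eqF.
case: Hs => [->|[-> s0]]; last by lra.
have : x ^+ 2 <= a ^+ 2.
  by apply: lerXn2r; rewrite ?nnegrE ?(ltW a0)// (le_trans _ xl)// divr_ge0// ltW.
have : 0 <= (x0 / 2) ^+ 2 by exact: sqr_ge0.
have : 0 <= a ^+ 2 by exact: sqr_ge0.
by rewrite exprMn; lra.
Qed.

Lemma holo_quadratic (p k : R[i]) z : holo (fun w => (w - p) + k * (w - p) ^+ 2) z.
Proof.
have hp : holo (fun w => w - p) z by apply: holoB; [exact: holo_id|exact: holo_cst].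
apply: (@holoD _ (fun w => w - p) (fun w => k * (w - p) ^+ 2)); first exact: hp.
apply: (@holoM _ (fun=> k) (fun w => (w - p) ^+ 2)); first exact: holo_cst.
by apply: (@holoX _ (fun w => w - p) 2); exact: hp.
Qed.

(** A function vanishing far to the right vanishes at [z0] too: in Cauchy's
    formula for the product of [F] with [exp (n (xi + kappa xi^2))], where
    [xi = z - a - i Im z0], the exponential is larger at [z0] than on the part
    of the boundary that lies to the left of the line [Re z = a], by a factor
    growing geometrically with [n]. *)
Theorem unique_continuation F (a : R) : 0 < a ->
  (forall z, 0 < complex.Re z -> holo F z) ->
  (forall z, a < complex.Re z -> F z = 0) ->
  forall z, 0 < complex.Re z -> F z = 0.
Proof.
move=> a0 HF F0 [x0 y0] /= x00; have [ax|xa] := ltP a x0; first exact: F0.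
(* The horizontal sides are at distance [2 a] from [z0], so that the quadratic
   term of the exponent dominates on them as far right as [a]. *)
pose aL := x0 / 2; pose bR := 3 * a; pose cB := y0 - 2 * a; pose dT := y0 + 2 * a.
pose hh := fun z : R[i] => (z - (a +i* y0)) + (2 * a)^-1%:C * (z - (a +i* y0)) ^+ 2.
pose h0 := complex.Re (hh (x0 +i* y0)).
have hE x y : complex.Re (hh (x +i* y)) =
    (x - a) + (2 * a)^-1 * ((x - a) ^+ 2 - (y - y0) ^+ 2).
  by rewrite /hh ReD ReM expr2 ReM /=; ring.
have h0E : h0 = (x0 - a) + (2 * a)^-1 * (x0 - a) ^+ 2.
  by rewrite /h0 hE subrr expr0n subr0.
pose g := 3 * x0 ^+ 2 / (8 * a).
have g0 : 0 < g by rewrite divr_gt0 ?mulr_gt0 ?exprn_gt0.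
have [aLx xbR] : aL < x0 /\ x0 < bR by rewrite /aL /bR; split; lra.
have [cy yd] : cB < y0 /\ y0 < dT by rewrite /cB /dT; split; lra.
have [ab cd] : aL <= bR /\ cB <= dT by split; apply: ltW; [exact: lt_trans xbR|exact: lt_trans yd].
have Fhol x y : aL <= x <= bR -> cB <= y <= dT -> holo F (x +i* y).
  by move=> /andP[xL _] _; apply: HF => /=; apply: lt_le_trans xL; rewrite divr_gt0.
have [k k0 Fk] := holo_boundary_bounded ab cd Fhol.
have gap x y : aL <= x <= bR -> cB <= y <= dT ->
    [|| x == aL, x == bR, y == cB | y == dT] -> x <= a ->
    complex.Re (hh (x +i* y)) <= h0 - g.
  move=> /andP[xL xR] _ bd xa'; rewrite hE h0E.
  apply: unique_continuation_gap => //; case/or4P: bd => /eqP E.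
  - by right; split; [exact: E|exact: sqr_ge0].
  - by exfalso; move: xa'; rewrite E /bR => b3; have : 0 < a by []; lra.
  - by left; rewrite E /cB; ring.
  - by left; rewrite E /dT; ring.
have dist x y : aL <= x <= bR -> cB <= y <= dT ->
    [|| x == aL, x == bR, y == cB | y == dT] ->
    x0 / 2 <= cabs ((x +i* y) - (x0 +i* y0)).
  move=> _ _ /or4P[] /eqP ->.
  - by apply: le_trans (Re_le_cabs _); rewrite /= ler_normr /aL; lra.
  - by apply: le_trans (Re_le_cabs _); rewrite /= ler_normr /bR; lra.
  - by apply: le_trans (Im_le_cabs _); rewrite /= ler_normr /cB; lra.
  - by apply: le_trans (Im_le_cabs _); rewrite /= ler_normr /dT; lra.
have xine x y : [|| x == aL, x == bR, y == cB | y == dT] -> (x +i* y) - (x0 +i* y0) != 0.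
  move=> bd; rewrite subr_eq0 eq_complex/= negb_and.
  case/or4P: bd => /eqP ->.
  - by rewrite lt_eqF.
  - by rewrite gt_eqF.
  - by rewrite (lt_eqF cy) orbT.
  - by rewrite (gt_eqF yd) orbT.
have hhol z : holo hh z by exact: holo_quadratic.
set s := (bR - aL) + (dT - cB).
suff key n : cabs (F (x0 +i* y0)) <= 2 * (2 * (k / (x0 / 2)) * s) * expR (- (n%:R * g)).
  apply: cabs_eq0; apply/le_anti; rewrite cabs_ge0 andbT.
  exact: expR_decay_le0 g0 key.
pose E z := cexp ((n%:R : R)%:C * hh z).
have cE z : cabs (E z) = expR (n%:R * complex.Re (hh z)).
  by rewrite cabs_cexp ReM /= mul0r subr0.
have Ehol z : holo E z.
  apply: (@holo_comp _ (fun w => (n%:R : R)%:C * hh w) cexp); last exact: holo_cexp.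
  by apply: holoM; [exact: holo_cst|exact: hhol].
have := @cauchy_rectangle _ (fun z => F z * E z) aL bR cB dT x0 y0.
rewrite aLx xbR cy yd => /(_ isT isT) CF.
have {}CF := CF (fun x y xab ycd => holoM (Fhol x y xab ycd) (Ehol _)).
have W : 1 / 2 <= cabs (rint (fun z : R[i] => (z - (x0 +i* y0))^-1) aL bR cB dT).
  by apply: winding_ge; rewrite ?aLx ?cy ?yd// /cB /bR; lra.
have : cabs (rint (fun z => F z * E z / (z - (x0 +i* y0))) aL bR cB dT) <=
    2 * (k * expR (n%:R * (h0 - g)) / (x0 / 2)) * s.
  apply: cabs_rint_le => //.
    apply: holo_rintegrable => // x y xab ycd bd; apply: holoM.
      by apply: holoM; [exact: Fhol|exact: Ehol].
    apply: holoV; first exact: xine.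
    by apply: holoB; [exact: holo_id|exact: holo_cst].
  move=> x y xab ycd bd; rewrite !cabsM cabsV cE.
  have x02 : 0 < x0 / 2 by rewrite divr_gt0.
  have di := dist x y xab ycd bd.
  have dp := lt_le_trans x02 di.
  apply: ler_pM; rewrite ?mulr_ge0 ?cabs_ge0 ?invr_ge0 ?expR_ge0 ?cabs_ge0//.
    have [xa'|xa'] := leP x a; last first.
      by rewrite F0// cabs0 mul0r mulr_ge0// expR_ge0.
    apply: ler_pM; rewrite ?cabs_ge0 ?expR_ge0 ?Fk// ler_expR ler_wpM2l//.
    exact: gap.
  by rewrite lef_pV2 ?posrE.
rewrite CF !cabsM cE -/h0 => HH.
have {HH} : cabs (F (x0 +i* y0)) * expR (n%:R * h0) * (1 / 2) <=
    2 * (k * expR (n%:R * (h0 - g)) / (x0 / 2)) * s.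
  by apply: le_trans HH; rewrite ler_wpM2l// mulr_ge0 ?cabs_ge0 ?expR_ge0.
have -> : n%:R * (h0 - g) = n%:R * h0 + - (n%:R * g) by ring.
rewrite expRD.
have -> : 2 * (k * (expR (n%:R * h0) * expR (- (n%:R * g))) / (x0 / 2)) * s =
  (2 * (2 * (k / (x0 / 2)) * s) * expR (- (n%:R * g))) * (expR (n%:R * h0) * (1 / 2)).
  by field; rewrite gt_eqF.
by rewrite -mulrA ler_pM2r// mulr_gt0// expR_gt0.
Qed.

End UniqueContinuation.

Section ContourEstimate.
Context {R : realType}.
Local Notation mu := (@lebesgue_measure R).
Implicit Types (F : R[i] -> R[i]).

(** Once the left side is removed from the boundary integral, each of the three
    others contributes at most its length times the bound. *)
Lemma cint_left_side_le F (a b c d k1 k2 : R) : a <= b -> c <= d ->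
  rintegrable F a b c d ->
  (forall x, a <= x <= b -> cabs (F (x +i* c)) <= k1) ->
  (forall x, a <= x <= b -> cabs (F (x +i* d)) <= k1) ->
  (forall y, c <= y <= d -> cabs (F (b +i* y)) <= k2) ->
  cabs (rint F a b c d + 'i * cint `[c, d] (fun y => F (a +i* y))) <=
    2 * k1 * (b - a) + k2 * (d - c).
Proof.
move=> ab cd [i1 i2 i3 i4] H1 H2 H3.
have -> : rint F a b c d + 'i * cint `[c, d] (fun y => F (a +i* y)) =
  cint `[a, b] (fun x => F (x +i* c)) - cint `[a, b] (fun x => F (x +i* d))
  + 'i * cint `[c, d] (fun y => F (b +i* y)) by rewrite /rint; ring.
have -> : 2 * k1 * (b - a) = k1 * (b - a) + k1 * (b - a) by ring.
apply: le_trans (cabsD _ _) _; rewrite cabsM cabsi mul1r; apply: lerD; last first.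
  exact: cabs_cint_itv_le.
by apply: le_trans (cabsB _ _) _; apply: lerD; exact: cabs_cint_itv_le.
Qed.

Lemma cint_right_side_le F (a b c d k1 k2 : R) : a <= b -> c <= d ->
  rintegrable F a b c d ->
  (forall x, a <= x <= b -> cabs (F (x +i* c)) <= k1) ->
  (forall x, a <= x <= b -> cabs (F (x +i* d)) <= k1) ->
  (forall y, c <= y <= d -> cabs (F (a +i* y)) <= k2) ->
  cabs (rint F a b c d - 'i * cint `[c, d] (fun y => F (b +i* y))) <=
    2 * k1 * (b - a) + k2 * (d - c).
Proof.
move=> ab cd [i1 i2 i3 i4] H1 H2 H3.
have -> : rint F a b c d - 'i * cint `[c, d] (fun y => F (b +i* y)) =
  cint `[a, b] (fun x => F (x +i* c)) - cint `[a, b] (fun x => F (x +i* d))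
  - 'i * cint `[c, d] (fun y => F (a +i* y)) by rewrite /rint; ring.
have -> : 2 * k1 * (b - a) = k1 * (b - a) + k1 * (b - a) by ring.
apply: le_trans (cabsB _ _) _; rewrite cabsM cabsi mul1r; apply: lerD; last first.
  exact: cabs_cint_itv_le.
by apply: le_trans (cabsB _ _) _; apply: lerD; exact: cabs_cint_itv_le.
Qed.

Lemma expn_expR_le (n : nat) (x : R) : 0 <= x -> x ^+ n * expR (- x) <= n`!%:R.
Proof.
move=> x0; rewrite expRN ler_pdivrMr ?expR_gt0//.
case: n => [|n]; first by rewrite expr0 fact0 mul1r; apply: le_trans (expR_ge1Dx _); rewrite lerDl.
have := expR_ge1Dxn n x0 => H.
rewrite -ler_pdivrMl ?ltr0n ?fact_gt0// mulrC.
by apply: le_trans H; rewrite lerDr.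
Qed.

Lemma cint_halfline_split (t : R) (f : R -> R[i]) : 0 <= t ->
  cintegrable `[0, +oo[ f ->
  cint `[0, +oo[ f = cint `[0, t] f + cint `]t, +oo[ f.
Proof.
move=> t0 [f1 f2]; apply: complex_eq => /=.
- apply/eqP; rewrite addrC -subr_eq; apply/eqP.
  by rewrite Rintegral_itvB//= bnd_simp.
- apply/eqP; rewrite addrC -subr_eq; apply/eqP.
  by rewrite Rintegral_itvB//= bnd_simp.
Qed.

Section Contour.
Variables (u : R -> R[i]) (h : R -> R) (F : R[i] -> R[i]) (omega : R) (m : nat).
Hypotheses (omega0 : 0 < omega) (m2 : (2 <= m)%N).
Hypotheses (mu_ : cmeasurable `[0, +oo[ u) (uh : forall s, 0 <= s -> cabs (u s) <= h s).
Hypothesis hi : forall s, 0 < s ->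
  mu.-integrable `[0, +oo[ (EFin \o (fun r => expR (- (s * r)) * h r)).
Hypothesis hloc : forall t s,
  mu.-integrable `[0, t] (EFin \o (fun r => expR (- (s * r)) * h r)).
Hypothesis Fu : forall z, 0 < complex.Re z -> F z = laplace `[0, +oo[ u z.
Hypothesis Fhol : forall z, 0 <= complex.Re z -> holo F z.

Lemma uh_itv t : forall s, `[0, t]%classic s -> cabs (u s) <= h s.
Proof. by move=> s /=; rewrite in_itv/= => /andP[s0 _]; exact: uh. Qed.

Lemma pos_itv (t : R) : forall s, `[0, t]%classic s -> 0 <= s.
Proof. by move=> s /=; rewrite in_itv/= => /andP[]. Qed.

Lemma mu_itv t : cmeasurable `[0, t] u.
Proof.
case: mu_ => m1 m2'; split.
- apply: measurable_funS m1 => // s /=; rewrite !in_itv/= => /andP[-> //].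
- apply: measurable_funS m2' => // s /=; rewrite !in_itv/= => /andP[-> //].
Qed.

Lemma holo_trunc t z : holo (laplace `[0, t] u) z.
Proof.
apply: (@holo_laplace _ _ _ h (complex.Re z - 1)) => //.
- exact: pos_itv.
- exact: mu_itv.
- exact: uh_itv.
- by rewrite ltrBlDr ltrDl.
Qed.

Section Fixed.
Variables (r t : R).
Hypotheses (r1 : 1 <= r) (t0 : 0 < t).
Hypothesis kint : mu.-integrable `[0, +oo[
  (EFin \o (fun s => h s / (1 + r * `|t - s|) ^+ 2)).

Let r0 : 0 < r. Proof. exact: lt_le_trans ltr01 r1. Qed.

Definition kernel_mean : R := \int[mu]_(s in `[0, +oo[) (h s / (1 + r * `|t - s|) ^+ 2).

(** The real parts on the contour are at most [r + 2 omega] in absolute value,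
    hence at most [contour_ratio * r]. *)
Definition contour_ratio : R := 1 + 2 * omega.
(** Equal to [1] at [omega], and with zeros of order [m] at [+- i r], where the
    contour crosses the imaginary axis: there the transforms on the two sides
    are not controlled. *)
Definition chi (z : R[i]) : R[i] :=
  ((z ^+ 2 + (r ^+ 2)%:C) / (omega ^+ 2 + r ^+ 2)%:C) ^+ m.

Lemma chi_omega : chi omega%:C = 1.
Proof.
rewrite /chi -rmorphXn -rmorphD /= divff ?expr1n//.
by rewrite eq_complex /= eqxx andbT gt_eqF// addr_gt0// exprn_gt0.
Qed.

Lemma cabs_chi_le z : cabs (chi z) <= (cabs (z ^+ 2 + (r ^+ 2)%:C) / r ^+ 2) ^+ m.
Proof.
rewrite cabsX; apply: lerXn2r.
- by rewrite nnegrE cabs_ge0.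
- by rewrite nnegrE divr_ge0 ?cabs_ge0// exprn_ge0// ltW.
rewrite cabsM cabsV cabs_real ger0_norm; last by rewrite addr_ge0// sqr_ge0.
rewrite ler_wpM2l ?cabs_ge0// lef_pV2 ?posrE ?addr_gt0 ?exprn_gt0//.
by rewrite lerDr sqr_ge0.
Qed.

(** On the horizontal sides [z ^ 2 + r ^ 2 = x (x +- 2 i r)]. *)
Lemma cabs_chi_horizontal x y : (y = r \/ y = - r) ->
  cabs (chi (x +i* y)) <= (`|x| / r * (`|x| / r + 2)) ^+ m.
Proof.
move=> yr; have y2 : y ^+ 2 = r ^+ 2 by case: yr => ->; rewrite ?sqrrN.
apply: le_trans (cabs_chi_le _) _; apply: lerXn2r.
- by rewrite nnegrE divr_ge0 ?cabs_ge0// exprn_ge0// ltW.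
- by rewrite nnegrE mulr_ge0 ?addr_ge0 ?divr_ge0// ltW.
have -> : (x +i* y) ^+ 2 + (r ^+ 2)%:C = x%:C * (x +i* (2 * y)).
  by apply: complex_eq; rewrite ?expr2 ?ReD ?ImD ?ReM ?ImM /= -?expr2 -?y2; ring.
rewrite cabsM cabs_real.
have : cabs (x +i* (2 * y)) <= `|x| + 2 * r.
  apply: le_trans (cabs_le_ReIm _) _ => /=; rewrite lerD2l normrM ger0_norm//.
  by rewrite ler_wpM2l//; case: yr => ->; rewrite ?normrN gtr0_norm.
move=> H; apply: (@le_trans _ _ (`|x| * (`|x| + 2 * r) / r ^+ 2)).
  by rewrite ler_wpM2r ?invr_ge0 ?exprn_ge0 ?(ltW r0)// ler_wpM2l.
by rewrite le_eqVlt; apply/orP; left; apply/eqP; field; rewrite gt_eqF.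
Qed.

Lemma contour_ratio_ge1 : 1 <= contour_ratio.
Proof. by rewrite /contour_ratio lerDl mulr_ge0// ltW. Qed.

(** The horizontal and the outer vertical sides of the two rectangles on either
    side of the imaginary axis. *)
Definition onside (x y : R) : Prop :=
  `|x| <= contour_ratio * r /\ ((y = r \/ y = - r) \/ (r <= `|x| /\ `|y| <= r)).

Lemma cabs_chi_le_sqr x y : onside x y ->
  cabs (chi (x +i* y)) <= (`|x| / r) ^+ 2 * (contour_ratio + 2) ^+ (2 * m).
Proof.
move=> [xb xy]; have b1 := contour_ratio_ge1; set v := `|x| / r.
have v0 : 0 <= v by rewrite divr_ge0// ltW.
have vb : v <= contour_ratio by rewrite ler_pdivrMr.
have b2 : 1 <= contour_ratio + 2 by lra.
case: xy => [yr|[rx yr]].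
  apply: le_trans (cabs_chi_horizontal _ yr) _; rewrite -/v exprMn.
  rewrite -(subnKC m2) exprD -mulrA ler_wpM2l ?exprn_ge0//.
  rewrite (subnKC m2) mul2n -addnn exprD; apply: ler_pM.
  - by rewrite exprn_ge0.
  - by rewrite exprn_ge0// addr_ge0.
  - apply: (@le_trans _ _ ((contour_ratio + 2) ^+ (m - 2))).
      by apply: lerXn2r; rewrite ?nnegrE; lra.
    by apply: ler_weXn2l => //; exact: leq_subr.
  - by apply: lerXn2r; rewrite ?nnegrE; lra.
have v1 : 1 <= v by rewrite ler_pdivlMr// mul1r.
apply: le_trans (cabs_chi_le _) _.
apply: (@le_trans _ _ ((contour_ratio + 2) ^+ (2 * m))); last first.
  by rewrite ler_peMl ?exprn_ge0 ?exprn_ege1//; lra.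
rewrite exprM; apply: lerXn2r.
- by rewrite nnegrE divr_ge0 ?cabs_ge0// exprn_ge0// ltW.
- by rewrite nnegrE exprn_ge0//; lra.
rewrite ler_pdivrMr ?exprn_gt0//; apply: le_trans (cabsD _ _) _.
rewrite cabsX cabs_sqr /= cabs_real ger0_norm; last by rewrite exprn_ge0// ltW.
have q1 : x ^+ 2 <= (contour_ratio * r) ^+ 2.
  rewrite -(real_normK (num_real x)); apply: lerXn2r => //.
  by rewrite nnegrE mulr_ge0 ?(le_trans ler01 b1) ?(ltW r0).
have q2 : y ^+ 2 <= r ^+ 2.
  by rewrite -(real_normK (num_real y)); apply: lerXn2r; rewrite ?nnegrE// ltW.
have -> : (contour_ratio + 2) ^+ 2 * r ^+ 2 = (contour_ratio * r) ^+ 2 + (4 * contour_ratio + 4) * r ^+ 2 by ring.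
have : 2 * r ^+ 2 <= (4 * contour_ratio + 4) * r ^+ 2.
  by rewrite ler_wpM2r ?exprn_ge0 ?(ltW r0)//; lra.
by lra.
Qed.

(** The key pointwise bound: the zeros of [chi] at [+- i r] turn the slowly
    decaying exponentials into an integrable kernel that does not depend on
    the point of the contour. With [v = |x| / r], [chi] is at most a multiple of
    [v ^ 2], and [v (1 + r s)] is at most a multiple of [exp (v r s / 2)]. *)
Lemma chi_kernel_le x y s : onside x y -> 0 <= s ->
  cabs (chi (x +i* y)) * expR (- (`|x| * s)) <=
    4 * contour_ratio ^+ 2 * (contour_ratio + 2) ^+ (2 * m) / (1 + r * s) ^+ 2.
Proof.
move=> os s0; have b1 := contour_ratio_ge1; set v := `|x| / r.
have v0 : 0 <= v by rewrite divr_ge0// ltW.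
have vb : v <= contour_ratio by case: os => xb _; rewrite ler_pdivrMr.
have rs : 0 <= r * s by rewrite mulr_ge0// ltW.
have xs : `|x| * s = v * (r * s) by rewrite /v mulrA divfK// gt_eqF.
rewrite xs ler_pdivlMr ?exprn_gt0//; last by lra.
apply: (@le_trans _ _ (v ^+ 2 * (contour_ratio + 2) ^+ (2 * m) * expR (- (v * (r * s))) * (1 + r * s) ^+ 2)).
  rewrite ler_wpM2r ?exprn_ge0//; first by lra.
  by rewrite ler_wpM2r ?expR_ge0//; exact: cabs_chi_le_sqr.
have B0 : 0 <= (contour_ratio + 2) ^+ (2 * m) by rewrite exprn_ge0//; lra.
have vrs : 0 <= v * (r * s) by rewrite mulr_ge0.
have key : (v * (1 + r * s)) ^+ 2 <= 4 * contour_ratio ^+ 2 * expR (v * (r * s)).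
  have := expR_ge1Dx (v * (r * s) / 2) => h1.
  have -> : expR (v * (r * s)) = expR (v * (r * s) / 2) ^+ 2.
    by rewrite expr2 -expRD; congr expR; field.
  rewrite (_ : 4 * contour_ratio ^+ 2 * _ = (2 * contour_ratio * expR (v * (r * s) / 2)) ^+ 2); last by ring.
  apply: lerXn2r; rewrite ?nnegrE.
  - by rewrite mulr_ge0//; lra.
  - by rewrite mulr_ge0 ?expR_ge0// mulr_ge0//; lra.
  rewrite -mulrA mulrCA; apply: (@le_trans _ _ (contour_ratio * (1 + v * (r * s)))); last first.
    by rewrite ler_pM2l; lra.
  rewrite mulrDr mulrDr !mulr1; apply: lerD => //.
  by rewrite ler_peMl.
rewrite (_ : v ^+ 2 * _ * _ * _ = (v * (1 + r * s)) ^+ 2 * expR (- (v * (r * s))) * (contour_ratio + 2) ^+ (2 * m)); last by ring.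
rewrite ler_wpM2r// expRN ler_pdivrMr ?expR_gt0//.
Qed.

Lemma holo_chi z : holo chi z.
Proof.
apply: (@holoX _ (fun z => (z ^+ 2 + (r ^+ 2)%:C) / (omega ^+ 2 + r ^+ 2)%:C)).
apply: (@holoM _ (fun z => z ^+ 2 + (r ^+ 2)%:C) (fun=> ((omega ^+ 2 + r ^+ 2)%:C)^-1)); last exact: holo_cst.
apply: (@holoD _ (fun z : R[i] => z ^+ 2) (fun=> (r ^+ 2)%:C)); last exact: holo_cst.
by apply: (@holoX _ (fun z => z) 2); exact: holo_id.
Qed.

Opaque chi.

Let side_const : R := 4 * contour_ratio ^+ 2 * (contour_ratio + 2) ^+ (2 * m).

Let side_const_ge0 : 0 <= side_const.
Proof. by have := contour_ratio_ge1 => b1; rewrite /side_const !mulr_ge0 ?exprn_ge0//; lra. Qed.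

Lemma kernel_ge0 s : 0 <= s -> 0 <= h s / (1 + r * `|t - s|) ^+ 2.
Proof.
move=> s0; rewrite divr_ge0//; first exact: le_trans (cabs_ge0 _) (uh s0).
by rewrite exprn_ge0// addr_ge0// mulr_ge0// ltW.
Qed.

Lemma kernel_mean_ge0 : 0 <= kernel_mean.
Proof.
by apply: Rintegral_ge0 => s /=; rewrite in_itv/= andbT; exact: kernel_ge0.
Qed.

Lemma kernel_meanE : kernel_mean = \int[mu]_(s in `[0, t]) (h s / (1 + r * `|t - s|) ^+ 2) +
  \int[mu]_(s in `]t, +oo[) (h s / (1 + r * `|t - s|) ^+ 2).
Proof.
apply/eqP; rewrite addrC -subr_eq; apply/eqP.
by rewrite Rintegral_itvB//= bnd_simp ltW.
Qed.

Lemma kernel_mean_near_le : \int[mu]_(s in `[0, t]) (h s / (1 + r * `|t - s|) ^+ 2) <= kernel_mean.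
Proof.
rewrite kernel_meanE lerDl; apply: Rintegral_ge0 => s /=; rewrite in_itv/= andbT => ts.
by apply: kernel_ge0; exact: ltW (lt_trans t0 ts).
Qed.

Lemma kernel_mean_far_le : \int[mu]_(s in `]t, +oo[) (h s / (1 + r * `|t - s|) ^+ 2) <= kernel_mean.
Proof.
rewrite kernel_meanE lerDr; apply: Rintegral_ge0 => s /=; rewrite in_itv/= => /andP[s0 _].
exact: kernel_ge0.
Qed.

Lemma cabs_cexp_scale (k x y : R) : cabs (cexp (k%:C * (x +i* y))) = expR (k * x).
Proof. by rewrite cabs_cexp; congr expR; rewrite /= mul0r subr0. Qed.

Lemma cabs_kernel_xy (s x y : R) : cabs (cexp (- (s%:C * (x +i* y)))) = expR (- (x * s)).
Proof. exact: cabs_kernel. Qed.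

Lemma cabs_weight (c w : R[i]) (k x y s : R) :
  cabs (c * cexp (k%:C * (x +i* y)) * (cexp (- (s%:C * (x +i* y))) * w)) =
  cabs c * expR (k * x) * (expR (- (x * s)) * cabs w).
Proof.
rewrite cabsM; congr (_ * _); rewrite cabsM; congr (_ * _).
  exact: cabs_cexp_scale.
exact: cabs_kernel_xy.
Qed.

Lemma cabs_tail_le x y : 0 < x -> onside x y ->
  cabs (cexp (t%:C * (x +i* y)) * (F (x +i* y) - laplace `[0, t] u (x +i* y)) *
    chi (x +i* y)) <= side_const * kernel_mean.
Proof.
move=> x0 os; have [z zE] : exists z, z = x +i* y by exists (x +i* y).
have Rez : complex.Re z = x by rewrite zE.
rewrite -zE.
have pos s : `[0, +oo[%classic s -> 0 <= s by rewrite /= in_itv/= andbT.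
have li : cintegrable `[0, +oo[ (fun s => cexp (- (s%:C * z)) * u s).
  apply: (@laplace_integrable _ _ u h 0); rewrite ?Rez//; by move=> s /pos; exact: uh.
have li' : cintegrable `]t, +oo[ (fun s => cexp (- (s%:C * z)) * u s).
  apply: cintegrableS li => // s /=; rewrite !in_itv/= !andbT => /ltW; exact: le_trans (ltW t0).
rewrite Fu ?Rez// /laplace (cint_halfline_split (ltW t0) li) [X in X - _]addrC addrK.
rewrite mulrC mulrA -cintZ//.
have ki : mu.-integrable `]t, +oo[ (EFin \o (fun s => h s / (1 + r * `|t - s|) ^+ 2)).
  apply: (@integrableS _ _ _ mu `[0, +oo[) => //.
  by move=> s /=; rewrite !in_itv/= !andbT => /ltW; exact: le_trans (ltW t0).
apply: (@le_trans _ _ (side_const * \int[mu]_(s in `]t, +oo[) (h s / (1 + r * `|t - s|) ^+ 2))); last first.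
  by rewrite ler_wpM2l//; exact: kernel_mean_far_le.
rewrite -RintegralZl//; apply: cabs_cint_le => //; first exact: cintegrableZ.
  exact: integrableRZ.
move=> s /=; rewrite in_itv/= andbT => ts.
have s0 : 0 <= s by exact: ltW (lt_trans t0 ts).
have ts0 : 0 <= s - t by rewrite subr_ge0 ltW.
rewrite zE cabs_weight -zE.
have := chi_kernel_le os ts0; rewrite -zE gtr0_norm// => ck.
have -> : `|t - s| = s - t by rewrite distrC ger0_norm.
have -> : cabs (chi z) * expR (t * x) * (expR (- (x * s)) * cabs (u s)) =
  cabs (chi z) * expR (- (x * (s - t))) * cabs (u s).
  by rewrite (_ : - (x * (s - t)) = t * x + - (x * s)) ?expRD; ring.
rewrite [leRHS]mulrA [leRHS]mulrAC; apply: ler_pM; rewrite ?mulr_ge0 ?cabs_ge0 ?expR_ge0//.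
exact: uh.
Qed.

Lemma cabs_trunc_le x y : x <= 0 -> onside x y ->
  cabs (cexp (t%:C * (x +i* y)) * laplace `[0, t] u (x +i* y) * chi (x +i* y)) <= side_const * kernel_mean.
Proof.
move=> x0 os; have [z zE] : exists z, z = x +i* y by exists (x +i* y).
have Rez : complex.Re z = x by rewrite zE.
rewrite -zE.
have li : cintegrable `[0, t] (fun s => cexp (- (s%:C * z)) * u s).
  apply: (@laplace_integrable _ _ u h (x - 1)) => //.
  - exact: mu_itv.
  - exact: uh_itv.
  - by rewrite Rez ltrBlDr ltrDl.
rewrite mulrC mulrA -cintZ//.
have ki : mu.-integrable `[0, t] (EFin \o (fun s => h s / (1 + r * `|t - s|) ^+ 2)).
  apply: (@integrableS _ _ _ mu `[0, +oo[) => //.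
  by move=> s /=; rewrite !in_itv/= => /andP[->].
apply: (@le_trans _ _ (side_const * \int[mu]_(s in `[0, t]) (h s / (1 + r * `|t - s|) ^+ 2))); last first.
  by rewrite ler_wpM2l//; exact: kernel_mean_near_le.
rewrite -RintegralZl//; apply: cabs_cint_le => //; first exact: cintegrableZ.
  exact: integrableRZ.
move=> s /=; rewrite in_itv/= => /andP[s0 ts].
have ts0 : 0 <= t - s by rewrite subr_ge0.
rewrite zE cabs_weight -zE.
have := chi_kernel_le os ts0; rewrite -zE ler0_norm// => ck.
have -> : `|t - s| = t - s by rewrite ger0_norm.
have -> : cabs (chi z) * expR (t * x) * (expR (- (x * s)) * cabs (u s)) =
  cabs (chi z) * expR (- (- x * (t - s))) * cabs (u s).
  by rewrite (_ : - (- x * (t - s)) = t * x + - (x * s)) ?expRD; ring.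
rewrite [leRHS]mulrA [leRHS]mulrAC; apply: ler_pM; rewrite ?mulr_ge0 ?cabs_ge0 ?expR_ge0//.
exact: uh.
Qed.

Lemma holo_exp_t z : holo (fun z : R[i] => cexp (t%:C * z)) z.
Proof.
apply: (@holo_comp _ (fun z => t%:C * z) cexp); last exact: holo_cexp.
by apply: (@holoM _ (fun=> t%:C) id); [exact: holo_cst|exact: holo_id].
Qed.

Lemma holo_inv_sub p z : z != p -> holo (fun z : R[i] => (z - p)^-1) z.
Proof.
move=> zp; apply: (@holoV _ (fun z => z - p)); first by rewrite subr_eq0.
by apply: (@holoB _ id (fun=> p)); [exact: holo_id|exact: holo_cst].
Qed.

Lemma dist_omega_horizontal x y : (y = r \/ y = - r) ->
  (cabs ((x +i* y) - omega%:C))^-1 <= r^-1.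
Proof.
move=> yr; have : r <= cabs ((x +i* y) - omega%:C).
  apply: le_trans (Im_le_cabs _) => /=; rewrite oppr0 addr0.
  by case: yr => ->; rewrite ?normrN gtr0_norm.
by move=> H; rewrite lef_pV2 ?posrE//; exact: lt_le_trans H.
Qed.

Lemma dist_omega_vertical x y (k : R) : 0 < k -> k <= `|x - omega| ->
  (cabs ((x +i* y) - omega%:C))^-1 <= k^-1.
Proof.
move=> k0 xk; have H : k <= cabs ((x +i* y) - omega%:C).
  exact: le_trans (Re_le_cabs _).
by rewrite lef_pV2 ?posrE//; exact: lt_le_trans H.
Qed.

Lemma cabs_chi_edge y : (y = r \/ y = - r) -> chi (0 +i* y) = 0.
Proof.
move=> yr; apply: cabs_eq0; apply/le_anti; rewrite cabs_ge0 andbT.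
apply: le_trans (cabs_chi_horizontal _ yr) _.
by rewrite normr0 !mul0r expr0n; case: m m2 => //.
Qed.

Let B : R := r + 2 * omega.

Let omega_B : omega < B.
Proof. by rewrite /B mulr2n mulrDl mul1r addrA ltrDr addr_gt0. Qed.

Let B0 : 0 < B. Proof. exact: lt_trans omega_B. Qed.

(** Contribution of the three sides of the right rectangle off the imaginary
    axis, where the transform of the tail of [u] is controlled by [kernel_mean]. *)
Lemma right_sides_le (H := fun z => cexp (t%:C * z) * (F z - laplace `[0, t] u z) * chi z) :
  cabs (rint (fun z => H z / (z - omega%:C)) 0 B (- r) r +
    'i * cint `[- r, r] (fun y => H (0 +i* y) / ((0 +i* y) - omega%:C))) <=
  2 * (contour_ratio + 1) * (side_const * kernel_mean).
Proof.
have b1 := contour_ratio_ge1.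
have B0' : 0 <= B by exact: ltW.
have rr : - r <= r by rewrite -subr_ge0 opprK addr_ge0// ltW.
have Br : B <= contour_ratio * r.
  by rewrite /B /contour_ratio [leRHS]mulrDl mul1r lerD2l ler_peMr// mulr_ge0// ltW.
have KP : 0 <= side_const * kernel_mean by rewrite mulr_ge0// kernel_mean_ge0.
have HH x y : 0 < x -> onside x y -> cabs (H (x +i* y)) <= side_const * kernel_mean by exact: cabs_tail_le.
have Hh x y : (y = r \/ y = - r) -> 0 <= x <= B -> cabs (H (x +i* y)) <= side_const * kernel_mean.
  move=> yr /andP[x0 xB]; move: x0; rewrite le_eqVlt => /predU1P[<-|x0].
    by rewrite /H cabs_chi_edge// mulr0 cabs0.
  apply: HH => //; split; last by left.
  by rewrite gtr0_norm// (le_trans xB).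
have Hv y : - r <= y <= r -> cabs (H (B +i* y)) <= side_const * kernel_mean.
  move=> yr; apply: HH => //; split; first by rewrite gtr0_norm.
  right; split; last by rewrite ler_norml.
  by rewrite gtr0_norm// /B lerDl mulr_ge0// ltW.
have Hhol z : 0 <= complex.Re z -> holo H z.
  move=> z0; apply: (@holoM _ (fun z => cexp (t%:C * z) * (F z - laplace `[0, t] u z)) chi); last exact: holo_chi.
  apply: (@holoM _ (fun z => cexp (t%:C * z))); first exact: holo_exp_t.
  by apply: (@holoB _ F (laplace `[0, t] u)); [exact: Fhol|exact: holo_trunc].
have bd x y : 0 <= x <= B -> - r <= y <= r ->
    [|| x == 0, x == B, y == - r | y == r] -> (x +i* y) != omega%:C.
  move=> _ _; rewrite eq_complex/= negb_and.
  case/or4P => /eqP ->.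
  - by rewrite lt_eqF.
  - by rewrite gt_eqF.
  - by rewrite oppr_eq0 (gt_eqF r0) orbT.
  - by rewrite (gt_eqF r0) orbT.
apply: (@le_trans _ _ (2 * (side_const * kernel_mean / r) * (B - 0) + (side_const * kernel_mean / r) * (r - - r))); last first.
  rewrite subr0 opprK.
  have -> : 2 * (side_const * kernel_mean / r) * B + side_const * kernel_mean / r * (r + r) = 2 * (B / r + 1) * (side_const * kernel_mean).
    by field; rewrite gt_eqF.
  rewrite ler_wpM2r// ler_wpM2l// lerD2r ler_pdivrMr//.
apply: cint_left_side_le => //.
- apply: holo_rintegrable => // x y xB yr e; apply: (@holoM _ H).
    by apply: Hhol => /=; case/andP: xB.
  by apply: holo_inv_sub; exact: bd.
- move=> x xB; rewrite cabsM cabsV; apply: ler_pM; rewrite ?invr_ge0 ?cabs_ge0//.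
    by apply: Hh => //; right.
  by apply: dist_omega_horizontal; right.
- move=> x xB; rewrite cabsM cabsV; apply: ler_pM; rewrite ?invr_ge0 ?cabs_ge0//.
    by apply: Hh => //; left.
  by apply: dist_omega_horizontal; left.
- move=> y yr; rewrite cabsM cabsV; apply: ler_pM; rewrite ?invr_ge0 ?cabs_ge0//.
    exact: Hv.
  apply: dist_omega_vertical => //.
  have -> : B - omega = r + omega by rewrite /B; ring.
  by rewrite gtr0_norm ?addr_gt0// lerDl ltW.
Qed.

(** The truncated transform is entire: its contribution moves to the left
    half-plane, where it is controlled by [kernel_mean] as well. *)
Lemma left_trunc_le :
  cabs (cint `[- r, r] (fun y => cexp (t%:C * (0 +i* y)) * laplace `[0, t] u (0 +i* y) *
    chi (0 +i* y) / ((0 +i* y) - omega%:C))) <= 4 * (side_const * kernel_mean).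
Proof.
pose H z := cexp (t%:C * z) * laplace `[0, t] u z * chi z.
have b1 := contour_ratio_ge1.
have rr : - r <= r by rewrite -subr_ge0 opprK addr_ge0// ltW.
have nr : - r <= 0 by rewrite oppr_le0 ltW.
have KP : 0 <= side_const * kernel_mean by rewrite mulr_ge0// kernel_mean_ge0.
have HH x y : x <= 0 -> onside x y -> cabs (H (x +i* y)) <= side_const * kernel_mean by exact: cabs_trunc_le.
have xbr x : - r <= x <= 0 -> `|x| <= contour_ratio * r.
  move=> /andP[x1 x2]; rewrite ler0_norm//; apply: (@le_trans _ _ r); first by lra.
  by rewrite ler_peMl// ltW.
have Hhol z : holo H z.
  apply: (@holoM _ (fun z => cexp (t%:C * z) * laplace `[0, t] u z) chi); last exact: holo_chi.
  by apply: (@holoM _ (fun z => cexp (t%:C * z))); [exact: holo_exp_t|exact: holo_trunc].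
have bd x y : - r <= x <= 0 -> (x +i* y) != omega%:C.
  move=> /andP[_ x0]; rewrite eq_complex/= negb_and lt_eqF//.
  exact: le_lt_trans omega0.
have Qhol x y : - r <= x <= 0 -> holo (fun z => H z / (z - omega%:C)) (x +i* y).
  by move=> xr; apply: (@holoM _ H); [exact: Hhol|apply: holo_inv_sub; exact: bd].
have := @cint_right_side_le (fun z => H z / (z - omega%:C)) (- r) 0 (- r) r
  (side_const * kernel_mean / r) (side_const * kernel_mean / r) nr rr.
rewrite goursat//; last by move=> x y xr _; exact: Qhol.
rewrite sub0r cabsN cabsM cabsi mul1r => /(_ _ _ _ _)/le_trans; apply.
- by apply: holo_rintegrable => // x y xr _ _; exact: Qhol.
- move=> x xr; rewrite cabsM cabsV; apply: ler_pM; rewrite ?invr_ge0 ?cabs_ge0//.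
    apply: HH; first by case/andP: xr.
    by split; [exact: xbr|left; right].
  by apply: dist_omega_horizontal; right.
- move=> x xr; rewrite cabsM cabsV; apply: ler_pM; rewrite ?invr_ge0 ?cabs_ge0//.
    apply: HH; first by case/andP: xr.
    by split; [exact: xbr|left; left].
  by apply: dist_omega_horizontal; left.
- move=> y yr; rewrite cabsM cabsV; apply: ler_pM; rewrite ?invr_ge0 ?cabs_ge0//.
    apply: HH => //; split; first by apply: xbr; rewrite lexx nr.
    by right; split; [rewrite normrN gtr0_norm|rewrite ler_norml].
  apply: dist_omega_vertical => //.
  by rewrite -opprD normrN gtr0_norm ?addr_gt0// lerDl ltW.
- rewrite le_eqVlt; apply/orP; left; apply/eqP.
  by field; rewrite gt_eqF.
Qed.

Variables (delta P : R).
Hypotheses (delta0 : 0 < delta) (delta1 : delta <= 1)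
  (Fleft : forall x y, - delta <= x <= 0 -> - r <= y <= r ->
     holo F (x +i* y) /\ cabs (F (x +i* y)) <= P).

(** Here [F] is bounded by [P] up to the line [Re z = - delta]. On the
    horizontal sides [|chi|] is at most [(3 |x| / r) ^ m] and
    [|x| ^ m exp (- |x| t)] is at most [m! / t ^ m]; on the vertical one the
    exponential gains [exp (- delta t)]. *)
Lemma left_extension_le :
  cabs (cint `[- r, r] (fun y => cexp (t%:C * (0 +i* y)) * F (0 +i* y) *
    chi (0 +i* y) / ((0 +i* y) - omega%:C))) <=
  P * (2 * (3 ^+ m * m`!%:R / (r ^+ m * t ^+ m)) + 2 * r * (3 ^+ m / omega) * expR (- (delta * t))).
Proof.
pose H z := cexp (t%:C * z) * F z * chi z.
have rr : - r <= r by rewrite -subr_ge0 opprK addr_ge0// ltW.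
have nr : - delta <= 0 by rewrite oppr_le0 ltW.
have P0 : 0 <= P.
  by apply: le_trans (cabs_ge0 _) (Fleft (x := 0) (y := 0) _ _).2; lra.
have Hhol x y : - delta <= x <= 0 -> - r <= y <= r -> holo H (x +i* y).
  move=> xr yr; apply: (@holoM _ (fun z => cexp (t%:C * z) * F z) chi); last exact: holo_chi.
  by apply: (@holoM _ (fun z => cexp (t%:C * z))); [exact: holo_exp_t|exact: (Fleft xr yr).1].
have bd x y : - delta <= x <= 0 -> (x +i* y) != omega%:C.
  move=> /andP[_ x0]; rewrite eq_complex/= negb_and lt_eqF//.
  exact: le_lt_trans omega0.
have Qhol x y : - delta <= x <= 0 -> - r <= y <= r ->
    holo (fun z => H z / (z - omega%:C)) (x +i* y).
  by move=> xr yr; apply: (@holoM _ H); [exact: Hhol|apply: holo_inv_sub; exact: bd].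
have cH x y : cabs (H (x +i* y)) = expR (x * t) * cabs (F (x +i* y)) * cabs (chi (x +i* y)).
  by rewrite !cabsM cabs_cexp_scale [t * x]mulrC.
pose k1 := P * (3 ^+ m * m`!%:R / (r ^+ m * t ^+ m)).
pose k2 := P * (expR (- (delta * t)) * 3 ^+ m) / omega.
have rm0 : 0 < r ^+ m by rewrite exprn_gt0.
have tm0 : 0 < t ^+ m by rewrite exprn_gt0.
have k10 : 0 <= k1 by rewrite mulr_ge0// divr_ge0 ?mulr_ge0 ?exprn_ge0// ltW.
have Hh x y : - delta <= x <= 0 -> (y = r \/ y = - r) -> cabs (H (x +i* y) / ((x +i* y) - omega%:C)) <= k1.
  move=> xd yr; have yr' : - r <= y <= r by case: yr => ->; rewrite ?lexx rr.
  have [x1 x2] := andP xd.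
  have di : (cabs ((x +i* y) - omega%:C))^-1 <= 1.
    by apply: le_trans (dist_omega_horizontal _ yr) _; rewrite invf_le1.
  rewrite cabsM cabsV -[k1]mulr1; apply: ler_pM; rewrite ?invr_ge0 ?cabs_ge0//.
  rewrite cH /k1 mulrAC mulrC; apply: ler_pM; rewrite ?mulr_ge0 ?expR_ge0 ?cabs_ge0//.
    exact: (Fleft xd yr').2.
  set v := - x; have v0 : 0 <= v by rewrite /v oppr_ge0.
  have cc := cabs_chi_horizontal x yr.
  have {cc} : cabs (chi (x +i* y)) <= 3 ^+ m * (v ^+ m / r ^+ m).
    apply: le_trans cc _; rewrite ler0_norm// -/v -expr_div_n -exprMn.
    have vr : v / r <= 1 by rewrite ler_pdivrMr// mul1r (le_trans _ r1)// (le_trans _ delta1)// /v lerNl.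
    have vr0 : 0 <= v / r by rewrite divr_ge0// ltW.
    apply: lerXn2r; [by rewrite nnegrE (mulr_ge0 vr0)// addr_ge0|by rewrite nnegrE mulr_ge0|].
    by rewrite mulrC ler_wpM2r// -[3]/((1 + 2)%:R) natrD lerD2r.
  move=> cc; apply: (@le_trans _ _ (expR (x * t) * (3 ^+ m * (v ^+ m / r ^+ m)))).
    by rewrite ler_wpM2l ?expR_ge0.
  have := expn_expR_le m (mulr_ge0 v0 (ltW t0)).
  rewrite exprMn => ee.
  have -> : expR (x * t) * (3 ^+ m * (v ^+ m / r ^+ m)) =
     3 ^+ m / (r ^+ m * t ^+ m) * (v ^+ m * t ^+ m * expR (- (v * t))).
    by rewrite /v mulNr opprK; field; rewrite !gt_eqF.
  rewrite [leRHS]mulrAC; apply: ler_wpM2l => //.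
  by rewrite divr_ge0 ?exprn_ge0// ltW// mulr_gt0.
have := @cint_right_side_le (fun z => H z / (z - omega%:C)) (- delta) 0 (- r) r k1 k2 nr rr.
rewrite goursat//.
rewrite sub0r cabsN cabsM cabsi mul1r => /(_ _ _ _ _)/le_trans; apply.
- by apply: holo_rintegrable => // x y xr yr _; exact: Qhol.
- by move=> x xr; apply: Hh => //; right.
- by move=> x xr; apply: Hh => //; left.
- move=> y yr; have dd : - delta <= - delta <= 0 by rewrite lexx nr.
  rewrite cabsM cabsV /k2; apply: ler_pM; rewrite ?invr_ge0 ?cabs_ge0//.
    rewrite cH mulNr mulrAC mulrC; apply: ler_pM; rewrite ?mulr_ge0 ?expR_ge0 ?cabs_ge0//.
      exact: (Fleft dd yr).2.
    rewrite ler_wpM2l ?expR_ge0//; apply: le_trans (cabs_chi_le _) _.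
    apply: lerXn2r; rewrite ?nnegrE ?divr_ge0 ?cabs_ge0 ?exprn_ge0 ?(ltW r0)//.
    rewrite ler_pdivrMr ?exprn_gt0//; apply: le_trans (cabsD _ _) _.
    rewrite cabsX cabs_sqr /= cabs_real ger0_norm; last by rewrite exprn_ge0// ltW.
    have q1 : (- delta) ^+ 2 <= r ^+ 2.
      by rewrite sqrrN; apply: lerXn2r; rewrite ?nnegrE ?(ltW delta0) ?(ltW r0)// (le_trans delta1).
    have q2 : y ^+ 2 <= r ^+ 2.
      by rewrite -(real_normK (num_real y)); apply: lerXn2r; rewrite ?nnegrE ?ler_norml// ltW.
    have -> : 3 * r ^+ 2 = r ^+ 2 + r ^+ 2 + r ^+ 2 by ring.
    by rewrite lerD2r lerD.
  by apply: dist_omega_vertical => //; rewrite -opprD normrN gtr0_norm ?addr_gt0// lerDr ltW.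
have -> : 0 - - delta = delta by ring.
have -> : r - - r = 2 * r by ring.
rewrite /k2 [leRHS]mulrDr; apply: lerD.
  rewrite [leRHS](_ : _ = 2 * k1 * 1); last by rewrite /k1; ring.
  by rewrite ler_wpM2l// mulr_ge0.
by rewrite le_eqVlt; apply/orP; left; apply/eqP; ring.
Qed.

(** Cauchy's formula at [omega] on the right rectangle, after moving the
    integral over the imaginary axis to the left. *)
Theorem contour_estimate :
  cabs (cexp (t%:C * omega%:C) * (F omega%:C - laplace `[0, t] u omega%:C)) <=
  2 * ((2 * (contour_ratio + 1) + 4) * (side_const * kernel_mean) +
   P * (2 * (3 ^+ m * m`!%:R / (r ^+ m * t ^+ m)) + 2 * r * (3 ^+ m / omega) * expR (- (delta * t)))).
Proof.
pose H z := cexp (t%:C * z) * (F z - laplace `[0, t] u z) * chi z.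
have rr : - r < r by rewrite -subr_gt0 opprK addr_gt0.
have Hhol z : 0 <= complex.Re z -> holo H z.
  move=> z0; apply: (@holoM _ (fun z => cexp (t%:C * z) * (F z - laplace `[0, t] u z)) chi); last exact: holo_chi.
  apply: (@holoM _ (fun z => cexp (t%:C * z))); first exact: holo_exp_t.
  by apply: (@holoB _ F (laplace `[0, t] u)); [exact: Fhol|exact: holo_trunc].
(* [B] is at distance at least [r] from [omega], as the lower bound requires. *)
have W : 1 / 2 <= cabs (rint (fun z : R[i] => (z - omega%:C)^-1) 0 B (- r) r).
  apply: winding_ge; rewrite ?oppr_lt0 ?r0//.
  rewrite /B sub0r opprK mulr2n mulrDl mul1r addrA addrK lerDl; exact: ltW.
have oB : 0 < omega < B by rewrite omega0 omega_B.
have o0 : - r < 0 < r by rewrite oppr_lt0 r0.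
have CF : rint (fun z => H z / (z - omega%:C)) 0 B (- r) r =
    H omega%:C * rint (fun z : R[i] => (z - omega%:C)^-1) 0 B (- r) r.
  exact: (cauchy_rectangle oB o0 (fun x y xB _ => Hhol (x +i* y) (proj1 (andP xB)))).
have Ho : H omega%:C = cexp (t%:C * omega%:C) * (F omega%:C - laplace `[0, t] u omega%:C).
  by rewrite /H chi_omega mulr1.
have RS : cabs (rint (fun z => H z / (z - omega%:C)) 0 B (- r) r +
    'i * cint `[- r, r] (fun y => H (0 +i* y) / ((0 +i* y) - omega%:C))) <=
    2 * (contour_ratio + 1) * (side_const * kernel_mean) by exact: right_sides_le.
rewrite -Ho; have LT := left_trunc_le; have LE := left_extension_le.
pose f1 y := cexp (t%:C * (0 +i* y)) * F (0 +i* y) * chi (0 +i* y) / ((0 +i* y) - omega%:C).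
pose f2 y := cexp (t%:C * (0 +i* y)) * laplace `[0, t] u (0 +i* y) * chi (0 +i* y) / ((0 +i* y) - omega%:C).
have ne y : (0 +i* y) != omega%:C.
  by rewrite eq_complex/= negb_and lt_eqF.
have i1 : cintegrable `[- r, r] f1.
  apply: (@holo_vslice_integrable _ (fun z => cexp (t%:C * z) * F z * chi z / (z - omega%:C)) 0) => y _.
  apply: (@holoM _ (fun z => cexp (t%:C * z) * F z * chi z)); last exact: holo_inv_sub.
  apply: (@holoM _ (fun z => cexp (t%:C * z) * F z) chi); last exact: holo_chi.
  apply: (@holoM _ (fun z => cexp (t%:C * z))); first exact: holo_exp_t.
  exact: Fhol.
have i2 : cintegrable `[- r, r] f2.
  apply: (@holo_vslice_integrable _ (fun z => cexp (t%:C * z) * laplace `[0, t] u z * chi z / (z - omega%:C)) 0) => y _.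
  apply: (@holoM _ (fun z => cexp (t%:C * z) * laplace `[0, t] u z * chi z)); last exact: holo_inv_sub.
  apply: (@holoM _ (fun z => cexp (t%:C * z) * laplace `[0, t] u z) chi); last exact: holo_chi.
  apply: (@holoM _ (fun z => cexp (t%:C * z))); first exact: holo_exp_t.
  exact: holo_trunc.
have fE : cint `[- r, r] (fun y => H (0 +i* y) / ((0 +i* y) - omega%:C)) =
    cint `[- r, r] f1 - cint `[- r, r] f2.
  rewrite -cintB//; apply: eq_cint => y _; rewrite /H /f1 /f2.
  by rewrite mulrBr !mulrBl.
rewrite fE CF in RS.
move: RS W; set w := rint _ _ _ _ _; set I1 := cint _ f1; set I2 := cint _ f2 => RS W.
have LT' : cabs I2 <= 4 * (side_const * kernel_mean) by exact: LT.
set bd := P * _ in LE *.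
have LE' : cabs I1 <= bd by exact: LE.
have S : cabs (H omega%:C * w) <= 2 * (contour_ratio + 1) * (side_const * kernel_mean) + (bd + 4 * (side_const * kernel_mean)).
  rewrite -[X in cabs X](addrK ('i * (I1 - I2))).
  apply: le_trans (cabsB _ _) _; apply: lerD; first exact: RS.
  rewrite cabsM cabsi mul1r; apply: le_trans (cabsB _ _) _; exact: lerD.
rewrite cabsM in S.
have S2 : cabs (H omega%:C) * (1 / 2) <= 2 * (contour_ratio + 1) * (side_const * kernel_mean) + (bd + 4 * (side_const * kernel_mean)).
  by apply: le_trans S; rewrite ler_wpM2l ?cabs_ge0.
rewrite mul1r ler_pdivrMr// in S2.
by apply: le_trans S2 _; rewrite le_eqVlt; apply/orP; left; apply/eqP; ring.
Qed.

End Fixed.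
End Contour.
End ContourEstimate.

(** * Integral operators on L^p *)

Section Kernel.
Context {R : realType}.
Local Notation mu := (@lebesgue_measure R).

(** A kernel of mass two on the line, concentrated at distance [1 / rho] from
    the diagonal. *)
Definition kern (rho t s : R) : R := rho / (1 + rho * `|t - s|) ^+ 2.

Lemma kern_den_gt0 (rho d : R) : 0 <= rho -> 0 < 1 + rho * `|d|.
Proof. by move=> r0; rewrite ltr_wpDr// mulr_ge0. Qed.

Lemma kern_ge0 (rho t s : R) : 0 <= rho -> 0 <= kern rho t s.
Proof. by move=> r0; rewrite /kern divr_ge0// exprn_ge0// ltW// kern_den_gt0. Qed.

Lemma kern_le (rho t s : R) : 0 <= rho -> kern rho t s <= rho.
Proof.
move=> r0; rewrite /kern ler_pdivrMr ?exprn_gt0 ?kern_den_gt0// ler_peMr//.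
by rewrite exprn_ege1// lerDl mulr_ge0.
Qed.

Lemma kernC (rho t s : R) : kern rho t s = kern rho s t.
Proof. by rewrite /kern distrC. Qed.

Lemma kern_continuous (rho t : R) : 0 <= rho -> continuous (kern rho t).
Proof.
move=> r0 s; apply: cvgM; first exact: cvg_cst.
apply: cvgV; first by rewrite gt_eqF// exprn_gt0// kern_den_gt0.
apply: (continuous_comp (f := fun s => 1 + rho * `|t - s|) (g := fun x => x ^+ 2)).
  apply: cvgD; first exact: cvg_cst.
  apply: cvgM; first exact: cvg_cst.
  apply: (continuous_comp (f := fun s => t - s) (g := fun x : R => `|x|)).
    by apply: cvgB; [exact: cvg_cst|exact: cvg_id].
  exact: norm_continuous.
exact: exprn_continuous.
Qed.

(** An antiderivative of the kernel to the right of [t] is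
    [- (1 + rho (s - t))^-1]. *)
Lemma kern_integral_right (rho t : R) : 0 < rho ->
  (\int[mu]_(s in `[t, +oo[) (kern rho t s)%:E = 1%:E)%E.
Proof.
move=> r0; pose F s := - (1 + rho * (s - t))^-1.
have den s : t <= s -> 0 < 1 + rho * (s - t).
  by move=> ts; rewrite ltr_wpDr// mulr_ge0 ?subr_ge0// ltW.
have dF (s : R) : t <= s -> is_derive s (1 : R) F (rho / (1 + rho * (s - t)) ^+ 2).
  move=> ts; rewrite /F.
  have d0 : 1 + rho * (s - t) != 0 by rewrite gt_eqF// den.
  apply: is_derive_eq; rewrite /GRing.scale/=; field; exact: d0.
rewrite (@ge0_continuous_FTC2y _ _ F t 0).
- by rewrite -EFinB /F subrr mulr0 addr0 invr1 opprK add0r.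
- by move=> s _; apply: kern_ge0; exact: ltW.
- by apply: continuous_subspaceT => s; apply: kern_continuous; exact: ltW.
- rewrite -[0]oppr0; apply: cvgN; apply/cvgrPdist_le => /= e e0; near=> s.
  have ts : t <= s by near: s; apply: nbhs_pinfty_ge; exact: num_real.
  rewrite sub0r normrN ger0_norm ?invr_ge0 ?(ltW (den _ _))//.
  rewrite invf_ple ?posrE ?den//.
  apply: (@le_trans _ _ (rho * (s - t))); last by rewrite lerDr.
  rewrite -ler_pdivrMl// lerBrDr; near: s; apply: nbhs_pinfty_ge; exact: num_real.
- by move=> s ts; have := dF s (ltW ts); case.
- apply: cvg_at_right_filter; apply: differentiable_continuous.
  by apply/derivable1_diffP; have := dF t (lexx _); case.
- move=> s; rewrite in_itv/= andbT => ts; rewrite derive1E; have := dF s (ltW ts).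
  by move=> /@derive_val ->; rewrite /kern distrC gtr0_norm// subr_gt0.
Unshelve. all: end_near. Qed.

Lemma kern_integral_left (rho t : R) : 0 < rho -> 0 <= t ->
  (\int[mu]_(s in `[0%R, t]) (kern rho t s)%:E <= 1%:E)%E.
Proof.
move=> r0; rewrite le_eqVlt => /predU1P[<-|t0].
  by rewrite set_itv1 integral_set1 lee_fin ler01.
pose F s := (1 + rho * (t - s))^-1.
have den s : s <= t -> 0 < 1 + rho * (t - s).
  by move=> ts; rewrite ltr_wpDr// mulr_ge0 ?subr_ge0// ltW.
have dF (s : R) : s <= t -> is_derive s (1 : R) F (rho / (1 + rho * (t - s)) ^+ 2).
  move=> ts; rewrite /F.
  have d0 : 1 + rho * (t - s) != 0 by rewrite gt_eqF// den.
  apply: is_derive_eq; rewrite /GRing.scale/=; field; exact: d0.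
have cF s : s <= t -> {for s, continuous F}.
  move=> st; apply: differentiable_continuous.
  by apply/derivable1_diffP; have := dF s st; case.
rewrite (@continuous_FTC2 _ _ F 0 t)//.
- rewrite -EFinB lee_fin /F subrr mulr0 addr0 invr1 gerBl invr_ge0.
  by rewrite ltW// den// ltW.
- by apply: continuous_subspaceT => s; apply: kern_continuous; exact: ltW.
- split.
  + by move=> s; rewrite in_itv/= => /andP[_ st]; have := dF s (ltW st); case.
  + by apply: cvg_at_right_filter; apply: cF; exact: ltW.
  + by apply: cvg_at_left_filter; apply: cF.
- move=> s; rewrite in_itv/= => /andP[_ ts]; rewrite derive1E; have := dF s (ltW ts).
  by move=> /@derive_val ->; rewrite /kern gtr0_norm// subr_gt0.
Qed.

Lemma measurable_kern (D : set R) (rho t : R) : 0 <= rho -> measurable_fun D (kern rho t).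
Proof.
move=> r0; apply: measurable_funTS; apply: continuous_measurable_fun.
exact: kern_continuous.
Qed.

Lemma kern_row (rho t : R) : 0 < rho -> 0 <= t ->
  (\int[mu]_(s in `[0%R, +oo[) (kern rho t s)%:E <= 2%:E)%E.
Proof.
move=> r0 t0.
have -> : `[0, +oo[%classic = `[0, t]%classic `|` `]t, +oo[%classic :> set R.
  by rewrite -itv_bndbnd_setU// bnd_simp.
rewrite ge0_integral_setU//=.
- rewrite -[2]/((1 + 1)%:R) natrD EFinD; apply: leeD.
    exact: kern_integral_left.
  by rewrite integral_itv_obnd_cbnd ?kern_integral_right//; apply/measurable_EFinP;
    apply: measurable_kern; exact: ltW.
- by apply/measurable_EFinP; apply: measurable_kern; exact: ltW.
- by move=> s _; rewrite lee_fin kern_ge0// ltW.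
- apply/disj_setPS => s [] /=; rewrite !in_itv/= andbT => /andP[_ st] ts.
  by move: (lt_le_trans ts st); rewrite ltxx.
Qed.

Lemma ge0_lty_integrable (D : set R) (f : R -> R) : measurable_fun D f ->
  (forall s, D s -> 0 <= f s) -> (\int[mu]_(s in D) (f s)%:E < +oo)%E ->
  mu.-integrable D (EFin \o f).
Proof.
move=> mf f0 fi; apply/integrableP; split; first exact/measurable_EFinP.
under eq_integral => s do (rewrite inE => Ds; rewrite /= ger0_norm ?f0//).
exact: fi.
Qed.

Lemma kern_integrable (rho t : R) : 0 < rho -> 0 <= t ->
  mu.-integrable `[0, +oo[ (EFin \o kern rho t).
Proof.
move=> r0 t0; apply: ge0_lty_integrable.
- by apply: measurable_kern; exact: ltW.
- by move=> s _; apply: kern_ge0; exact: ltW.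
- by apply: le_lt_trans (kern_row r0 t0) _; rewrite ltry.
Qed.

Lemma exp_le_kern (k t s : R) : 0 < k -> expR (- (k * `|t - s|)) <= 4 / k * kern k t s.
Proof.
move=> k0; set d := `|t - s|; have d0 : 0 <= d by exact: normr_ge0.
have kd : 0 <= k * d by rewrite mulr_ge0// ltW.
rewrite /kern -/d mulrA divfK ?gt_eqF// ler_pdivlMr; last by rewrite exprn_gt0// ltr_wpDr.
rewrite expRN mulrC ler_pdivrMr ?expR_gt0//.
have -> : expR (k * d) = expR (k * d / 2) ^+ 2 by rewrite expr2 -expRD; congr expR; field.
rewrite -[4]/((2 * 2)%:R) natrM -expr2 -exprMn; apply: lerXn2r.
- by rewrite nnegrE addr_ge0.
- by rewrite nnegrE mulr_ge0// expR_ge0.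
have := expR_ge1Dx (k * d / 2); move: (expR _) => e he; lra.
Qed.

(** The convexity of [x |-> x^p], in the form of its tangent at [b]. *)
Lemma powR_tangent (p a b : R) : 1 <= p -> 0 <= a -> 0 <= b ->
  p * b `^ (p - 1) * a <= a `^ p + (p - 1) * b `^ p.
Proof.
rewrite le_eqVlt => /predU1P[<-|p1] a0 b0.
  by rewrite subrr mul0r addr0 powRr0 mulr1 mul1r powRr1.
have p0 : 0 < p by exact: lt_trans p1.
have q0 : 0 < p - 1 by rewrite subr_gt0.
have := @conjugate_powR _ a (b `^ (p - 1)) p (p / (p - 1)) a0 (powR_ge0 _ _) p0.
rewrite divr_gt0// => /(_ isT).
have -> : p^-1 + (p / (p - 1))^-1 = 1 by field; rewrite !gt_eqF.
move=> /(_ erefl); rewrite -powRrM mulrCA divff ?gt_eqF// mulr1.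
rewrite -(ler_pM2l p0) => H.
have -> : p * b `^ (p - 1) * a = p * (a * b `^ (p - 1)) by ring.
apply: le_trans H _; rewrite le_eqVlt; apply/orP; left; apply/eqP.
by field; rewrite !gt_eqF.
Qed.

Lemma le_1_powR (p a : R) : 1 <= p -> 0 <= a -> a <= 1 + a `^ p.
Proof.
move=> p1 a0; have [a1|a1] := leP a 1.
  by rewrite (le_trans a1)// lerDl powR_ge0.
by rewrite (le_trans (le1r_powR (ltW a1) p1))// lerDr.
Qed.

Lemma measurable_powR_comp (D : set R) (f : R -> R) (p : R) : measurable_fun D f ->
  measurable_fun D (fun x => f x `^ p).
Proof. by move=> mf; apply: (measurableT_comp (measurable_powR p)). Qed.

Section Jensen.
Variables (D : set R) (w h : R -> R) (p A : R).
Hypotheses (mD : measurable D) (p1 : 1 <= p) (A0 : 0 < A)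
  (w0 : forall s, D s -> 0 <= w s) (h0 : forall s, D s -> 0 <= h s)
  (mw : measurable_fun D w) (mh : measurable_fun D h)
  (wi : mu.-integrable D (EFin \o w))
  (whi : mu.-integrable D (EFin \o (fun s => w s * h s `^ p))).

Lemma jensen_integrable : mu.-integrable D (EFin \o (fun s => w s * h s)).
Proof.
apply: (@le_integrable _ _ _ mu D mD _ (EFin \o (fun s => w s + w s * h s `^ p))).
- by apply/measurable_EFinP; exact: measurable_funM.
- move=> s Ds /=; rewrite lee_fin ger0_norm ?mulr_ge0 ?w0 ?h0//.
  rewrite ger0_norm ?addr_ge0 ?mulr_ge0 ?powR_ge0 ?w0//.
  rewrite -[X in X + _]mulr1 -mulrDr ler_wpM2l ?w0//.
  by apply: le_1_powR => //; exact: h0.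
- exact: integrableRD.
Qed.

Hypothesis wA : \int[mu]_(s in D) w s <= A.

(** The tangent inequality at [b], the integral of [w * h] divided by [A], is
    integrated against [w]. *)
Lemma jensen : (\int[mu]_(s in D) (w s * h s)) `^ p <=
  A `^ (p - 1) * \int[mu]_(s in D) (w s * h s `^ p).
Proof.
set I := \int[mu]_(s in D) (w s * h s); set J := \int[mu]_(s in D) (w s * h s `^ p).
have I0 : 0 <= I by apply: Rintegral_ge0 => s Ds; rewrite mulr_ge0 ?w0 ?h0.
pose b := I / A; have b0 : 0 <= b by rewrite divr_ge0// ltW.
have p0 : 0 < p by exact: lt_le_trans p1.
have key : p * b `^ (p - 1) * I <= J + (p - 1) * b `^ p * A.
  apply: (@le_trans _ _ (\int[mu]_(s in D) (w s * h s `^ p + ((p - 1) * b `^ p) * w s))).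
    rewrite /I -RintegralZl//; last exact: jensen_integrable.
    apply: le_Rintegral => //.
    - by apply: integrableRZ => //; exact: jensen_integrable.
    - by apply: integrableRD => //; exact: integrableRZ.
    - move=> s Ds; have := powR_tangent p1 (h0 Ds) b0 => H.
      have -> : w s * h s `^ p + (p - 1) * b `^ p * w s =
        w s * (h s `^ p + (p - 1) * b `^ p) by ring.
      by rewrite mulrCA ler_wpM2l ?w0.
  rewrite RintegralD//; last exact: integrableRZ.
  rewrite RintegralZl// lerD2l ler_wpM2l// mulr_ge0 ?powR_ge0// subr_ge0//.
have IE : I = b * A by rewrite /b divfK// gt_eqF.
have bp : b `^ (p - 1) * b = b `^ p.
  have [->|b1] := eqVneq b 0; first by rewrite mulr0 powR0// gt_eqF.
  rewrite -[X in _ * X]powRr1// -powRD ?subrK//.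
  by rewrite b1 implybT.
have {}key : b `^ p * A <= J.
  have : p * b `^ (p - 1) * I = p * (b `^ p * A) by rewrite -bp IE; ring.
  by move: key => + E; rewrite E -mulrA; move: (b `^ p * A) => y; lra.
have Ap : A `^ (p - 1) * A = A `^ p.
  rewrite -[X in _ * X]powRr1 ?(ltW A0)// -powRD ?subrK//.
  by rewrite (gt_eqF A0) implybT.
rewrite IE powRM ?(ltW A0)// -Ap mulrCA ler_wpM2l ?powR_ge0//.
Qed.

End Jensen.

Lemma measurable_kern2 (rho : R -> R) : measurable_fun setT rho ->
  measurable_fun setT (fun z : R * R => kern (rho z.1) z.1 z.2).
Proof.
move=> mr; have m1 : measurable_fun setT (fun z : R * R => rho z.1).
  exact: (measurableT_comp mr measurable_fst).
apply: measurable_funM => //.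
have md : measurable_fun setT (fun z : R * R => 1 + rho z.1 * `|z.1 - z.2|).
  apply: measurable_funD => //; apply: measurable_funM => //.
  have mn : measurable_fun setT (fun x : R => `|x|).
    by apply: continuous_measurable_fun; exact: norm_continuous.
  apply: (measurableT_comp mn).
  by apply: measurable_funB; [exact: measurable_fst|exact: measurable_snd].
have md2 := measurableT_comp (measurable_powR (- 1)) (measurable_funX 2 md).
apply: eq_measurable_fun md2 => z _ /=; rewrite powR_inv1//.
exact: sqr_ge0.
Qed.

Local Notation D := (`[0%R, +oo[%classic : set R).
Opaque kern.

(** Schur's test: rows of the kernel are integrated with Jensen's
    inequality, columns with Tonelli's theorem. *)
Lemma schur (rho h G : R -> R) (p A K : R) : 1 <= p -> 0 <= K ->
  measurable_fun setT rho -> (forall t, 0 < rho t) ->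
  (forall s, 0 <= s -> (\int[mu]_(t in D) (kern (rho t) t s)%:E <= A%:E)%E) ->
  measurable_fun D h -> (forall s, 0 <= s -> 0 <= h s) ->
  (\int[mu]_(s in D) (h s `^ p)%:E < +oo)%E ->
  measurable_fun D G -> (forall t, 0 <= t -> 0 <= G t) ->
  (forall t, 0 <= t -> G t <= K * \int[mu]_(s in D) (kern (rho t) t s * h s)) ->
  (\int[mu]_(t in D) (G t `^ p)%:E < +oo)%E.
Proof.
move=> p1 K0 mrho rho0 col mh h0 hp mG G0 GK.
have p0 : 0 < p by exact: lt_le_trans p1.
have mD : measurable D by exact: measurable_itv.
have Dge (s : R) : D s -> 0 <= s by rewrite /= in_itv/= andbT.
have mhp : measurable_fun D (fun s => h s `^ p) by exact: measurable_powR_comp.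
have hpi : mu.-integrable D (EFin \o (fun s => h s `^ p)).
  by apply: ge0_lty_integrable => // s _; exact: powR_ge0.
pose hp' := (fun s => h s `^ p) \_ D.
have hp'0 s : 0 <= hp' s by rewrite /hp' patchE; case: ifP => // _; exact: powR_ge0.
have mhp' : measurable_fun setT hp' by exact: ((measurable_restrictT _ mD).1 mhp).
pose f (z : R * R) : \bar R := (\1_D z.1 * (kern (rho z.1) z.1 z.2 * hp' z.2))%:E.
have f0 z : (0 <= f z)%E.
  by rewrite lee_fin mulr_ge0// mulr_ge0// kern_ge0// ltW.
have mf : measurable_fun setT f.
  apply/measurable_EFinP; apply: measurable_funM.
    by apply: (measurableT_comp _ measurable_fst); exact: measurable_indic.
  apply: measurable_funM; first exact: measurable_kern2.
  exact: (measurableT_comp mhp' measurable_snd).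
pose Phi t := (\int[mu]_s f (t, s))%E.
have mPhi : measurable_fun setT Phi by exact: measurable_fun_fubini_tonelli_F.
pose PhiG s := (\int[mu]_t f (t, s))%E.
have mPhiG : measurable_fun setT PhiG by exact: measurable_fun_fubini_tonelli_G.
have khi t : 0 <= t -> mu.-integrable D (EFin \o (fun s => kern (rho t) t s * h s `^ p)).
  move=> t0; apply: (@le_integrable _ _ _ mu D mD _ (EFin \o (fun s => rho t * h s `^ p))).
  - by apply/measurable_EFinP; apply: measurable_funM => //; apply: measurable_kern; exact: ltW.
  - move=> s Ds /=; have k0 : 0 <= kern (rho t) t s by apply: kern_ge0; exact: ltW.
    rewrite lee_fin ger0_norm; last exact: mulr_ge0 k0 (powR_ge0 _ _).
    rewrite ger0_norm; last exact: mulr_ge0 (ltW (rho0 t)) (powR_ge0 _ _).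
    by rewrite ler_wpM2r ?powR_ge0// kern_le// ltW.
  - exact: integrableRZ.
have PhiE t : 0 <= t -> Phi t = (\int[mu]_(s in D) (kern (rho t) t s * h s `^ p))%:E.
  move=> t0; rewrite /Phi /Rintegral fineK; last exact: (@integrable_fin_num _ _ _ mu D mD _ (khi t t0)).
  rewrite [in RHS]integral_mkcond; apply: eq_integral => s _.
  rewrite /f /= indicE mem_set /=; last by rewrite in_itv/= t0.
  by rewrite mul1r /hp' !patchE; case: ifP => // _; rewrite mulr0.
have bound t : 0 <= t -> ((G t `^ p)%:E <= (K `^ p * 2 `^ (p - 1))%:E * Phi t)%E.
  move=> t0; rewrite PhiE// -EFinM lee_fin -mulrA.
  have P0 : 0 <= \int[mu]_(s in D) (kern (rho t) t s * h s).
    by apply: Rintegral_ge0 => s /Dge s0; rewrite mulr_ge0 ?kern_ge0 ?h0// ltW.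
  apply: (@le_trans _ _ ((K * \int[mu]_(s in D) (kern (rho t) t s * h s)) `^ p)).
    by apply: ge0_ler_powR; rewrite ?(ltW p0)// ?nnegrE ?mulr_ge0 ?G0 ?GK.
  rewrite powRM// ler_wpM2l ?powR_ge0//; apply: jensen => //.
  - by move=> s _; apply: kern_ge0; exact: ltW.
  - by move=> s /Dge; exact: h0.
  - by apply: measurable_kern; exact: ltW.
  - exact: kern_integrable.
  - exact: khi.
  - rewrite -lee_fin /Rintegral fineK; last exact: (@integrable_fin_num _ _ _ mu D mD _ (kern_integrable (rho0 t) t0)).
    exact: kern_row.
have mPhiD : measurable_fun D Phi by exact: measurable_funTS mPhi.
have c0 : 0 <= K `^ p * 2 `^ (p - 1) by rewrite mulr_ge0 ?powR_ge0.
have Phi0 t : (0 <= Phi t)%E by apply: integral_ge0.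
apply: (@le_lt_trans _ _ (\int[mu]_(t in D) ((K `^ p * 2 `^ (p - 1))%:E * Phi t))%E).
  apply: ge0_le_integral => //.
  - by move=> t _; rewrite lee_fin powR_ge0.
  - by apply/measurable_EFinP; exact: measurable_powR_comp.
  - exact: (measurable_funeM _ mPhiD).
  - by move=> t /Dge; exact: bound.
rewrite ge0_integralZl//.
apply: lte_mul_pinfty => //.
have -> : (\int[mu]_(t in D) Phi t = \int[mu]_t \int[mu]_s f (t, s))%E.
  rewrite integral_mkcond; apply: eq_integral => t _; rewrite patchE.
  case: ifPn => // tD; rewrite integral0_eq// => s _; rewrite /f /= indicE.
  by rewrite (negbTE tD) mul0r.
rewrite fubini_tonelli//.
apply: (@le_lt_trans _ _ (\int[mu]_s (A%:E * (hp' s)%:E))%E); last first.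
  rewrite ge0_integralZl//; last 3 first.
  - exact/measurable_EFinP.
  - by move=> s _; rewrite lee_fin.
  - by apply: le_trans (col 0 (lexx 0)); apply: integral_ge0 => t _;
      rewrite lee_fin kern_ge0// ltW.
  apply: lte_mul_pinfty => //.
    by apply: le_trans (col 0 (lexx 0)); apply: integral_ge0 => t _;
      rewrite lee_fin kern_ge0// ltW.
  apply: le_lt_trans hp; rewrite [leRHS]integral_mkcond.
  rewrite le_eqVlt; apply/orP; left; apply/eqP; apply: eq_integral => s _.
  by rewrite /hp' !patchE; case: ifP.
apply: ge0_le_integral.
- exact: measurableT.
- by move=> s _; apply: integral_ge0 => t _; exact: f0.
- exact: mPhiG.
- by apply: measurable_funeM; exact/measurable_EFinP.
move=> s _; have [Ds|nDs] := boolP (s \in D); last first.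
  rewrite integral0_eq; last by move=> t _; rewrite /f /= /hp' patchE (negbTE nDs) !mulr0.
  by rewrite /hp' patchE (negbTE nDs) mule0.
have -> : (\int[mu]_t f (t, s) = (hp' s)%:E * \int[mu]_(t in D) (kern (rho t) t s)%:E)%E.
  have mk : measurable_fun D (fun t => (kern (rho t) t s)%:E).
    apply/measurable_EFinP; apply: measurable_funTS.
    exact: measurable_fun_pair1 s (measurable_kern2 mrho).
  rewrite -ge0_integralZl//; last 2 first.
  - by move=> t _; rewrite lee_fin kern_ge0// ltW.
  - by rewrite lee_fin.
  rewrite [RHS]integral_mkcond; apply: eq_integral => t _; rewrite /f /= patchE indicE.
  by case: ifP => _; rewrite ?mul0r// mul1r -EFinM mulrC.
rewrite muleC; apply: lee_wpmul2r; first by rewrite lee_fin.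
by apply: col; apply: Dge; rewrite inE in Ds.
Qed.

End Kernel.

(** * The weight *)

Section Weight.
Context {R : realType}.
Local Notation mu := (@lebesgue_measure R).
Local Notation D := (`[0%R, +oo[%classic : set R).

Lemma expR_half_le2 : expR (1 / 2) <= 2 :> R.
Proof. by have := @expR_sub1_le R (1 / 2); move: (expR _) => e; lra. Qed.

Lemma ler_div2 (a b c d : R) : 0 < b -> 0 < d -> a * d <= c * b -> a / b <= c / d.
Proof. by move=> b0 d0 H; rewrite ler_pdivrMr// mulrAC ler_pdivlMr. Qed.

(** The kernels of a slowly varying weight have bounded columns: near the
    diagonal they are comparable with kernels of constant parameter, and away
    from it they are at most the inverse squared distance, whatever the
    parameter. *)
Lemma kern_column_le (rho : R -> R) (s t : R) :
  (forall t, 1 <= rho t) ->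
  (forall t t', t <= t' -> rho t <= rho t') ->
  (forall t t', t <= t' -> t' - t <= 1 -> rho t' <= 4 * rho t) ->
  kern (rho t) t s <= 16 * kern (rho s / 4) s t + 4 * kern 1 s t.
Proof.
move=> rho1 mono dbl.
have r0 t' : 0 < rho t' by exact: lt_le_trans (rho1 t').
have rs4 : 0 < rho s / 4 by rewrite divr_gt0.
set d := `|t - s|; have dE : `|s - t| = d by rewrite distrC.
have d0 : 0 <= d by exact: normr_ge0.
have k1 : 0 <= kern (rho s / 4) s t by apply: kern_ge0; exact: ltW.
have k2 : 0 <= kern 1 s t by exact: kern_ge0.
have [d1|d1] := leP d 1.
  have [rt4 rt] : rho t <= 4 * rho s /\ rho s / 4 <= rho t.
    have [ts|st] := leP t s.
      have sd : s - t <= 1 by rewrite -[s - t]ger0_norm ?subr_ge0// dE.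
      split.
        by rewrite (le_trans (mono _ _ ts))// ler_peMl ?(ltW (r0 _))// ler1n.
      by rewrite ler_pdivrMr// mulrC; exact: dbl.
    have sd : t - s <= 1 by rewrite -[t - s]ger0_norm ?subr_ge0// ltW.
    split; first by apply: dbl => //; exact: ltW.
    rewrite ler_pdivrMr// (le_trans (mono _ _ (ltW st)))// ler_peMr// ?(ltW (r0 _))//.
    by rewrite ler1n.
  apply: (@le_trans _ _ (16 * kern (rho s / 4) s t)); last by rewrite lerDl mulr_ge0.
  have -> : kern (rho s / 4) s t = (rho s / 4) / (1 + (rho s / 4) * d) ^+ 2 by rewrite /kern dE.
  have -> : kern (rho t) t s = rho t / (1 + rho t * d) ^+ 2 by [].
  have -> : 16 * ((rho s / 4) / (1 + (rho s / 4) * d) ^+ 2) =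
    (4 * rho s) / (1 + (rho s / 4) * d) ^+ 2 by rewrite mulrA; congr (_ / _); field.
  have p1 : 0 < 1 + rho s / 4 * d by rewrite ltr_wpDr// mulr_ge0// ltW.
  have p2 : 0 < 1 + rho t * d by rewrite ltr_wpDr// mulr_ge0// ltW.
  apply: ler_pM; rewrite ?(ltW (r0 _))// ?invr_ge0 ?exprn_ge0 ?(ltW p2)//.
  rewrite lef_pV2 ?posrE ?exprn_gt0//; apply: lerXn2r; rewrite ?nnegrE ?(ltW p1) ?(ltW p2)//.
  by rewrite lerD2l ler_wpM2r.
apply: (@le_trans _ _ (4 * kern 1 s t)); last by rewrite lerDr mulr_ge0.
have -> : kern 1 s t = 1 / (1 + 1 * d) ^+ 2 by rewrite /kern dE.
have -> : kern (rho t) t s = rho t / (1 + rho t * d) ^+ 2 by [].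
have p2 : 0 < 1 + rho t * d by rewrite ltr_wpDr// mulr_ge0// ltW.
have p3 : 0 < 1 + 1 * d by rewrite ltr_wpDr// mul1r.
rewrite [leRHS]mulrA; apply: ler_div2; rewrite ?exprn_gt0// mulr1 mul1r.
have q1 : rho t * d <= 1 + rho t * d by rewrite lerDr.
have q2 : 1 + d <= 2 * d by lra.
have q3 : (1 + d) ^+ 2 <= (2 * d) ^+ 2.
  by apply: lerXn2r; rewrite ?nnegrE ?addr_ge0 ?mulr_ge0.
have q4 : (rho t * d) ^+ 2 <= (1 + rho t * d) ^+ 2.
  by apply: lerXn2r; rewrite ?nnegrE ?(ltW p2)// mulr_ge0// ltW.
apply: (@le_trans _ _ (rho t * (2 * d) ^+ 2)); first by rewrite ler_wpM2l// ltW.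
apply: (@le_trans _ _ (4 * (rho t * d) ^+ 2)); last by rewrite ler_pM2l.
have -> : 4 * (rho t * d) ^+ 2 = rho t * (rho t * (2 * d) ^+ 2) by ring.
rewrite ler_pM2l// ler_peMl// sqr_ge0//.
Qed.

Lemma kern_column (rho : R -> R) (s : R) : measurable_fun setT rho ->
  (forall t, 1 <= rho t) ->
  (forall t t', t <= t' -> rho t <= rho t') ->
  (forall t t', t <= t' -> t' - t <= 1 -> rho t' <= 4 * rho t) -> 0 <= s ->
  (\int[mu]_(t in D) (kern (rho t) t s)%:E <= 40%:E)%E.
Proof.
move=> mrho rho1 mono dbl s0.
have mD : measurable D by exact: measurable_itv.
have r0 t : 0 < rho t by exact: lt_le_trans (rho1 t).
have rs4 : 0 < rho s / 4 by rewrite divr_gt0.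
have mk : measurable_fun D (fun t => (kern (rho t) t s)%:E).
  apply/measurable_EFinP; apply: measurable_funTS.
  exact: measurable_fun_pair1 s (measurable_kern2 mrho).
have m1 : measurable_fun D (fun t => (kern (rho s / 4) s t)%:E).
  by apply/measurable_EFinP; apply: measurable_kern; exact: ltW.
have m2 : measurable_fun D (fun t => (kern 1 s t)%:E).
  by apply/measurable_EFinP; apply: measurable_kern.
have k1 t : D t -> (0%:E <= (kern (rho s / 4) s t)%:E)%E.
  by move=> _; rewrite lee_fin; apply: kern_ge0; exact: ltW.
have k2 t : D t -> (0%:E <= (kern 1 s t)%:E)%E.
  by move=> _; rewrite lee_fin; apply: kern_ge0.
apply: (@le_trans _ _ (\int[mu]_(t in D) (16%:E * (kern (rho s / 4) s t)%:E + 4%:E * (kern 1 s t)%:E))%E).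
  apply: ge0_le_integral.
  - exact: mD.
  - by move=> t _; rewrite lee_fin; apply: kern_ge0; exact: ltW.
  - exact: mk.
  - by apply: emeasurable_funD; exact: measurable_funeM.
  - by move=> t _; rewrite -!EFinM -EFinD lee_fin; exact: kern_column_le.
rewrite ge0_integralD//; last 4 first.
- by move=> t Dt; rewrite mule_ge0// k1.
- exact: measurable_funeM.
- by move=> t Dt; rewrite mule_ge0// k2.
- exact: measurable_funeM.
rewrite !ge0_integralZl//.
have -> : 40%:E = (16%:E * 2%:E + 4%:E * 2%:E)%E :> \bar R.
  by rewrite -!EFinM -EFinD; congr EFin; ring.
by apply: leeD; apply: lee_wpmul2l; rewrite ?lee_fin//; exact: kern_row.
Qed.

Section Inverse.
Variable M : R -> R.
Hypotheses (Mc : {within Rplus R, continuous M})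
  (Mmono : forall s t, 0 <= s -> s <= t -> M s <= M t)
  (M2 : forall s, 0 <= s -> 2 <= M s).

Lemma ln1D_ge0 (s : R) : 0 <= s -> 0 <= ln (1 + s).
Proof. by move=> s0; apply: ln_ge0; rewrite lerDl. Qed.

Lemma M_log_incr (s t : R) : 0 <= s -> s <= t ->
  2 * (ln (1 + t) - ln (1 + s)) <= M_log M t - M_log M s.
Proof.
move=> s0 st; have t0 := le_trans s0 st.
have ms := M2 s0; have mst := Mmono s0 st; have mt := M2 t0.
have ms0 : 0 <= M s by lra. have mt0 : 0 <= M t by lra.
have l1 := ln1D_ge0 ms0; have l2 := ln1D_ge0 s0.
have l3 : ln (1 + M s) <= ln (1 + M t) by rewrite ler_ln ?posrE; lra.
have l4 : ln (1 + s) <= ln (1 + t) by rewrite ler_ln ?posrE; lra.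
rewrite /M_log; move: (ln (1 + M s)) (ln (1 + s)) (ln (1 + M t)) (ln (1 + t)) l1 l2 l3 l4.
move=> a b a' b' l1 l2 l3 l4.
have : M s * (a' + b') <= M t * (a' + b') by rewrite ler_wpM2r//; lra.
have : 2 * (b' - b) <= M s * (b' - b) by rewrite ler_wpM2r//; lra.
have : 0 <= M s * (a' - a) by rewrite mulr_ge0//; lra.
by lra.
Qed.

Lemma M_log_strict (s t : R) : 0 <= s -> s < t -> M_log M s < M_log M t.
Proof.
move=> s0 st; rewrite -subr_gt0; apply: lt_le_trans (M_log_incr s0 (ltW st)).
by rewrite mulr_gt0// subr_gt0 ltr_ln ?posrE; lra.
Qed.

Lemma M_continuous_pos (s : R) : 0 < s -> {for s, continuous M}.
Proof.
move=> s0; have o : open (`]0%R, +oo[%classic : set R) by exact: interval_open.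
have W : {within (`]0%R, +oo[%classic : set R), continuous M}.
  by apply: continuous_subspaceW Mc => x; rewrite /= in_itv/= andbT => /ltW.
rewrite continuous_open_subspace// in W.
by apply: W; rewrite inE/= in_itv/= s0.
Qed.

Lemma M_log_continuous_pos (s : R) : 0 < s -> {for s, continuous (M_log M)}.
Proof.
move=> s0; have cM := M_continuous_pos s0.
have ms := M2 (ltW s0).
have c1 : {for s, continuous (fun x : R => 1 + M x)}.
  by apply: cvgD; [exact: cvg_cst|exact: cM].
have c2 : {for s, continuous (fun x : R => 1 + x)}.
  by apply: cvgD; [exact: cvg_cst|exact: cvg_id].
apply: cvgM; first exact: cM.
apply: cvgD.
- by apply: (continuous_comp c1); apply: continuous_ln; lra.
- by apply: (continuous_comp c2); apply: continuous_ln; lra.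
Qed.

(** [M_log] is at least the logarithm, hence unbounded. *)
Lemma M_log_onto (t : R) : M_log M 1 <= t -> exists2 s, 1 <= s & M_log M s = t.
Proof.
move=> t1; have m1 := M2 (@ler01 R).
have L1 : 0 <= M_log M 1.
  by rewrite /M_log mulr_ge0 ?addr_ge0 ?ln1D_ge0//; lra.
have t0 : 0 <= t by exact: le_trans t1.
have b1 : 1 <= expR t by apply: le_trans (expR_ge1Dx _); rewrite lerDl.
have b0 : 0 <= expR t by exact: expR_ge0.
have tL : t <= M_log M (expR t).
  have mb := M2 b0.
  have q : t <= ln (1 + expR t) by rewrite -{1}(expRK t) ler_ln ?posrE ?expR_gt0// lerDr.
  have q' : 0 <= ln (1 + M (expR t)) by apply: ln1D_ge0; lra.
  rewrite /M_log; move: (M (expR t)) (ln (1 + expR t)) (ln (1 + M (expR t))) mb q q'.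
  by move=> m x y; nra.
have [] := @IVT R (M_log M) 1 (expR t) t b1.
- apply: continuous_in_subspaceT => x; rewrite inE/= in_itv/= => /andP[x1 _].
  by apply: M_log_continuous_pos; exact: lt_le_trans x1.
- by rewrite ge_min t1 le_max tL orbT.
- by move=> s; rewrite in_itv/= => /andP[s1 _] <-; exists s.
Qed.

Lemma w_M_log_spec (t : R) : 1 <= w_M_log M t /\
  (M_log M 1 <= t -> M_log M (w_M_log M t) = t) /\ (t < M_log M 1 -> w_M_log M t = 1).
Proof.
rewrite /w_M_log; case: leP => [t1|t1]; last by split; [|split].
have [s s1 sE] := M_log_onto t1.
have [w0 wE] : 0 <= M_log_inv M t /\ M_log M (M_log_inv M t) = t.
  by apply: (@getPex _ [set s | 0 <= s /\ M_log M s = t]); exists s; split; rewrite // (le_trans _ s1).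
split; last by split.
rewrite leNgt; apply/negP => w1; have := M_log_strict w0 w1.
by rewrite wE ltNge t1.
Qed.

Lemma w_ge1 t : 1 <= w_M_log M t. Proof. by case: (w_M_log_spec t). Qed.

Lemma le_M_log_w t : t <= M_log M (w_M_log M t).
Proof.
case: (w_M_log_spec t) => _ [w1 w2]; case: (leP (M_log M 1) t) => [/w1 ->//|].
by move=> t1; rewrite w2// ltW.
Qed.

Lemma M_log_w_gt1 t : 1 < w_M_log M t -> M_log M (w_M_log M t) = t.
Proof.
case: (w_M_log_spec t) => _ [w1 w2]; case: (leP (M_log M 1) t) => [/w1 ->//|].
by move=> /w2 ->; rewrite ltxx.
Qed.

Lemma w_mono (t t' : R) : t <= t' -> w_M_log M t <= w_M_log M t'.
Proof.
move=> tt; rewrite leNgt; apply/negP => lt.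
have w0 : 0 <= w_M_log M t' by exact: le_trans (w_ge1 t').
have := M_log_strict w0 lt.
rewrite (M_log_w_gt1 (le_lt_trans (w_ge1 t') lt)) => /lt_le_trans/(_ tt).
by rewrite ltNge le_M_log_w.
Qed.

(** The weight grows at most exponentially, because [M_log s - 2 log (1 + s)]
    is increasing. *)
Lemma w_growth (t t' : R) : t <= t' ->
  1 + w_M_log M t' <= (1 + w_M_log M t) * expR ((t' - t) / 2).
Proof.
move=> tt; have w1 := w_ge1 t; have w1' := w_ge1 t'.
have p1 : 0 < 1 + w_M_log M t by lra.
have p2 : 0 < 1 + w_M_log M t' by lra.
have := w_mono tt; rewrite le_eqVlt => /predU1P[<-|lt].
  by rewrite ler_peMr ?(ltW p1)//; apply: le_trans (expR_ge1Dx _); rewrite lerDl divr_ge0// subr_ge0.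
have w0 : 0 <= w_M_log M t by lra.
have := M_log_incr w0 (ltW lt).
rewrite (M_log_w_gt1 (le_lt_trans w1 lt)).
have := le_M_log_w t => h1 h2.
have h3 : ln (1 + w_M_log M t') <= ln (1 + w_M_log M t) + (t' - t) / 2 by lra.
rewrite -[1 + w_M_log M t']lnK ?posrE// -[X in X * _]lnK ?posrE// -expRD.
by rewrite ler_expR.
Qed.

Lemma w_double (t t' : R) : t <= t' -> t' - t <= 1 -> w_M_log M t' <= 4 * w_M_log M t.
Proof.
move=> tt t1; have w1 := w_ge1 t; have := w_growth tt.
have : expR ((t' - t) / 2) <= 2.
  by apply: le_trans expR_half_le2; rewrite ler_expR; lra.
have := expR_ge0 ((t' - t) / 2); move: (expR _) (w_M_log M t) (w_M_log M t') w1 => e a b.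
by nra.
Qed.

(** The growth estimate bounds the increments over unit intervals too, since
    [exp u - 1 <= u exp u]. *)
Lemma w_continuous : continuous (w_M_log M).
Proof.
move=> t; apply: ball_segment => e e0.
set W := 1 + w_M_log M t; have w1 := w_ge1 t.
have W0 : 0 < W by rewrite /W; lra.
have main s s' : s <= s' -> s' - s <= 1 -> w_M_log M s' - w_M_log M s <= (1 + w_M_log M s) * (s' - s).
  move=> ss s1; have := w_growth ss; have := @expR_sub1_le R ((s' - s) / 2).
  have : expR ((s' - s) / 2) <= 2.
    by apply: le_trans expR_half_le2; rewrite ler_expR; lra.
  have := w_ge1 s; move: (expR _) (w_M_log M s) (w_M_log M s') => x a b a1 x2 x3 x4.
  have d0 : 0 <= (s' - s) / 2 by lra.
  have x5 : x - 1 <= s' - s by have := ler_wpM2l d0 x2; lra.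
  have a0 : 0 <= 1 + a by lra.
  by have := ler_wpM2l a0 x5; lra.
exists (Num.min 1 (e / W)); first by rewrite lt_min ltr01 divr_gt0.
move=> s; rewrite lt_min => /andP[s1 sW].
have sW' : W * `|s - t| <= e by rewrite mulrC -ler_pdivlMr// ltW.
have [ts|st] := leP t s.
  move: s1 sW'; rewrite [`|s - t|]ger0_norm ?subr_ge0// => s1 sW'.
  rewrite ger0_norm ?subr_ge0 ?w_mono//.
  by apply: le_trans (main _ _ ts (ltW s1)) _.
move: s1 sW'; rewrite distrC [`|t - s|]ger0_norm ?subr_ge0 ?(ltW st)// => s1 sW'.
rewrite distrC ger0_norm ?subr_ge0 ?w_mono ?(ltW st)//.
apply: le_trans (main _ _ (ltW st) (ltW s1)) _.
apply: le_trans sW'; rewrite ler_wpM2r ?subr_ge0 ?(ltW st)// /W lerD2l.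
by apply: w_mono; exact: ltW.
Qed.

(** With [y = log (1 + M r) + log (1 + r)], the choice of [k] makes
    [exp (- t / (2 M r))] equal to [((1 + M r) (1 + r))^-(N + 6)] when
    [M_log r = k t], which beats the growth of all the other factors. *)
Lemma remainder_le (N : nat) (t r C a c : R) (k := (2 * (N%:R + 6))^-1) :
  1 <= r -> M_log M r = k * t -> 0 <= C -> 0 <= a -> 0 <= c ->
  let P := C * ((1 + r) * M r) ^+ N in
  [/\ 1 <= t & r * (P * (2 * (a / (r ^+ (N + 3) * t ^+ (N + 3))) +
      2 * r * c * expR (- ((2 * M r)^-1 * t)))) <=
    (2 * a * C * 2 ^+ N + 8 * c * C * (N%:R + 6) ^+ 2) / t ^+ 2].
Proof.
move=> r1 rt C0 a0 c0 P; have r0 : 0 < r by exact: lt_le_trans r1.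
have m2 := M2 (ltW r0); set m := M r in m2 *.
have m0 : 0 < m by lra.
pose y := ln (1 + m) + ln (1 + r); pose Z := (1 + m) * (1 + r).
have Zm : m <= Z by rewrite /Z; nra.
have Z6 : 6 <= Z by rewrite /Z; nra.
have Z0 : 0 < Z by lra.
have yE : y = ln Z by rewrite /y /Z lnM ?posrE//; lra.
have N6 : 0 < (N%:R + 6 : R) by rewrite ltr_wpDl.
have tE : t = 2 * (N%:R + 6) * (m * y).
  have : m * y = k * t by rewrite -rt.
  by move=> ->; rewrite /k mulrA divff ?mul1r// gt_eqF// mulr_gt0.
have y1 : 1 <= y.
  rewrite yE -(expRK 1) ler_ln ?posrE ?expR_gt0//; apply: le_trans (_ : 4 <= _); last by lra.
  have -> : expR 1 = expR (1 / 2) * expR (1 / 2) :> R by rewrite -expRD; congr expR; field.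
  have -> : 4 = 2 * 2 :> R by ring.
  by apply: ler_pM; rewrite ?expR_ge0// expR_half_le2.
have yZ : y <= Z by rewrite yE ltW// ln_sublinear.
have mt : m <= t.
  rewrite tE; have : m <= m * y by rewrite ler_peMr// ltW.
  have : 1 <= 2 * (N%:R + 6 : R) by have := ler0n R N; lra.
  by move=> q1 q2; apply: le_trans q2 _; rewrite ler_peMl// mulr_ge0 ?(ltW m0)//; lra.
have t1 : 1 <= t by lra.
have t0 : 0 < t by lra.
split => //.
have tZ : t <= 2 * (N%:R + 6) * Z ^+ 2.
  rewrite tE ler_wpM2l ?mulr_ge0 ?(ltW N6)// expr2; apply: ler_pM => //; lra.
have eE : expR (- ((2 * m)^-1 * t)) = (Z ^+ (N + 6))^-1.
  rewrite expRN; congr (_^-1); have -> : (2 * m)^-1 * t = (N + 6)%:R * y.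
    by rewrite tE natrD; field; rewrite gt_eqF.
  by rewrite expRM_natl yE lnK// posrE.
rewrite eE /P.
set T1 := a / _.
have -> : r * (C * ((1 + r) * m) ^+ N * (2 * T1 + 2 * r * c / Z ^+ (N + 6))) =
  (r * C * ((1 + r) * m) ^+ N) * (2 * T1) + 2 * c * C * (r * r * ((1 + r) * m) ^+ N / Z ^+ (N + 6)).
  by field; rewrite gt_eqF// exprn_gt0.
rewrite [leRHS]mulrDl; apply: lerD.
  have -> : 2 * a * C * 2 ^+ N / t ^+ 2 = 2 * a * C * (2 ^+ N / t ^+ 2) by ring.
  have -> : r * C * ((1 + r) * m) ^+ N * (2 * T1) =
    2 * a * C * (r * ((1 + r) * m) ^+ N / (r ^+ (N + 3) * t ^+ (N + 3))).
    by rewrite /T1; field; rewrite !gt_eqF// exprn_gt0.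
  rewrite ler_wpM2l ?mulr_ge0//.
  apply: ler_div2; rewrite ?mulr_gt0 ?exprn_gt0//.
  have q1 : ((1 + r) * m) ^+ N <= (2 * r * t) ^+ N.
    apply: lerXn2r; rewrite ?nnegrE ?mulr_ge0 ?addr_ge0 ?(ltW r0) ?(ltW m0) ?(ltW t0)//.
    by apply: ler_pM; rewrite ?addr_ge0 ?(ltW r0) ?(ltW m0)//; lra.
  apply: (@le_trans _ _ (r * (2 * r * t) ^+ N * t ^+ 2)).
    by rewrite ler_wpM2r ?exprn_ge0 ?(ltW t0)// ler_wpM2l// ltW.
  rewrite !exprMn !exprD.
  have -> : r * (2 ^+ N * r ^+ N * t ^+ N) * t ^+ 2 = (2 ^+ N * r ^+ N * t ^+ N) * (r * t ^+ 2) by ring.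
  have -> : 2 ^+ N * (r ^+ N * r ^+ 3 * (t ^+ N * t ^+ 3)) = (2 ^+ N * r ^+ N * t ^+ N) * (r ^+ 3 * t ^+ 3) by ring.
  rewrite ler_wpM2l ?mulr_ge0 ?exprn_ge0 ?(ltW r0) ?(ltW t0)//.
  apply: ler_pM; rewrite ?exprn_ge0 ?(ltW r0) ?(ltW t0)//.
    by rewrite -{1}[r]expr1; apply: ler_weXn2l.
  by apply: ler_weXn2l.
have -> : 8 * c * C * (N%:R + 6) ^+ 2 / t ^+ 2 = 2 * c * C * (4 * (N%:R + 6) ^+ 2 / t ^+ 2) by ring.
rewrite ler_wpM2l ?mulr_ge0//.
apply: ler_div2; rewrite ?exprn_gt0//.
have q1 : r * r * ((1 + r) * m) ^+ N <= Z ^+ 2 * Z ^+ N.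
  have rZ : r <= Z by rewrite /Z; nra.
  have rmZ : (1 + r) * m <= Z by rewrite /Z; nra.
  apply: ler_pM.
  - by rewrite mulr_ge0// ltW.
  - by rewrite exprn_ge0// mulr_ge0 ?addr_ge0// ltW.
  - by rewrite expr2; apply: ler_pM => //; rewrite ltW.
  - by apply: lerXn2r; rewrite ?nnegrE ?(ltW Z0)// mulr_ge0 ?addr_ge0// ltW.
have q2 : t ^+ 2 <= (2 * (N%:R + 6) * Z ^+ 2) ^+ 2.
  apply: lerXn2r => //; rewrite ?nnegrE ?(ltW t0)//.
  by rewrite (le_trans (ltW t0)).
apply: (@le_trans _ _ ((Z ^+ 2 * Z ^+ N) * (2 * (N%:R + 6) * Z ^+ 2) ^+ 2)).
  apply: ler_pM => //; first by rewrite !mulr_ge0 ?exprn_ge0 ?mulr_ge0 ?addr_ge0 ?(ltW r0) ?(ltW m0).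
  by rewrite exprn_ge0// ltW.
by rewrite le_eqVlt; apply/orP; left; apply/eqP; rewrite exprD; ring.
Qed.

End Inverse.

(** Dominated convergence of the restrictions of [q] to [[n, +oo[]. *)
Lemma integral_tail (q : R -> R) : mu.-integrable D (EFin \o q) ->
  (forall s, 0 <= s -> 0 <= q s) -> forall e, 0 < e ->
  exists2 T, 0 <= T & forall t, T <= t -> \int[mu]_(s in `]t, +oo[) q s <= e.
Proof.
move=> qi q0 e e0.
have mD : measurable D by exact: measurable_itv.
have Dge (s : R) : D s -> 0 <= s by rewrite /= in_itv/= andbT.
have [mq _] := integrableP _ _ _ qi.
pose f_ (n : nat) := (EFin \o q) \_ (`]n%:R, +oo[%classic : set R).
have f_E n s : f_ n s = if n%:R < s then (q s)%:E else 0%E.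
  rewrite /f_ /patch; case: ifPn.
    by rewrite inE/= in_itv/= andbT => ->.
  by rewrite notin_setE/= in_itv/= andbT => /negP/negbTE ->.
have mf n : measurable_fun D (f_ n).
  by apply/measurable_restrict => //; apply: measurable_funS mq => // s [].
have cv := @dominated_cvg _ _ _ mu D mD f_ (cst 0%E) (EFin \o q) mf.
have {}cv : (\int[mu]_(s in D) f_ n s)%E @[n --> \oo] --> 0%E.
  rewrite -(@integral0 _ _ _ mu D); apply: cv => //.
  - move=> s _; apply: cvg_near_cst; near=> n; apply/eqP; rewrite f_E ltNge.
    suff -> : s <= n%:R by []. near: n; exact: nbhs_infty_ger.
  - move=> n s /Dge s0; rewrite f_E; case: ifP => _; rewrite ?abse0 ?lee_fin ?q0//.
    by rewrite ger0_norm ?q0.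
have [n _ nP] : \forall n \near \oo, (\int[mu]_(s in D) f_ n s < e%:E)%E.
  have /fine_cvgP[fn /cvgr_lt/(_ e e0) ce] := cv.
  near=> n; rewrite -[ltLHS]fineK; last by near: n.
  by rewrite lte_fin; near: n.
exists n%:R => // t nt; have t0 : 0 <= t by exact: le_trans nt.
have mt : measurable (`]t, +oo[%classic : set R) by exact: measurable_itv.
have tD : (`]t, +oo[%classic : set R) `<=` D.
  by move=> s; rewrite /= !in_itv/= !andbT => /ltW; exact: le_trans.
rewrite -lee_fin fineK; last first.
  have qt : mu.-integrable (`]t, +oo[%classic : set R) (EFin \o q).
    exact: (@integrableS _ _ _ mu D _ _ mD mt tD qi).
  exact: (@integrable_fin_num _ _ _ mu _ mt _ qt).
apply: le_trans (ltW (nP n (leqnn n))).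
rewrite -integral_mkcondr; apply: ge0_subset_integral.
- exact: mt.
- exact: measurableI.
- by apply: measurable_funS mq => // s [].
- by move=> s [/Dge s0 _]; rewrite lee_fin q0.
- move=> s; rewrite /= !in_itv/= !andbT => ts; split; last exact: le_lt_trans ts.
  by rewrite ltW// (le_lt_trans t0).
Unshelve. all: end_near. Qed.

End Weight.

(** * Linear functionals *)

Section HahnBanach.
Context {R : realType} {X : normedModType R[i]}.
Variable x0 : X.

(** Real-linear functionals dominated by the norm on a subspace, encoded by
    their graphs, so that chains have unions as upper bounds. *)
Definition dominated_graph (A : set (X * R)) : Prop :=
  [/\ forall u v, A u -> A v -> A (u.1 + v.1, u.2 + v.2),
      forall (k : R) u, A u -> A (k%:C *: u.1, k * u.2)
    & forall u, A u -> u.2 <= rnorm u.1].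

Definition norming_graph (A : set (X * R)) : Prop :=
  dominated_graph A /\ (A = set0 \/ A (x0, rnorm x0)).

Lemma norming_graph_bigcup (F : set (set (X * R))) : F `<=` norming_graph ->
  total_on F subset -> norming_graph (\bigcup_(A in F) A).
Proof.
move=> FP Ft; split; first split.
- move=> u v [A FA Au] [B FB Bv].
  have [AB|BA] := Ft _ _ FA FB.
    by exists B => //; have [[+ _ _] _] := FP _ FB; apply => //; exact: AB.
  by exists A => //; have [[+ _ _] _] := FP _ FA; apply => //; exact: BA.
- move=> k u [A FA Au]; exists A => //.
  by have [[_ + _] _] := FP _ FA; apply.
- by move=> u [A FA Au]; have [[_ _ +] _] := FP _ FA; apply.
have [[A [FA A0]]|nA] := pselect (exists A, F A /\ A !=set0).
  right; exists A => //; have [_ [Ae|//]] := FP _ FA.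
  by move: A0; rewrite Ae => -[].
left; rewrite -subset0 => u [A FA Au]; apply: nA.
by exists A; split => //; exists u.
Qed.

(** The one-dimensional extension step: the value at [v] has to lie between
    [a - |y - v|] and [|z + v| - b] for all points [(y, a)] and [(z, b)] of
    the graph, and the triangle inequality leaves room for it. *)
Lemma dominated_graph_extend A (v : X) : dominated_graph A -> A !=set0 ->
  exists c : R, dominated_graph
    [set u | exists2 y, A y & exists k : R, u = (y.1 + k%:C *: v, y.2 + k * c)].
Proof.
move=> [Aa As Ad] [a0 Aa0].
pose S : set R := [set y.2 - rnorm (y.1 - v) | y in A].
have Sle y z : A y -> A z -> y.2 - rnorm (y.1 - v) <= rnorm (z.1 + v) - z.2.
  move=> Ay Az; have := Ad _ (Aa _ _ Ay Az) => /= H.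
  have : rnorm (y.1 + z.1) <= rnorm (y.1 - v) + rnorm (z.1 + v).
    by apply: le_trans (rnormD _ _); rewrite addrACA [- v + v]addrC subrr addr0.
  by lra.
have S0 : S !=set0 by exists (a0.2 - rnorm (a0.1 - v)); exists a0.
have Sub z : A z -> ubound S (rnorm (z.1 + v) - z.2).
  by move=> Az _ [y Ay <-]; exact: Sle.
have Sb : has_ubound S by exists (rnorm (a0.1 + v) - a0.2); exact: Sub.
pose c := sup S.
have c1 y : A y -> y.2 - c <= rnorm (y.1 - v).
  move=> Ay; have : y.2 - rnorm (y.1 - v) <= c by apply: ub_le_sup => //; exists y.
  by lra.
have c2 y : A y -> y.2 + c <= rnorm (y.1 + v).
  move=> Ay; have : c <= rnorm (y.1 + v) - y.2 by apply: ge_sup => //; exact: Sub.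
  by lra.
exists c; split.
- move=> _ _ [y Ay [k ->]] [z Az [l ->]]; exists (y.1 + z.1, y.2 + z.2); first exact: Aa.
  exists (k + l) => /=; rewrite rmorphD /= scalerDl mulrDl.
  by congr (_, _); rewrite addrACA.
- move=> m _ [y Ay [k ->]]; exists (m%:C *: y.1, m * y.2); first exact: As.
  exists (m * k) => /=; rewrite rmorphM /= scalerDr scalerA mulrDr mulrA //.
- move=> _ [y Ay [k ->]] /=.
  have [k0|k0|->] := ltrgt0P k; last by rewrite scale0r mul0r !addr0; exact: Ad.
    have := c2 _ (As k^-1 _ Ay) => /= H.
    have -> : y.1 + k%:C *: v = k%:C *: ((k^-1)%:C *: y.1 + v).
      by rewrite scalerDr scalerA -rmorphM /= divff ?gt_eqF// scale1r.
    rewrite rnormZ cabs_real gtr0_norm//.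
    have -> : y.2 + k * c = k * (k^-1 * y.2 + c) by rewrite mulrDr mulrA divff ?gt_eqF// mul1r.
    by rewrite ler_pM2l.
  have k0' : 0 < - k by rewrite oppr_gt0.
  have kn : - k != 0 by rewrite gt_eqF.
  have := c1 _ (As (- k)^-1 _ Ay) => /= H.
  have -> : y.1 + k%:C *: v = (- k)%:C *: (((- k)^-1)%:C *: y.1 - v).
    by rewrite scalerDr scalerA -rmorphM /= divff// scale1r rmorphN /= scalerN scaleNr opprK.
  rewrite rnormZ cabs_real gtr0_norm//.
  have -> : y.2 + k * c = - k * ((- k)^-1 * y.2 - c).
    by rewrite mulrDr mulrA divff// mul1r mulrN mulNr opprK.
  by rewrite ler_pM2l.
Qed.

Lemma real_hahn_banach : exists phi : X -> R,
  [/\ forall y z, phi (y + z) = phi y + phi z,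
      forall (k : R) y, phi (k%:C *: y) = k * phi y,
      forall y, phi y <= rnorm y & phi x0 = rnorm x0].
Proof.
have [A [[Ag A0] Amax]] := Zorn_bigcup norming_graph_bigcup.
have Ax0 : A (x0, rnorm x0).
  case: A0 => // A0; exfalso.
  apply: (Amax [set u | exists k : R, u = (k%:C *: x0, k * rnorm x0)]).
    split; first by rewrite A0.
    move=> /(_ (x0, rnorm x0)); rewrite A0; apply.
    by exists 1; rewrite scale1r mul1r.
  split; last by right; exists 1; rewrite scale1r mul1r.
  split.
  - move=> _ _ [k ->] [l ->]; exists (k + l) => /=.
    by rewrite rmorphD /= scalerDl mulrDl.
  - by move=> m _ [k ->]; exists (m * k) => /=; rewrite rmorphM /= scalerA mulrA.
  - move=> _ [k ->] /=; rewrite rnormZ cabs_real ler_wpM2r ?rnorm_ge0//.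
    exact: ler_norm.
have [Aa As Ad] := Ag.
have A00 : A (0, 0).
  by have := As 0 _ Ax0; rewrite /= scale0r mul0r.
have dom v : exists a, A (v, a).
  apply: contrapT => nv.
  have [c Bg] := dominated_graph_extend v Ag (ex_intro _ _ A00).
  pose B := [set u | exists2 y, A y & exists k : R, u = (y.1 + k%:C *: v, y.2 + k * c)].
  have AB : A `<=` B.
    move=> [y a] Ay; exists (y, a) => //; exists 0.
    by rewrite scale0r mul0r !addr0.
  apply: (Amax B); last by split => //; right; exact: AB.
  split => // BA; apply: nv; exists c; apply: BA; exists (0, 0) => //.
  by exists 1; rewrite scale1r mul1r !add0r.
have uniq v a b : A (v, a) -> A (v, b) -> a = b.
  have le a' b' : A (v, a') -> A (v, b') -> a' <= b'.
    move=> Aa' Ab'; have := Ad _ (Aa _ _ Aa' (As (-1) _ Ab')).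
    by rewrite /= rmorphN /= scaleN1r subrr rnorm0 mulN1r subr_le0.
  by move=> Aa' Ab'; apply/eqP; rewrite eq_le !le.
have [phi phiP] := choice dom.
exists phi; split.
- by move=> y z; apply: uniq (phiP _) (Aa _ _ (phiP y) (phiP z)).
- by move=> k y; apply: uniq (phiP _) (As k _ (phiP y)).
- by move=> y; exact: (Ad _ (phiP y)).
- exact: uniq (phiP _) Ax0.
Qed.

End HahnBanach.

Section Functionals.
Context {R : realType} {X : normedModType R[i]}.

Definition unit_functional (Phi : X -> R[i]) : Prop :=
  (forall (a : R[i]) y z, Phi (a *: y + z) = a * Phi y + Phi z) /\
  forall y, cabs (Phi y) <= rnorm y.

(** A complex functional is recovered from its real part [phi] as
    [phi y - i phi (i y)]; rotating [y] so that its value is real shows that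
    both have the same norm. *)
Theorem hahn_banach (x0 : X) : exists2 Phi, unit_functional Phi & Phi x0 = (rnorm x0)%:C.
Proof.
have [phi [phiD phiZ phile phix0]] := real_hahn_banach x0.
pose Phi y := phi y +i* (- phi ('i *: y)).
have PhiD y z : Phi (y + z) = Phi y + Phi z.
  by apply: complex_eq; rewrite ?ReD ?ImD /= ?scalerDr !phiD ?opprD.
have PhiZ (a : R[i]) y : Phi (a *: y) = a * Phi y.
  have aE : a *: y = (complex.Re a)%:C *: y + (complex.Im a)%:C *: ('i *: y).
    by rewrite {1}[a]complexE scalerDl scalerA [_ * 'i]mulrC.
  have iaE : 'i *: (a *: y) = (complex.Re a)%:C *: ('i *: y) + (- complex.Im a)%:C *: y.
    rewrite aE scalerDr !scalerA [in 'i * _]mulrC; congr (_ + _ *: y).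
    by apply: complex_eq; rewrite ?ReM ?ImM/=; ring.
  apply: complex_eq.
    by rewrite (ReM a (Phi y)) /= aE phiD !phiZ; ring.
  by rewrite (ImM a (Phi y)) /= iaE phiD !phiZ; ring.
have Phile y : cabs (Phi y) <= rnorm y.
  have [->|P0] := eqVneq (Phi y) 0; first by rewrite cabs0 rnorm_ge0.
  pose th := (cabs (Phi y))%:C / Phi y.
  have cth : cabs th = 1.
    by rewrite /th cabsM cabsV cabs_real ger0_norm ?cabs_ge0// divff// gt_eqF// cabs_gt0.
  have E : Phi (th *: y) = (cabs (Phi y))%:C by rewrite PhiZ /th divfK.
  have -> : cabs (Phi y) = phi (th *: y) by have := congr1 (@complex.Re R) E.
  by apply: le_trans (phile _) _; rewrite rnormZ cth mul1r.
exists Phi; first by split => // a y z; rewrite PhiD PhiZ.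
have Rx : complex.Re (Phi x0) = rnorm x0 by [].
apply: complex_eq => //=.
have : cabs (Phi x0) ^+ 2 <= rnorm x0 ^+ 2.
  by apply: lerXn2r; rewrite ?nnegrE ?cabs_ge0 ?rnorm_ge0.
rewrite cabs_sqr Rx gerDl => I0; apply/eqP; rewrite -sqrf_eq0 eq_le I0 /=.
exact: sqr_ge0.
Qed.

Lemma unit_functional0 Phi : unit_functional Phi -> Phi 0 = 0.
Proof.
move=> [_ /(_ 0)]; rewrite rnorm0 => P0; apply: cabs_eq0.
by apply/eqP; rewrite eq_le P0 cabs_ge0.
Qed.

Lemma unit_functionalD Phi y z : unit_functional Phi -> Phi (y + z) = Phi y + Phi z.
Proof. by move=> [L _]; have := L 1 y z; rewrite scale1r mul1r. Qed.

Lemma unit_functionalZ Phi a y : unit_functional Phi -> Phi (a *: y) = a * Phi y.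
Proof.
by move=> P; case: (P) => L _; have := L a y 0; rewrite (unit_functional0 P) !addr0.
Qed.

Lemma unit_functionalB Phi y z : unit_functional Phi -> Phi (y - z) = Phi y - Phi z.
Proof.
by move=> P; rewrite -scaleN1r (unit_functionalD _ _ P) (unit_functionalZ _ _ P) mulN1r.
Qed.

Lemma functional_norm_le (y : X) (k : R) :
  (forall Phi, unit_functional Phi -> cabs (Phi y) <= k) -> rnorm y <= k.
Proof.
move=> H; have [Phi P E] := hahn_banach y.
by have := H _ P; rewrite E cabs_real ger0_norm ?rnorm_ge0.
Qed.

Lemma functional_separates (y z : X) :
  (forall Phi, unit_functional Phi -> Phi y = Phi z) -> y = z.
Proof.
move=> H; apply/eqP; rewrite -subr_eq0; apply/eqP; apply: rnorm_eq0; apply/eqP.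
rewrite eq_le rnorm_ge0 andbT; apply: functional_norm_le => Phi P.
by rewrite (unit_functionalB _ _ P) (H _ P) subrr cabs0.
Qed.

End Functionals.

(** * Weak integrals of vector-valued functions *)

Section Translation.
Context {R : realType}.
Local Notation mu := (@lebesgue_measure R).

Lemma lebesgue_measure_translation (t : R) (A : set R) : measurable A ->
  pushforward mu (+%R t : _ -> measurableTypeR R) A = mu A.
Proof.
have mt : measurable_fun setT (+%R t : measurableTypeR R -> measurableTypeR R).
  by apply: measurable_funD.
move=> mA; apply/esym/lebesgue_measure_unique => //= _ [[a b]] _ <-.
rewrite /pushforward.
have -> : (+%R t : R -> R) @^-1` `]a, b] = `](a - t), (b - t)]%classic.
  by apply/seteqP; split => x /=; rewrite !in_itv/= ltrBlDl lerBrDl.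
by rewrite /= !lebesgue_measure_itv/= !lte_fin ltrD2r; case: ifPn => // _; rewrite -!EFinB; congr EFin; ring.
Qed.

Lemma ge0_integral_translation (t : R) (f : R -> \bar R) :
  measurable_fun `[t, +oo[ f -> (forall x, `[t, +oo[%classic x -> (0 <= f x)%E) ->
  (\int[mu]_(s in `[t, +oo[) f s = \int[mu]_(s in `[0%R, +oo[) f (t + s)%R)%E.
Proof.
have mt : measurable_fun setT (+%R t : measurableTypeR R -> measurableTypeR R).
  by apply: measurable_funD.
move=> mf f0.
have -> : `[0%R, +oo[%classic = (+%R t : _ -> measurableTypeR R) @^-1` `[t, +oo[.
  by apply/seteqP; split => x /=; rewrite !in_itv/= !andbT lerDl.
rewrite -(@ge0_integral_pushforward _ _ _ _ R _ mt mu `[t, +oo[ f)//.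
  by apply: eq_measure_integral => //= A mA AS; exact/esym/lebesgue_measure_translation.
by move=> x; rewrite inE => /f0.
Qed.

Lemma integral_translation (t : R) (f : R -> \bar R) :
  measurable_fun `[t, +oo[ f ->
  (\int[mu]_(s in `[t, +oo[) f s = \int[mu]_(s in `[0%R, +oo[) f (t + s)%R)%E.
Proof.
move=> mf; rewrite integralE [RHS]integralE.
congr (_ - _)%E.
- rewrite (ge0_integral_translation (measurable_funepos mf)); last by move=> x _; exact: funepos_ge0.
  by apply: eq_integral => s _; have := congr1 (fun k => k s) (funepos_comp f (+%R t)) => /= <-.
- rewrite (ge0_integral_translation (measurable_funeneg mf)); last by move=> x _; exact: funeneg_ge0.
  by apply: eq_integral => s _; have := congr1 (fun k => k s) (funeneg_comp f (+%R t)) => /= <-.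
Qed.

Lemma cint_translation (t : R) (f : R -> R[i]) : cmeasurable `[t, +oo[ f ->
  cint `[t, +oo[ f = cint `[0, +oo[ (fun s => f (t + s)).
Proof.
move=> [m1 m2]; apply: complex_eq => /=; rewrite /Rintegral; congr fine.
- by rewrite integral_translation//; exact/measurable_EFinP.
- by rewrite integral_translation//; exact/measurable_EFinP.
Qed.

End Translation.

Section HalflineContinuity.
Context {R : realType}.
Local Notation D := (`[0%R, +oo[%classic : set R).

Definition halfline_continuous (X : normedModType R[i]) (u : R -> X) : Prop :=
  forall t e : R, 0 <= t -> 0 < e -> exists2 d, 0 < d &
    forall s, 0 <= s -> `|s - t| < d -> rnorm (u s - u t) <= e.

Lemma max_lipschitz (s t : R) : 0 <= t -> `|Num.max 0 s - t| <= `|s - t|.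
Proof.
move=> t0; case: (leP 0 s) => [//|s0].
by rewrite sub0r normrN (ger0_norm t0) distrC ger0_norm; lra.
Qed.

(** The projection [max 0] of the line onto the half-line does not increase
    distances; composing with it gives access to the criteria for functions
    that are continuous everywhere. *)
Lemma halfline_continuous_max (v : R -> R) :
  (forall t e : R, 0 <= t -> 0 < e -> exists2 d, 0 < d &
    forall s, 0 <= s -> `|s - t| < d -> `|v s - v t| <= e) ->
  continuous (fun s : R => v (Num.max 0 s)).
Proof.
move=> vc t; apply: ball_segment => e e0.
have m0 s : 0 <= Num.max 0 s :> R by rewrite le_max lexx.
have [d d0 H] := vc _ _ (m0 t) e0; exists d => // s st; apply: H => //.
apply: le_lt_trans st; have [t0|t0] := leP 0 t; first exact: max_lipschitz.
case: (leP 0 s) => [s0|s0]; last by rewrite subrr normr0.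
by rewrite subr0 !ger0_norm; lra.
Qed.

Lemma halfline_continuous_measurable (v : R -> R) :
  (forall t e : R, 0 <= t -> 0 < e -> exists2 d, 0 < d &
    forall s, 0 <= s -> `|s - t| < d -> `|v s - v t| <= e) ->
  measurable_fun D v.
Proof.
move=> /halfline_continuous_max/continuous_measurable_fun mv.
apply: (@eq_measurable_fun _ _ _ _ D (fun s => v (Num.max 0 s))).
  by move=> s; rewrite inE/= in_itv/= andbT => s0; rewrite max_r.
exact: measurable_funTS.
Qed.

Lemma measurable_functional (X : normedModType R[i]) (u : R -> X) Phi :
  halfline_continuous u -> unit_functional Phi -> cmeasurable D (fun s => Phi (u s)).
Proof.
move=> uc P.
have H t e : 0 <= t -> 0 < e -> exists2 d : R, 0 < d &
    forall s, 0 <= s -> `|s - t| < d -> cabs (Phi (u s) - Phi (u t)) <= e.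
  move=> t0 e0; have [d d0 ud] := uc _ _ t0 e0; exists d => // s s0 st.
  by rewrite -(unit_functionalB _ _ P); apply: le_trans (P.2 _) _; exact: ud.
split; apply: halfline_continuous_measurable => t e t0 e0.
- have [d d0 ud] := H _ _ t0 e0; exists d => // s s0 st.
  by rewrite -ReN -ReD; apply: le_trans (Re_le_cabs _) _; exact: ud.
- have [d d0 ud] := H _ _ t0 e0; exists d => // s s0 st.
  by rewrite -ImN -ImD; apply: le_trans (Im_le_cabs _) _; exact: ud.
Qed.

Lemma rnorm_triangle (X : normedModType R[i]) (x y : X) :
  `|rnorm x - rnorm y| <= rnorm (x - y).
Proof.
rewrite ler_norml; apply/andP; split.
  by have := rnormD (y - x) x; rewrite subrK rnorm_distC; lra.
by have := rnormD (x - y) y; rewrite subrK; lra.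
Qed.

Lemma measurable_rnorm (X : normedModType R[i]) (u : R -> X) :
  halfline_continuous u -> measurable_fun D (fun s => rnorm (u s)).
Proof.
move=> uc; apply: halfline_continuous_measurable => t e t0 e0.
have [d d0 ud] := uc _ _ t0 e0; exists d => // s s0 st.
by apply: le_trans (rnorm_triangle _ _) _; exact: ud.
Qed.

End HalflineContinuity.

Section WeakIntegral.
Context {R : realType} {X : completeNormedModType R[i]}.
Local Notation mu := (@lebesgue_measure R).
Local Notation D := (`[0%R, +oo[%classic : set R).
Variables (u : R -> X) (q : R -> R).
Hypothesis ucont : forall B e : R, 0 < e -> exists2 d, 0 < d &
  forall s t, 0 <= s -> s <= t -> t <= B -> t - s < d -> rnorm (u t - u s) <= e.
Hypothesis uq : forall s, 0 <= s -> rnorm (u s) <= q s.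
Hypothesis qi : mu.-integrable D (EFin \o q).

Lemma locally_uniform_halfline_continuous : halfline_continuous u.
Proof.
move=> t e t0 e0; have [d d0 ud] := ucont (t + 1) e0.
exists (Num.min d 1); first by rewrite lt_min d0 ltr01.
move=> s s0; rewrite lt_min => /andP[st s1].
have [ts|st'] := leP t s.
  move: st s1; rewrite ger0_norm ?subr_ge0// => st s1.
  by apply: ud => //; lra.
move: st s1; rewrite distrC gtr0_norm ?subr_gt0// => st s1.
by rewrite rnorm_distC; apply: ud => //; lra.
Qed.

Lemma weak_integrable Phi : unit_functional Phi -> cintegrable D (fun s => Phi (u s)).
Proof.
move=> P; have [m1 m2] := measurable_functional locally_uniform_halfline_continuous P.
apply: (@le_cintegrable R D (fun s => Phi (u s)) q) => //.
move=> s; rewrite /= in_itv/= andbT => s0.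
by apply: le_trans (P.2 _) _; exact: uq.
Qed.

Lemma weak_integrable_itv Phi (a b : R) : 0 <= a -> unit_functional Phi ->
  cintegrable `[a, b] (fun s => Phi (u s)).
Proof.
move=> a0 P; apply: (@cintegrableS R D) (weak_integrable P) => //.
by move=> s; rewrite /= !in_itv/= andbT => /andP[/(le_trans a0)].
Qed.

Lemma riemann_sum_approx (eta e : R) (K : nat) : 0 < eta ->
  (forall s t, 0 <= s -> s <= t -> t <= K%:R * eta -> t - s <= eta ->
     rnorm (u t - u s) <= e) ->
  exists y : X, forall Phi, unit_functional Phi ->
    cabs (Phi y - cint `[0, K%:R * eta] (fun s => Phi (u s))) <= K%:R * eta * e.
Proof.
move=> eta0; elim: K => [|K IH] ue.
  exists 0 => Phi P; rewrite !mul0r (unit_functional0 P) sub0r cabsN.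
  have := @cabs_cint_itv_le R 0 0 (rnorm (u 0)) (fun s => Phi (u s)) (lexx 0).
  rewrite subrr mulr0; apply; first exact: weak_integrable_itv.
  by move=> x; rewrite -eq_le => /eqP <-; exact: P.2.
have KS : K.+1%:R * eta = K%:R * eta + eta by rewrite -natr1 mulrDl mul1r.
have [|y yP] := IH.
  by move=> s t s0 st tK; apply: ue => //; rewrite KS; lra.
set A := K%:R * eta in KS yP *.
have A0 : 0 <= A by rewrite mulr_ge0// ltW.
exists (y + eta%:C *: u A) => Phi P; rewrite KS.
rewrite (@cint_itv_split R 0 A)//; [|lra|exact: weak_integrable_itv].
rewrite (unit_functionalD _ _ P) (unit_functionalZ _ _ P).
have -> : eta%:C * Phi (u A) = cint `[A, A + eta] (fun=> Phi (u A)).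
  by rewrite cint_cst; [congr (_%:C * _); ring|lra].
rewrite opprD addrACA -cintB//; last 2 first.
- exact: cintegrable_cst.
- exact: weak_integrable_itv.
apply: le_trans (cabsD _ _) _; rewrite mulrDl; apply: lerD; first exact: yP.
have -> : eta * e = e * (A + eta - A) by ring.
apply: cabs_cint_itv_le.
- by rewrite lerDl ltW.
- by apply: cintegrableB => //; [exact: cintegrable_cst|exact: weak_integrable_itv].
- move=> s /andP[As sA]; rewrite -(unit_functionalB _ _ P).
  apply: le_trans (P.2 _) _; rewrite rnorm_distC; apply: ue => //.
    by rewrite KS.
  by lra.
Qed.

(** The integral of [q] bounds the part beyond [B], and a Riemann sum of small
    mesh approximates the integral over [[0, B]]. *)
Lemma weak_integral_approx (e : R) : 0 < e -> exists y : X, forall Phi, unit_functional Phi ->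
  cabs (Phi y - cint D (fun s => Phi (u s))) <= e.
Proof.
move=> e0; have e2 : 0 < e / 2 by lra.
have q0 s : 0 <= s -> 0 <= q s by move=> /uq; apply: le_trans; exact: rnorm_ge0.
have [B0 B00 tail] := integral_tail qi q0 e2.
pose B := B0 + 1; have Bp : 0 < B by rewrite /B; lra.
have eB : 0 < e / 2 / B by rewrite divr_gt0.
have [d d0 ud] := ucont B eB.
pose K := (Num.Def.trunc (B / d)).+1; pose eta := B / K%:R.
have K0 : 0 < K%:R :> R by rewrite ltr0n.
have eta0 : 0 < eta by rewrite divr_gt0.
have etad : eta < d.
  by rewrite /eta ltr_pdivrMr// mulrC -ltr_pdivrMr// /K truncnS_gt.
have KB : K%:R * eta = B by rewrite /eta mulrC divfK// gt_eqF.
have [|y yP] := @riemann_sum_approx eta (e / 2 / B) K eta0.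
  by move=> s t s0 st; rewrite KB => tB ts; apply: ud => //; exact: le_lt_trans etad.
exists y => Phi P; have := yP _ P; rewrite KB => H.
rewrite (cint_halfline_split (ltW Bp) (weak_integrable P)) opprD addrA.
apply: le_trans (cabsB _ _) _; have -> : e = B * (e / 2 / B) + e / 2.
  by field; rewrite gt_eqF.
apply: lerD => //.
have BD : `]B, +oo[%classic `<=` D.
  by move=> s; rewrite /= !in_itv/= !andbT => /ltW; apply: le_trans; exact: ltW.
have B0B : B0 <= B by rewrite /B; lra.
apply: le_trans (tail _ B0B); apply: cabs_cint_le.
- exact: measurable_itv.
- by apply: (@cintegrableS R D) (weak_integrable P).
- exact: (@integrableS _ _ _ mu D _ _ (measurable_itv _) (measurable_itv _) BD qi).
- move=> s /BD; rewrite /= in_itv/= andbT => s0.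
  by apply: le_trans (P.2 _) _; exact: uq.
Qed.

(** Riemann sums converge weakly, at a rate that does not depend on the
    functional; hence they form a Cauchy sequence in norm. *)
Theorem weak_integral : exists y : X, forall Phi, unit_functional Phi ->
  Phi y = cint D (fun s => Phi (u s)).
Proof.
have e0 n : 0 < n.+1%:R^-1 :> R by rewrite invr_gt0 ltr0n.
have [y yP] := choice (fun n => weak_integral_approx (e0 n)).
have yd n m : rnorm (y n - y m) <= n.+1%:R^-1 + m.+1%:R^-1.
  apply: functional_norm_le => Phi P; rewrite (unit_functionalB _ _ P).
  set I := cint D (fun s => Phi (u s)).
  have -> : Phi (y n) - Phi (y m) = (Phi (y n) - I) - (Phi (y m) - I).
    by rewrite opprB addrA subrK.
  by apply: le_trans (cabsB _ _) _; apply: lerD; exact: yP.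
have small (e : R) : 0 < e -> \forall n \near \oo, n.+1%:R^-1 < e.
  by move=> e1; exact: near_infty_natSinv_lt (PosNum e1).
have yC : cvg (y @ \oo).
  apply/cauchy_cvgP/cauchy_ballP => e ep.
  have er : e = (complex.Re e)%:C by rewrite RRe_real// gtr0_real.
  have e0' : 0 < complex.Re e / 2 by rewrite divr_gt0// -ltcR -er.
  pose S : set X := [set z | exists2 n, n.+1%:R^-1 < complex.Re e / 2 & y n = z].
  have yS : (y @ \oo) S by apply: filterS (small _ e0') => n n1; exists n.
  exists (S, S); first by split.
  move=> [_ _] /= [[n n1 <-] [m m1 <-]]; rewrite -ball_normE /ball_ /= rnormE er ltcR.
  apply: le_lt_trans (yd _ _) _.
  by rewrite [ltRHS](splitr (complex.Re e)) ltrD.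
exists (lim (y @ \oo)) => Phi P; set z := lim _; set I := cint _ _.
suff H e : 0 < e -> cabs (Phi z - I) <= e.
  apply/eqP; rewrite -subr_eq0; apply/eqP; apply: cabs_eq0; apply/eqP.
  rewrite eq_le cabs_ge0 andbT leNgt; apply/negP => h0.
  by have := H (cabs (Phi z - I) / 2); rewrite divr_gt0// => /(_ isT); lra.
move=> e1; have e2 : 0 < e / 2 by lra.
have e2' : 0 < (e / 2)%:C by rewrite ltcR.
have /cvgrPdist_le/(_ _ e2') yz : y @ \oo --> z by exact: yC.
have [n [n1 n2]] := filter_ex (filterI yz (small _ e2)).
have -> : Phi z - I = Phi (z - y n) + (Phi (y n) - I).
  by rewrite (unit_functionalB _ _ P) addrA subrK.
apply: le_trans (cabsD _ _) _.
have -> : e = e / 2 + e / 2 by field.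
apply: lerD; last by apply: le_trans (yP _ _ P) (ltW n2).
by apply: le_trans (P.2 _) _; rewrite -lecR -rnormE.
Qed.

End WeakIntegral.

(** * The resolvent of a semigroup as a Laplace transform *)

Section Limits.
Context {R : realType} {X : normedModType R[i]}.

Lemma cvg_rnormP {U : Type} (F : set_system U) (f : U -> X) (y : X) : Filter F ->
  f @ F --> y <-> forall e : R, 0 < e -> \forall t \near F, rnorm (f t - y) <= e.
Proof.
move=> FF; split.
- move=> /cvgrPdist_le H e e0; have e0' : 0 < e%:C by rewrite ltcR.
  by apply: filterS (H _ e0') => t; rewrite rnormE lecR rnorm_distC.
- move=> H; apply/cvgrPdist_le => e e0.
  have er : e = (complex.Re e)%:C by rewrite RRe_real// gtr0_real.
  have e0' : 0 < complex.Re e by rewrite -ltcR -er.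
  by apply: filterS (H _ e0') => t; rewrite rnorm_distC er rnormE lecR.
Qed.

Lemma near_right0 (P : R -> Prop) : (\forall t \near (0 : R)^'+, P t) <->
  exists2 d : R, 0 < d & forall t, 0 < t -> t < d -> P t.
Proof.
split.
- move=> [d /= d0 H]; exists d => // t t0 td; apply: H => //=.
  by rewrite sub0r normrN gtr0_norm.
- move=> [d d0 H]; exists d => //= t /=; rewrite sub0r normrN => td t0.
  by apply: H => //; rewrite -(gtr0_norm t0).
Qed.

End Limits.

Section Semigroup.
Context {R : realType} {X : completeNormedModType R[i]}.
Local Notation mu := (@lebesgue_measure R).
Local Notation D := (`[0%R, +oo[%classic : set R).

Lemma mulr_le_eps (k e : R) : 0 <= k -> 0 < e -> k * (e / (k + 1)) <= e.
Proof.
move=> k0 e0; rewrite mulrC -mulrA ler_piMr ?(ltW e0)//.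
by rewrite mulrC ler_pdivrMr ?mul1r; lra.
Qed.

Lemma expR_integrable (k : R) : 0 < k -> mu.-integrable D (EFin \o (fun s => expR (- (k * s)))).
Proof.
move=> k0; have mD : measurable D by exact: measurable_itv.
have ki := @kern_integrable R k 0 k0 (lexx _).
apply: (@le_integrable _ _ _ mu D mD _ (EFin \o (fun s => 4 / k * kern k 0 s))).
- apply/measurable_EFinP; apply: measurable_funTS; apply: measurableT_comp => //.
  by apply: measurable_funN; exact: measurable_funM.
- move=> s; rewrite /= in_itv/= andbT => s0; rewrite lee_fin !ger0_norm ?expR_ge0//.
    have := exp_le_kern 0 s k0; rewrite sub0r normrN ger0_norm//.
  by apply: mulr_ge0; [rewrite divr_ge0// ltW|apply: kern_ge0; exact: ltW].
- exact: integrableRZ.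
Qed.

Variables (T : R -> {linear X -> X}) (a c : R).
Hypotheses (hT : C0_semigroup T) (a0 : 0 <= a) (c0 : 0 <= c)
  (Tb : forall t, 0 <= t -> forall x, rnorm (T t x) <= c * expR (a * t) * rnorm x).

Lemma semigroup0 x : T 0 x = x. Proof. by case: hT. Qed.

Lemma semigroupD s t x : 0 <= s -> 0 <= t -> T (s + t) x = T s (T t x).
Proof. by case: hT => _ _ H _ s0 t0; exact: H. Qed.

Lemma semigroupC s t x : 0 <= s -> 0 <= t -> T s (T t x) = T t (T s x).
Proof. by move=> s0 t0; rewrite -!semigroupD// addrC. Qed.

Lemma semigroup_near0 x (e : R) : 0 < e -> exists2 d, 0 < d &
  forall t, 0 <= t -> t < d -> rnorm (T t x - x) <= e.
Proof.
move=> e0; case: hT => _ _ _ /(_ x)/cvg_rnormP/(_ _ e0)/near_right0[d d0 H].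
exists d => // t; rewrite le_eqVlt => /predU1P[<-|]; last exact: H.
by rewrite semigroup0 subrr rnorm0 ltW.
Qed.

(** Uniform continuity on bounded intervals: [T t - T s = T s (T (t - s) - 1)],
    and [T s] is bounded there. *)
Lemma orbit_uniform x (B e : R) : 0 < e -> exists2 d, 0 < d &
  forall s t, 0 <= s -> s <= t -> t <= B -> t - s < d -> rnorm (T t x - T s x) <= e.
Proof.
move=> e0; set k := c * expR (a * B); have k0 : 0 <= k by rewrite mulr_ge0 ?expR_ge0.
have e1 : 0 < e / (k + 1) by rewrite divr_gt0//; lra.
have [d d0 H] := semigroup_near0 x e1; exists d => // s t s0 st tB ts.
have ts0 : 0 <= t - s by rewrite subr_ge0.
rewrite -[t in T t](subrKC s) semigroupD// -linearB.
apply: le_trans (Tb s0 _) _; apply: le_trans (mulr_le_eps k0 e0).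
apply: ler_pM; rewrite ?rnorm_ge0 ?mulr_ge0 ?expR_ge0 ?H//.
by rewrite ler_wpM2l// ler_expR ler_wpM2l// (le_trans st).
Qed.

Lemma orbit_continuous x : halfline_continuous (fun t => T t x).
Proof. by apply: locally_uniform_halfline_continuous => B e; exact: orbit_uniform. Qed.

Section Resolvent.
Variable l : R[i].
Hypothesis al : a < complex.Re l.

Lemma cexp_near0 (m : R[i]) (e : R) : 0 < e -> exists2 d, 0 < d &
  forall t : R, 0 <= t -> t < d -> cabs (cexp (t%:C * m) - 1) <= e.
Proof.
move=> e0; have [d d0 H] := @holo_continuous R cexp 0 (@holo_cexp R 0) _ e0.
have m0 := cabs_ge0 m.
have d1 : 0 < d / (cabs m + 1) by rewrite divr_gt0//; lra.
exists (d / (cabs m + 1)) => // t t0 td.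
have := H (t%:C * m); rewrite subr0 cexp0 => {}H; apply: H.
rewrite cabsM cabs_real ger0_norm//.
apply: le_lt_trans (_ : t * (cabs m + 1) < d); first by rewrite ler_wpM2l// lerDl.
by rewrite -ltr_pdivlMr//; lra.
Qed.

Lemma cexp_derivative0 (m : R[i]) (e : R) : 0 < e -> exists2 d, 0 < d &
  forall t : R, 0 < t -> t < d -> cabs ((t^-1)%:C * (cexp (t%:C * m) - 1) - m) <= e.
Proof.
move=> e0; have m0 := cabs_ge0 m.
set k := 5 * cabs m ^+ 2 * expR (cabs m).
have k0 : 0 <= k by rewrite !mulr_ge0 ?exprn_ge0 ?expR_ge0.
have e1 : 0 < e / (k + 1) by rewrite divr_gt0//; lra.
exists (Num.min 1 (e / (k + 1))); first by rewrite lt_min ltr01.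
move=> t t0; rewrite lt_min => /andP[t1 te].
have t0' : t != 0 by rewrite gt_eqF.
have -> : (t^-1)%:C * (cexp (t%:C * m) - 1) - m = (t^-1)%:C * (cexp (t%:C * m) - 1 - t%:C * m).
  rewrite [RHS]mulrBr mulrA -rmorphM /= mulVf// mul1r //.
rewrite cabsM cabs_real gtr0_norm ?invr_gt0// ler_pdivrMl//.
apply: le_trans (cexp_taylor2 _) _.
rewrite cabsM cabs_real gtr0_norm//.
apply: (@le_trans _ _ (t * (t * k))).
  have -> : 5 * (t * cabs m) ^+ 2 * expR (t * cabs m) = t * (t * (5 * cabs m ^+ 2 * expR (t * cabs m))) by ring.
  rewrite ler_pM2l// ler_pM2l// /k ler_wpM2l ?mulr_ge0 ?exprn_ge0//.
  by rewrite ler_expR ler_piMl// ltW.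
rewrite ler_pM2l//; apply: le_trans (mulr_le_eps k0 e0).
by rewrite mulrC ler_wpM2l// ltW.
Qed.

Lemma expR_rate (s : R) : expR (- (complex.Re l * s)) * expR (a * s) = expR (- ((complex.Re l - a) * s)).
Proof. by rewrite -expRD; congr expR; ring. Qed.

Lemma weighted_orbit_le x (s : R) : 0 <= s ->
  rnorm (cexp (- (s%:C * l)) *: T s x) <= c * rnorm x * expR (- ((complex.Re l - a) * s)).
Proof.
move=> s0; rewrite rnormZ cabs_kernel -expR_rate.
have -> : c * rnorm x * (expR (- (complex.Re l * s)) * expR (a * s)) =
  expR (- (complex.Re l * s)) * (c * expR (a * s) * rnorm x) by ring.
by rewrite ler_wpM2l ?expR_ge0// Tb.
Qed.

Lemma cabs_kernel_le1 (s : R) : 0 <= s -> cabs (cexp (- (s%:C * l))) <= 1.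
Proof.
move=> s0; rewrite cabs_kernel -expR0 ler_expR oppr_le0 mulr_ge0//.
by apply: ltW; exact: le_lt_trans al.
Qed.

Lemma weighted_orbit_uniform x (B e : R) : 0 < e -> exists2 d, 0 < d &
  forall s t, 0 <= s -> s <= t -> t <= B -> t - s < d ->
    rnorm (cexp (- (t%:C * l)) *: T t x - cexp (- (s%:C * l)) *: T s x) <= e.
Proof.
move=> e0; have e2 : 0 < e / 2 by rewrite divr_gt0.
set k := c * expR (a * B) * rnorm x.
have k0 : 0 <= k by rewrite !mulr_ge0 ?expR_ge0 ?rnorm_ge0.
have e1 : 0 < e / 2 / (k + 1) by rewrite divr_gt0//; lra.
have [d1 d10 H1] := orbit_uniform x B e2.
have [d2 d20 H2] := cexp_near0 (- l) e1.
exists (Num.min d1 d2); first by rewrite lt_min d10 d20.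
move=> s t s0 st tB; rewrite lt_min => /andP[ts1 ts2].
have t0 : 0 <= t by exact: le_trans st.
have ts0 : 0 <= t - s by rewrite subr_ge0.
have cE : cexp (- (t%:C * l)) = cexp (- (s%:C * l)) * cexp ((t - s)%:C * - l).
  by rewrite -cexpD; congr cexp; rewrite rmorphB /=; ring.
have -> : cexp (- (t%:C * l)) *: T t x - cexp (- (s%:C * l)) *: T s x =
   cexp (- (t%:C * l)) *: (T t x - T s x) +
   (cexp (- (s%:C * l)) * (cexp ((t - s)%:C * - l) - 1)) *: T s x.
  by rewrite mulrBr mulr1 -cE scalerBr scalerBl addrA subrK.
apply: le_trans (rnormD _ _) _; rewrite [leRHS](splitr e); apply: lerD.
  rewrite rnormZ -[leRHS]mul1r; apply: ler_pM; rewrite ?cabs_ge0 ?rnorm_ge0//.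
    exact: cabs_kernel_le1.
  exact: H1.
rewrite rnormZ; apply: le_trans (mulr_le_eps k0 e2); rewrite [leRHS]mulrC.
apply: ler_pM; rewrite ?cabs_ge0 ?rnorm_ge0//.
  rewrite cabsM -[leRHS]mul1r; apply: ler_pM; rewrite ?cabs_ge0//.
    exact: cabs_kernel_le1.
  exact: H2.
apply: le_trans (Tb s0 _) _; rewrite ler_wpM2r ?rnorm_ge0// ler_wpM2l//.
by rewrite ler_expR ler_wpM2l// (le_trans st).
Qed.

Lemma weighted_bound_integrable (x : X) :
  mu.-integrable D (EFin \o (fun s => c * rnorm x * expR (- ((complex.Re l - a) * s)))).
Proof.
apply: integrableRZ; first exact: measurable_itv.
by apply: expR_integrable; rewrite subr_gt0.
Qed.

Lemma orbit_integrable x Phi : unit_functional Phi ->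
  cintegrable D (fun s => cexp (- (s%:C * l)) * Phi (T s x)).
Proof.
move=> P; have := weak_integrable (weighted_orbit_uniform x) (weighted_orbit_le x)
  (weighted_bound_integrable x) P.
apply: eq_cintegrable; first exact: measurable_itv.
by move=> s _; rewrite (unit_functionalZ _ _ P).
Qed.

Definition laplace_resolvent (J : X -> X) : Prop := forall x Phi,
  unit_functional Phi -> Phi (J x) = laplace D (fun s => Phi (T s x)) l.

Lemma laplace_resolvent_exists : exists J, laplace_resolvent J.
Proof.
have H x : exists y, forall Phi, unit_functional Phi ->
    Phi y = laplace D (fun s => Phi (T s x)) l.
  have [y yP] := weak_integral (weighted_orbit_uniform x) (weighted_orbit_le x)
    (weighted_bound_integrable x).
  exists y => Phi P; rewrite yP//; apply: eq_cint => s _.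
  by rewrite (unit_functionalZ _ _ P).
by have [J JP] := choice H; exists J.
Qed.

Section Formula.
Variable J : X -> X.
Hypothesis JP : laplace_resolvent J.

Definition bounded_linear (B : X -> X) (b : R) : Prop :=
  [/\ 0 < b, forall k x y, B (k *: x + y) = k *: B x + B y
    & forall x, rnorm (B x) <= b * rnorm x].

(** Bounded operators pass through weak integrals: up to a factor, composition
    with them preserves the functionals of norm at most one. *)
Lemma functional_comp (B : X -> X) (b : R) Phi : bounded_linear B b -> unit_functional Phi ->
  unit_functional (fun x => (b^-1)%:C * Phi (B x)).
Proof.
move=> [b0 Bl Bb] [Pl Pb]; split.
  by move=> k y z; rewrite Bl Pl; ring.
move=> y; rewrite cabsM cabs_real gtr0_norm ?invr_gt0// ler_pdivrMl//.
exact: le_trans (Pb _) (Bb _).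
Qed.

Lemma functional_compE (b : R) (w : R[i]) : 0 < b -> b%:C * ((b^-1)%:C * w) = w.
Proof. by move=> b0; rewrite mulrA -rmorphM /= divff ?mul1r// gt_eqF. Qed.

Lemma bounded_orbit_integrable (B : X -> X) (b : R) x Phi : bounded_linear B b ->
  unit_functional Phi -> cintegrable D (fun s => cexp (- (s%:C * l)) * Phi (B (T s x))).
Proof.
move=> Bb P; have b0 : 0 < b by case: Bb.
have mD : measurable D by exact: measurable_itv.
have := cintegrableZ b%:C mD (orbit_integrable x (functional_comp Bb P)).
apply: eq_cintegrable => // s _.
by rewrite mulrCA functional_compE.
Qed.

Lemma bounded_laplace_resolvent (B : X -> X) (b : R) x Phi : bounded_linear B b ->
  unit_functional Phi -> Phi (B (J x)) = laplace D (fun s => Phi (B (T s x))) l.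
Proof.
move=> Bb P; have b0 : 0 < b by case: Bb.
have mD : measurable D by exact: measurable_itv.
rewrite -[LHS](functional_compE _ b0) (JP x (functional_comp Bb P)).
rewrite /laplace -cintZ//; last exact: orbit_integrable (functional_comp Bb P).
by apply: eq_cint => s _; rewrite mulrCA functional_compE.
Qed.

Lemma semigroup_bounded_linear (t : R) : 0 <= t -> bounded_linear (T t) (c * expR (a * t) + 1).
Proof.
move=> t0; split.
- by rewrite ltr_pwDr// mulr_ge0 ?expR_ge0.
- by move=> k x y; rewrite linearP.
- move=> x; apply: le_trans (Tb t0 x) _.
  by rewrite ler_wpM2r ?rnorm_ge0// lerDl.
Qed.

Lemma bounded_linear_comp (B B' : X -> X) (b b' : R) : bounded_linear B b ->
  bounded_linear B' b' -> bounded_linear (fun x => B (B' x)) (b * b').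
Proof.
move=> [b0 Bl Bb] [b0' Bl' Bb']; split; first exact: mulr_gt0.
  by move=> k x y; rewrite Bl' Bl.
move=> x; apply: le_trans (Bb _) _; by rewrite -mulrA ler_pM2l.
Qed.

(** Applying [T t] to the resolvent shifts the orbit, so that only the part of
    the transform beyond [t] remains. *)
Lemma semigroup_laplace_resolvent (B : X -> X) (b : R) x Phi (t : R) : 0 <= t ->
  bounded_linear B b -> unit_functional Phi ->
  Phi (B (T t (J x))) = cexp (t%:C * l) *
    (laplace D (fun s => Phi (B (T s x))) l - laplace `[0, t] (fun s => Phi (B (T s x))) l).
Proof.
move=> t0 Bb P; have mD : measurable D by exact: measurable_itv.
have BT := bounded_linear_comp Bb (semigroup_bounded_linear t0).
pose K s := cexp (- (s%:C * l)) * Phi (B (T s x)).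
have Ki : cintegrable D K by exact: bounded_orbit_integrable Bb P.
have KE s : D s -> cexp (- (s%:C * l)) * Phi (B (T t (T s x))) = cexp (t%:C * l) * K (t + s).
  rewrite /= in_itv/= andbT => s0; rewrite /K mulrA -cexpD semigroupD//.
  by congr (cexp _ * _); rewrite rmorphD /=; ring.
have Kti : cintegrable D (fun s => K (t + s)).
  have := cintegrableZ (cexp (- (t%:C * l))) mD (bounded_orbit_integrable x BT P).
  apply: eq_cintegrable => // s; rewrite inE => Ds.
  by rewrite KE// mulrA -cexpD addNr cexp0 mul1r.
rewrite (bounded_laplace_resolvent x BT P) {1}/laplace.
have -> : cint D (fun s => cexp (- (s%:C * l)) * Phi (B (T t (T s x)))) =
    cint D (fun s => cexp (t%:C * l) * K (t + s)).
  by apply: eq_cint => s; rewrite inE => Ds; rewrite KE.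
rewrite cintZ//; congr (_ * _).
have tD : `[t, +oo[%classic `<=` D.
  by move=> s; rewrite /= !in_itv/= !andbT; exact: le_trans.
have Kt : cintegrable `[t, +oo[ K by exact: (@cintegrableS R D).
have mK : cmeasurable `[t, +oo[ K.
  by case: Kt => /measurable_int/measurable_EFinP ? /measurable_int/measurable_EFinP.
rewrite -(cint_translation mK) /laplace -/K (cint_halfline_split t0 Ki) addrC addKr.
have [m1 m2] : cintegrable `]t, +oo[ K.
  apply: (@cintegrableS R `[t, +oo[) Kt; [exact: measurable_itv|exact: measurable_itv|].
  by move=> s; rewrite /= !in_itv/= !andbT => /ltW.
by apply: complex_eq;
  rewrite /= ?(Rintegral_itv_obnd_cbnd m1) ?(Rintegral_itv_obnd_cbnd m2).
Qed.

Lemma laplace_resolvent_semigroup (t : R) x : 0 <= t -> T t (J x) = J (T t x).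
Proof.
move=> t0; apply: functional_separates => Phi P.
rewrite (bounded_laplace_resolvent x (semigroup_bounded_linear t0) P) JP//.
by apply: eq_cint => s; rewrite inE/= in_itv/= andbT => s0; rewrite semigroupC.
Qed.

Lemma laplace_resolvent_linear k x y : J (k *: x + y) = k *: J x + J y.
Proof.
have mD : measurable D by exact: measurable_itv.
apply: functional_separates => Phi P; rewrite P.1 !JP// /laplace.
rewrite -cintZ//; last exact: orbit_integrable.
rewrite -cintD//; last 2 first.
- by apply: cintegrableZ => //; exact: orbit_integrable.
- exact: orbit_integrable.
by apply: eq_cint => s _; rewrite linearP P.1; ring.
Qed.

Lemma laplace_resolvent_bounded : exists2 b : R, 0 <= b & forall x, rnorm (J x) <= b * rnorm x.
Proof.
have mD : measurable D by exact: measurable_itv.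
pose q (s : R) := expR (- ((complex.Re l - a) * s)).
have qi : mu.-integrable D (EFin \o q) by apply: expR_integrable; rewrite subr_gt0.
exists (c * \int[mu]_(s in D) q s).
  by rewrite mulr_ge0// Rintegral_ge0// => s _; exact: expR_ge0.
move=> x; apply: functional_norm_le => Phi P; rewrite JP//.
have -> : c * \int[mu]_(s in D) q s * rnorm x = \int[mu]_(s in D) (c * rnorm x * q s).
  by rewrite RintegralZl// mulrAC.
apply: cabs_cint_le => //; first exact: orbit_integrable.
  exact: weighted_bound_integrable.
move=> s; rewrite /= in_itv/= andbT => s0; rewrite -(unit_functionalZ _ _ P).
apply: le_trans (P.2 _) _; exact: weighted_orbit_le.
Qed.

(** The difference quotient of the orbit through [J x] is, weakly,
    [t^-1 (exp (t l) - 1) J x] minus a mean of the orbit of [x] over [[0, t]]. *)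
Lemma laplace_resolvent_generator x :
  diff_quotient T (J x) t @[t --> (0 : R)^'+] --> l *: J x - x.
Proof.
apply/cvg_rnormP => e e0; apply/near_right0.
set n1 := rnorm (J x); set n2 := rnorm x.
have n10 : 0 <= n1 by exact: rnorm_ge0.
have n20 : 0 <= n2 by exact: rnorm_ge0.
have e4 : 0 < e / 4 by rewrite divr_gt0.
have e8 : 0 < e / 8 by rewrite divr_gt0.
have e1 : 0 < e / 4 / (n1 + 1) by rewrite divr_gt0//; lra.
have e2 : 0 < e / 4 / (n2 + 1) by rewrite divr_gt0//; lra.
have [d1 d10 H1] := cexp_derivative0 l e1.
have [d2 d20 H2] := cexp_near0 l e2.
have [d3 d30 H3] := cexp_near0 l (@ltr01 R).
have [d4 d40 H4] := weighted_orbit_uniform x 1 e8.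
exists (Num.min (Num.min d1 d2) (Num.min (Num.min d3 d4) 1)).
  by rewrite !lt_min d10 d20 d30 d40 ltr01.
move=> t t0; rewrite !lt_min => /andP[/andP[t1 t2] /andP[/andP[t3 t4] t5]].
have t0' : 0 <= t by exact: ltW.
apply: functional_norm_le => Phi P.
have mD : measurable D by exact: measurable_itv.
have idb : bounded_linear id 1 by split => // y; rewrite mul1r.
pose K s := cexp (- (s%:C * l)) * Phi (T s x).
have Ki : cintegrable `[0, t] K.
  apply: (@cintegrableS R D) (orbit_integrable x P) => //.
  by move=> s; rewrite /= !in_itv/= andbT => /andP[].
have E := semigroup_laplace_resolvent x t0' idb P; rewrite -(JP x P) /= in E.
set I := laplace _ _ _ in E.
have IE : cabs (I - t%:C * Phi x) <= e / 8 * t.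
  have -> : t%:C * Phi x = cint `[0, t] (fun=> Phi x) by rewrite cint_cst// subr0.
  rewrite /I /laplace -cintB//; last exact: cintegrable_cst.
  have := @cabs_cint_itv_le R 0 t (e / 8) (fun s => K s - Phi x) t0'.
  rewrite subr0; apply.
    by apply: cintegrableB => //; exact: cintegrable_cst.
  move=> s /andP[s0 st]; rewrite /K -(unit_functionalZ _ _ P) -(unit_functionalB _ _ P).
  apply: le_trans (P.2 _) _.
  have := H4 0 s (lexx 0) s0; rewrite (_ : - (0%:C * l) = 0); last first.
    by rewrite (_ : 0%:C = 0 :> R[i])// mul0r oppr0.
  rewrite cexp0 scale1r semigroup0; apply.
    by apply: le_trans st (ltW t5).
  by rewrite subr0; exact: le_lt_trans t4.
have t0C : t%:C != 0 :> R[i] by rewrite -(rmorph0 (real_complex R)) (inj_eq (@complexI R)) gt_eqF.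
have -> : Phi (diff_quotient T (J x) t - (l *: J x - x)) =
    ((t^-1)%:C * (cexp (t%:C * l) - 1) - l) * Phi (J x) -
    (t^-1)%:C * cexp (t%:C * l) * (I - t%:C * Phi x) -
    (cexp (t%:C * l) - 1) * Phi x.
  rewrite /diff_quotient !(unit_functionalB, unit_functionalZ)// E.
  rewrite fmorphV /=; clearbody I; clear E IE.
  move: (cexp (t%:C * l)) (Phi (J x)) (Phi x) => p q v.
  by field; exact: t0C.
apply: le_trans (cabsB _ _) _; apply: (@le_trans _ _ ((e / 4 + e / 4) + e / 4)); last lra.
apply: lerD.
  apply: le_trans (cabsB _ _) _; apply: lerD.
    rewrite cabsM; apply: le_trans (mulr_le_eps n10 e4); rewrite [leRHS]mulrC.
    by apply: ler_pM; rewrite ?cabs_ge0// ?H1//; exact: P.2.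
  rewrite cabsM cabsM cabs_real gtr0_norm ?invr_gt0//.
  have c2 : cabs (cexp (t%:C * l)) <= 2.
    have := cabsD (cexp (t%:C * l) - 1) 1; rewrite subrK cabs1.
    by have := H3 _ t0' t3; move: (cabs _) (cabs _) => p q; lra.
  have -> : e / 4 = t^-1 * 2 * (e / 8 * t) by field; rewrite gt_eqF.
  apply: ler_pM; rewrite ?cabs_ge0 ?mulr_ge0 ?invr_ge0 ?cabs_ge0//.
  by rewrite ler_wpM2l// invr_ge0.
rewrite cabsM; apply: le_trans (mulr_le_eps n20 e4); rewrite [leRHS]mulrC.
by apply: ler_pM; rewrite ?cabs_ge0// ?H2//; exact: P.2.
Qed.

(** The transform commutes with the semigroup, hence with its generator; so
    [J] is also a left inverse of [l - A], and [l - A] is injective. *)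
Lemma laplace_resolvent_left_inverse r : generator_dom T r ->
  J (l *: r - generator T r) = r.
Proof.
move=> dr; have [b b0 Jb] := laplace_resolvent_bounded.
have Jlin := laplace_resolvent_linear.
have JB y z : J (y - z) = J y - J z.
  by rewrite -scaleN1r addrC Jlin scaleN1r addrC.
have J0 : J 0 = 0 by have := JB 0 0; rewrite !subrr.
have JZ k y : J (k *: y) = k *: J y by have := Jlin k y 0; rewrite J0 !addr0.
have lim1 : J (diff_quotient T r t) @[t --> (0 : R)^'+] --> J (generator T r).
  apply/cvg_rnormP => e e0.
  have e1 : 0 < e / (b + 1) by rewrite divr_gt0//; lra.
  have /cvg_rnormP/(_ _ e1) := dr; apply: filterS => t H.
  rewrite -JB; apply: le_trans (Jb _) _; apply: le_trans (mulr_le_eps b0 e0).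
  by rewrite ler_wpM2l.
have lim2 : J (diff_quotient T r t) @[t --> (0 : R)^'+] --> l *: J r - r.
  apply: cvg_trans (@laplace_resolvent_generator r); apply: near_eq_cvg.
  apply/near_right0; exists 1 => // t t0 _.
  by rewrite /diff_quotient JZ JB laplace_resolvent_semigroup// ltW.
have -> : J (l *: r - generator T r) = l *: J r - J (generator T r) by rewrite JB JZ.
have -> : J (generator T r) = l *: J r - r.
  have := cvg_lim (@norm_hausdorff _ _) lim1 => <-.
  have e2 := cvg_lim (@norm_hausdorff _ _) lim2; exact: e2.
by rewrite opprB addrC subrK.
Qed.

(** The two preceding results: [J x] is in the domain and is mapped to [x] by
    [l - A], and nothing else is. *)
Lemma resolvent_laplace_resolvent x : resolvent T l x = J x.
Proof.
have Jl := @laplace_resolvent_generator x.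
have dJ : generator_dom T (J x) by apply/cvg_ex; exists (l *: J x - x).
have [dr E] : generator_dom T (resolvent T l x) /\
    l *: resolvent T l x - generator T (resolvent T l x) = x.
  apply: (@getPex _ [set r | generator_dom T r /\ l *: r - generator T r = x]).
  have gE : generator T (J x) = l *: J x - x.
    by have e2 := cvg_lim (@norm_hausdorff _ _) Jl; exact: e2.
  by exists (J x); split => //; rewrite gE opprB addrC subrK.
by rewrite -[in RHS]E laplace_resolvent_left_inverse.
Qed.

End Formula.

Theorem resolvent_laplace (B : X -> X) (b : R) x Phi : bounded_linear B b ->
  unit_functional Phi ->
  Phi (B (resolvent T l x)) = laplace D (fun s => Phi (B (T s x))) l.
Proof.
move=> Bb P; have [J JP] := laplace_resolvent_exists.
rewrite (resolvent_laplace_resolvent JP).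
exact: bounded_laplace_resolvent Bb P.
Qed.

Theorem semigroup_resolvent_laplace (B : X -> X) (b : R) x Phi (t : R) : 0 <= t ->
  bounded_linear B b -> unit_functional Phi ->
  Phi (B (T t (resolvent T l x))) = cexp (t%:C * l) *
    (laplace D (fun s => Phi (B (T s x))) l - laplace `[0, t] (fun s => Phi (B (T s x))) l).
Proof.
move=> t0 Bb P; have [J JP] := laplace_resolvent_exists.
rewrite (resolvent_laplace_resolvent JP).
exact: semigroup_laplace_resolvent Bb P.
Qed.

End Resolvent.

End Semigroup.

Section GrowthBound.
Context {R : realType} {X : normedModType R[i]}.

Lemma growth_bound_lt (T : R -> {linear X -> X}) (omega : R) : 0 < omega ->
  (growth_bound T < omega%:E)%E -> exists a c : R, [/\ 0 <= a, a < omega, 0 <= c &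
    forall t, 0 <= t -> forall x, rnorm (T t x) <= c * expR (a * t) * rnorm x].
Proof.
move=> o0 /ereal_inf_lt[_ [a' [c' H] <-]]; rewrite lte_fin => ao.
exists (Num.max 0 a'), (Num.max 0 c'); split; rewrite ?le_max ?lexx// ?gt_max ?o0//.
move=> t t0 x; apply: le_trans (H _ t0 _) _; rewrite ler_wpM2r ?rnorm_ge0//.
apply: (@le_trans _ _ (Num.max 0 c' * expR (a' * t))).
  by rewrite ler_wpM2r ?expR_ge0// le_max lexx orbT.
by rewrite ler_wpM2l ?le_max ?lexx// ler_expR ler_wpM2r// le_max lexx orbT.
Qed.

End GrowthBound.

(** * Strong measurability of continuous functions *)

Section StrongMeasurability.
Context {R : realType} {X : normedModType R[i]}.
Local Notation mu := (@lebesgue_measure R).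
Local Notation D := (`[0%R, +oo[%classic : set R).

Lemma RplusE : Rplus R = D.
Proof. by apply/seteqP; split => t; rewrite /Rplus /= in_itv/= andbT. Qed.

(** The index of the interval of length [1 / (n + 1)] containing [t]; index [0]
    is kept for the points outside [[0, n[]. *)
Definition step_index (n : nat) (t : R) : nat :=
  if 0 <= t < n%:R then (Num.Def.trunc (n.+1%:R * t)).+1 else 0.

Definition step_value (u : R -> X) (n k : nat) : X :=
  if k is j.+1 then u (j%:R / n.+1%:R) else 0.

Lemma step_index_preimage (n : nat) (S : set nat) : measurable (step_index n @^-1` S).
Proof.
have m1 k : measurable (step_index n @^-1` [set k]).
  case: k => [|k].
    have -> : step_index n @^-1` [set 0%N] = ~` `[0, n%:R[%classic.
      apply/seteqP; split => t /=; rewrite /step_index in_itv/=; case: ifP => //.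
    by apply: measurableC; exact: measurable_itv.
  have n0 : 0 < n.+1%:R :> R by rewrite ltr0n.
  have -> : step_index n @^-1` [set k.+1] =
      `[0, n%:R[%classic `&` `[k%:R / n.+1%:R, k.+1%:R / n.+1%:R[%classic.
    apply/seteqP; split => t /=; rewrite /step_index !in_itv/=.
      case: ifP => // t0n [] /eqP; rewrite truncn_eq; last first.
        by case/andP: t0n => t0 _; rewrite mulr_ge0// ltW.
      by rewrite ler_pdivrMr// ltr_pdivlMr// ![t * _]mulrC.
    move=> [t0n tk]; rewrite t0n; congr (_.+1); apply/eqP; rewrite truncn_eq; last first.
      by case/andP: t0n => t0 _; rewrite mulr_ge0// ltW.
    by move: tk; rewrite ler_pdivrMr// ltr_pdivlMr// ![t * _]mulrC.
  by apply: measurableI; exact: measurable_itv.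
have -> : step_index n @^-1` S = \bigcup_(k in S) (step_index n @^-1` [set k]).
  by apply/seteqP; split => t /=; [move=> St; exists (step_index n t)|move=> [k Sk /= ->]].
by apply: bigcup_measurable => k _; exact: m1.
Qed.

Lemma halfline_continuous_strongly_measurable (u : R -> X) :
  halfline_continuous u -> strongly_measurable (Rplus R) u.
Proof.
move=> uc; exists (fun n t => step_value u n (step_index n t)); split.
  move=> n; split; last first.
    by move=> y; exact: (step_index_preimage n [set k | step_value u n k = y]).
  apply: (@sub_finite_set _ _ (step_value u n @` `I_(n.+1 * n).+2)).
    move=> _ [t _ <-]; exists (step_index n t) => //=; rewrite /step_index.
    case: ifP => // /andP[t0 tn]; rewrite ltnS.
    have -> : (Num.Def.trunc (n.+1%:R * t) < (n.+1 * n).+1)%N.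
      rewrite truncn_lt_nat; last by rewrite mulr_ge0.
      apply: (@lt_trans _ _ (n.+1 * n)%:R); last by rewrite ltr_nat.
      by rewrite natrM ltr_pM2l// ltr0n.
    by [].
  by apply: finite_image; exact: finite_II.
apply: aeW => t; rewrite /Rplus /= => t0.
apply/cvg_rnormP => e e0; have [d d0 ud] := uc _ _ t0 e0.
near=> n.
have tn : t < n%:R.
  near: n; exists (Num.Def.trunc t).+1 => // n /= tn.
  by apply: lt_le_trans (truncnS_gt t) _; rewrite ler_nat.
have nd : n.+1%:R^-1 < d by near: n; exact: near_infty_natSinv_lt (PosNum d0).
rewrite /step_index t0 tn /=.
have n0 : 0 < n.+1%:R :> R by rewrite ltr0n.
have nt0 : 0 <= n.+1%:R * t by rewrite mulr_ge0// ltW.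
set k := Num.Def.trunc _.
have /andP[k1 k2] : k%:R <= n.+1%:R * t < k.+1%:R by exact: truncn_itv.
have k0 : 0 <= k%:R / n.+1%:R :> R by rewrite divr_ge0.
have kt : k%:R / n.+1%:R <= t by rewrite ler_pdivrMr// mulrC.
apply: ud => //; rewrite distrC ger0_norm ?subr_ge0//; apply: le_lt_trans nd.
have : t <= k.+1%:R / n.+1%:R by rewrite ler_pdivlMr// mulrC ltW.
by rewrite -natr1 mulrDl mul1r lerBlDl.
Unshelve. all: end_near. Qed.

Lemma halfline_continuous_within (u : R -> X) : halfline_continuous u ->
  {within Rplus R, continuous u}.
Proof.
move=> uc; apply: (@subspace_eq_continuous _ _ _ (fun t : R => u (Num.max 0 t))).
  by move=> t; rewrite inE /Rplus /= => t0; rewrite /= max_r.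
apply: continuous_subspaceT => t; apply/cvg_rnormP => e e0.
have m0 : 0 <= Num.max 0 t :> R by rewrite le_max lexx.
have [d d0 ud] := uc _ _ m0 e0; exists d => // s /= st.
apply: ud; first by rewrite le_max lexx.
apply: le_lt_trans st; rewrite (distrC t s); have [t0|t0] := leP 0 t.
  by exact: max_lipschitz.
case: (leP 0 s) => [s0|s0]; last by rewrite subrr normr0.
by rewrite subr0 !ger0_norm; lra.
Qed.

Lemma halfline_continuousZ (w : R -> R) (u : R -> X) : continuous w ->
  halfline_continuous u -> halfline_continuous (fun t => (w t)%:C *: u t).
Proof.
move=> wc uc t e t0 e0; have e2 : 0 < e / 2 by rewrite divr_gt0.
set k1 := `|w t| + 1; set k2 := rnorm (u t).
have k10 : 0 <= k1 by rewrite addr_ge0.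
have k20 : 0 <= k2 by exact: rnorm_ge0.
have e3 : 0 < e / 2 / (k1 + 1) by rewrite divr_gt0//; lra.
have e4 : 0 < Num.min 1 (e / 2 / (k2 + 1)) by rewrite lt_min ltr01 divr_gt0//; lra.
have [d1 d10 H1] := uc _ _ t0 e3.
have /cvgrPdist_le/(_ _ e4)[d2 /= d20 H2] := wc t.
exists (Num.min d1 d2); first by rewrite lt_min d10 d20.
move=> s s0; rewrite lt_min => /andP[sd1 sd2].
have := H2 s; rewrite /= distrC => /(_ sd2); rewrite distrC le_min => /andP[w1 w2].
have -> : (w s)%:C *: u s - (w t)%:C *: u t =
    (w s)%:C *: (u s - u t) + (w s - w t)%:C *: u t.
  by rewrite rmorphB /= scalerBr scalerBl addrA subrK.
apply: le_trans (rnormD _ _) _; rewrite [leRHS](splitr e); apply: lerD.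
  rewrite rnormZ cabs_real; apply: le_trans (mulr_le_eps k10 e2).
  apply: ler_pM => //; [exact: rnorm_ge0| |exact: H1].
  rewrite /k1; have := ler_normD (w s - w t) (w t); rewrite subrK => h.
  by apply: le_trans h _; rewrite addrC lerD2l.
rewrite rnormZ cabs_real; apply: le_trans (mulr_le_eps k20 e2).
by rewrite [leRHS]mulrC ler_wpM2r// rnorm_ge0.
Qed.

End StrongMeasurability.

Lemma halfline_continuous_bounded_linear {R : realType}
    {X : completeNormedModType R[i]} (B : X -> X) (b : R) (u : R -> X) :
  bounded_linear B b -> halfline_continuous u -> halfline_continuous (fun t => B (u t)).
Proof.
move=> [b0 Bl Bb] uc t e t0 e0; have e1 : 0 < e / (b + 1) by rewrite divr_gt0//; lra.
have [d d0 ud] := uc _ _ t0 e1; exists d => // s s0 st.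
have -> : B (u s) - B (u t) = B (u s - u t).
  have -> : u s - u t = -1 *: u t + u s by rewrite scaleN1r addrC.
  by rewrite Bl scaleN1r addrC.
apply: le_trans (Bb _) _; apply: le_trans (mulr_le_eps (ltW b0) e0).
by rewrite ler_pM2l// ud.
Qed.

(** * Orbits through the range of the resolvent *)

Section OrbitEstimates.
Context {R : realType} {X : completeNormedModType R[i]}.
Local Notation mu := (@lebesgue_measure R).
Local Notation D := (`[0%R, +oo[%classic : set R).

Lemma Rintegral_subset_le (A E : set R) (q : R -> R) : measurable A -> measurable E ->
  A `<=` E -> mu.-integrable E (EFin \o q) -> (forall s, E s -> 0 <= q s) ->
  \int[mu]_(s in A) q s <= \int[mu]_(s in E) q s.
Proof.
move=> mA mE AE qi q0; have qA := @integrableS _ _ _ mu E A _ mE mA AE qi.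
rewrite -lee_fin !fineK; last 2 first.
- exact: (@integrable_fin_num _ _ _ mu _ mE _ qi).
- exact: (@integrable_fin_num _ _ _ mu _ mA _ qA).
apply: ge0_subset_integral => //; first exact: (measurable_int mu).
Qed.

Lemma powR_add_le (q x y : R) : 0 <= q -> 0 <= x -> 0 <= y ->
  (x + y) `^ q <= 2 `^ q * (x `^ q + y `^ q).
Proof.
move=> q0 x0 y0; have xy0 : 0 <= x + y by exact: addr_ge0.
have [xy|yx] := leP x y.
  apply: (@le_trans _ _ ((2 * y) `^ q)).
    by apply: ge0_ler_powR; rewrite ?nnegrE ?mulr_ge0//; lra.
  by rewrite powRM// ler_wpM2l ?powR_ge0// lerDr powR_ge0.
apply: (@le_trans _ _ ((2 * x) `^ q)).
  by apply: ge0_ler_powR; rewrite ?nnegrE ?mulr_ge0//; lra.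
by rewrite powRM// ler_wpM2l ?powR_ge0// lerDl powR_ge0.
Qed.

Lemma powR_le_id (q x : R) : 1 <= q -> 0 <= x -> x <= 1 -> x `^ q <= x.
Proof.
move=> q1; rewrite le_eqVlt => /predU1P[<- _|x0 x1].
  by rewrite powR0// gt_eqF// (lt_le_trans ltr01).
by apply: ge1r_powR => //; rewrite x0.
Qed.

Variables (T : R -> {linear X -> X}) (a c : R) (B : X -> X) (b omega p : R) (z : X).
Hypotheses (hT : C0_semigroup T) (a0 : 0 <= a) (c0 : 0 <= c)
  (Tb : forall t, 0 <= t -> forall x, rnorm (T t x) <= c * expR (a * t) * rnorm x)
  (Bb : bounded_linear B b) (omega0 : 0 < omega) (ao : a < omega) (p1 : 1 <= p).

Let f t := B (T t z).
Let h t := rnorm (f t).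
Let g t := B (T t (resolvent T omega%:C z)).

Hypothesis hp : (\int[mu]_(s in D) (h s `^ p)%:E < +oo)%E.

Let mD : measurable D. Proof. exact: measurable_itv. Qed.
Let D0 s : D s -> 0 <= s. Proof. by rewrite /= in_itv/= andbT. Qed.
Let h0 s : 0 <= h s. Proof. exact: rnorm_ge0. Qed.

Lemma orbit_halfline_continuous x : halfline_continuous (fun t => B (T t x)).
Proof. exact (halfline_continuous_bounded_linear Bb (orbit_continuous hT a0 c0 Tb x)). Qed.

Let mh : measurable_fun D h.
Proof. by apply: measurable_rnorm; exact: orbit_halfline_continuous. Qed.

Lemma orbit_powR_integrable : mu.-integrable D (EFin \o (fun s => h s `^ p)).
Proof.
apply: ge0_lty_integrable => //; first exact: measurable_powR_comp.
by move=> s _; exact: powR_ge0.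
Qed.

Lemma weight_integrable (E : set R) (w : R -> R) (K : R) : measurable E -> E `<=` D ->
  measurable_fun E w -> (forall s, E s -> 0 <= w s <= K) ->
  mu.-integrable E (EFin \o w) -> mu.-integrable E (EFin \o (fun s => w s * h s)).
Proof.
move=> mE ED mw wK wi; apply: (@jensen_integrable R E w h p) => //.
- by move=> s /wK/andP[].
- exact: measurable_funS mh.
- have hi := @integrableS _ _ _ mu D E _ mD mE ED orbit_powR_integrable.
  apply: (@le_integrable _ _ _ mu E mE _ (EFin \o (fun s => K * h s `^ p))).
  + apply/measurable_EFinP; apply: measurable_funM => //.
    by apply: measurable_powR_comp; exact: measurable_funS mh.
  + move=> s Es; have /andP[w0 w1] := wK _ Es.
    rewrite lee_fin !ger0_norm ?mulr_ge0 ?powR_ge0//; last exact: le_trans w1.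
    by rewrite ler_wpM2r// powR_ge0.
  + exact: integrableRZ.
Qed.

Let mexp (E : set R) (k : R) : measurable_fun E (fun s : R => expR (- (k * s))).
Proof.
apply: measurable_funTS; apply: measurableT_comp => //.
by apply: measurable_funN; exact: measurable_funM.
Qed.

Lemma orbit_exp_integrable (k : R) : 0 < k ->
  mu.-integrable D (EFin \o (fun s => expR (- (k * s)) * h s)).
Proof.
move=> k0; apply: (@weight_integrable D _ 1) => //; last exact: expR_integrable.
move=> s /D0 s0; rewrite expR_ge0 -expR0 ler_expR oppr_le0.
by rewrite mulr_ge0// ltW.
Qed.

Lemma orbit_exp_local_integrable (t k : R) :
  mu.-integrable `[0, t] (EFin \o (fun s => expR (- (k * s)) * h s)).
Proof.
have wK s : `[0, t]%classic s -> 0 <= expR (- (k * s)) <= expR (`|k| * t).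
  rewrite /= in_itv/= => /andP[s0 st]; rewrite expR_ge0 ler_expR.
  apply: le_trans (ler_norm _) _; rewrite normrN normrM (ger0_norm s0).
  by rewrite ler_wpM2l.
have mt : measurable (`[0, t]%classic : set R) by exact: measurable_itv.
apply: (@weight_integrable `[0, t] (fun s => expR (- (k * s))) (expR (`|k| * t)) mt) => //.
  by move=> s; rewrite /= !in_itv/= => /andP[->].
apply: (@le_integrable _ _ _ mu _ mt _ (EFin \o cst (expR (`|k| * t)))).
- by apply/measurable_EFinP; exact: mexp.
- move=> s /wK/andP[w0 w1]; rewrite lee_fin ger0_norm//.
  by rewrite ger0_norm ?expR_ge0.
- exact: cst_integrable_itv.
Qed.

Lemma orbit_kern_integrable (rho t : R) : 0 < rho -> 0 <= t ->
  mu.-integrable D (EFin \o (fun s => kern rho t s * h s)).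
Proof.
move=> r0 t0; apply: (@weight_integrable D _ rho) => //.
- by apply: measurable_kern; exact: ltW.
- by move=> s _; rewrite kern_ge0 ?kern_le// ltW.
- exact: kern_integrable.
Qed.

Lemma functional_orbit_measurable Phi : unit_functional Phi -> cmeasurable D (fun s => Phi (f s)).
Proof. by move=> P; apply: measurable_functional P; exact: orbit_halfline_continuous. Qed.

Lemma functional_orbit_le Phi : unit_functional Phi -> forall s, cabs (Phi (f s)) <= h s.
Proof. by move=> P s; exact: P.2. Qed.

Let ao' : a < complex.Re omega%:C. Proof. by []. Qed.

Lemma functional_orbit_integrable Phi : unit_functional Phi ->
  cintegrable D (fun s => cexp (- (s%:C * omega%:C)) * Phi (f s)).
Proof. by move=> P; exact (bounded_orbit_integrable hT a0 c0 Tb ao' z Bb P). Qed.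

Lemma resolvent_orbitE Phi (t : R) : 0 <= t -> unit_functional Phi ->
  Phi (g t) = cexp (t%:C * omega%:C) *
    (laplace D (fun s => Phi (f s)) omega%:C - laplace `[0, t] (fun s => Phi (f s)) omega%:C).
Proof. by move=> t0 P; exact: (semigroup_resolvent_laplace hT a0 c0 Tb ao' z t0 Bb P). Qed.

Let tD t : 0 <= t -> `]t, +oo[%classic `<=` D.
Proof. by move=> t0 s; rewrite /= !in_itv/= !andbT => /ltW; exact: le_trans. Qed.

Lemma resolvent_orbit_tail_le (t : R) : 0 <= t ->
  rnorm (g t) <= 4 / omega * \int[mu]_(s in `]t, +oo[) (kern omega t s * h s).
Proof.
move=> t0; apply: functional_norm_le => Phi P.
have mt : measurable (`]t, +oo[%classic : set R) by exact: measurable_itv.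
have fi := functional_orbit_integrable P.
rewrite resolvent_orbitE// /laplace (cint_halfline_split t0 fi) addrC addKr.
have fit := cintegrableS mD mt (@tD _ t0) fi.
have ki := @integrableS _ _ _ mu D _ _ mD mt (@tD _ t0) (orbit_kern_integrable omega0 t0).
rewrite -cintZ// -RintegralZl//; apply: cabs_cint_le => //.
- exact: cintegrableZ.
- exact: integrableRZ.
move=> s st; have := st; rewrite /= in_itv/= andbT => ts.
rewrite mulrA -cexpD cabsM; apply: (@le_trans _ _ (expR (- (omega * `|t - s|)) * h s)).
  rewrite ler_pM ?cabs_ge0// ?P.2// cabs_cexp ler_expR.
  rewrite ReD ReN !ReM /= !mul0r !subr0 distrC gtr0_norm ?subr_gt0//.
  by rewrite le_eqVlt; apply/orP; left; apply/eqP; ring.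
by rewrite mulrA ler_wpM2r// exp_le_kern.
Qed.

Lemma resolvent_orbit_le (t : R) : 0 <= t ->
  rnorm (g t) <= 4 / omega * \int[mu]_(s in D) (kern omega t s * h s).
Proof.
move=> t0; apply: le_trans (resolvent_orbit_tail_le t0) _.
rewrite ler_wpM2l ?divr_ge0 ?(ltW omega0)//; apply: Rintegral_subset_le => //.
- exact: tD.
- exact: orbit_kern_integrable.
- by move=> s _; rewrite mulr_ge0// kern_ge0// ltW.
Qed.

Lemma resolvent_orbit_measurable : measurable_fun D (fun t => rnorm (g t)).
Proof. by apply: measurable_rnorm; exact: orbit_halfline_continuous. Qed.

(** The kernel is a convolution with an integrable function, so this is
    Young's inequality. *)
Lemma resolvent_orbit_Lp : in_Lp p g.
Proof.
split.
  by apply: halfline_continuous_strongly_measurable; exact: orbit_halfline_continuous.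
rewrite RplusE; apply: (@schur R (cst omega) h (fun t => rnorm (g t)) p 2 (4 / omega)) => //.
- by rewrite divr_ge0// ltW.
- move=> s s0; under eq_integral do rewrite kernC.
  exact: kern_row.
- exact: resolvent_orbit_measurable.
- by move=> t _; exact: rnorm_ge0.
- by move=> t t0; exact: resolvent_orbit_le.
Qed.

(** By Jensen's inequality the [p]-th power of the orbit is controlled by the
    tail of the integral of [h ^ p]. *)
Lemma resolvent_orbit_C0 : in_C0 g.
Proof.
split.
  by apply: halfline_continuous_within; exact: orbit_halfline_continuous.
apply/cvg_rnormP => e e0; have p0 : 0 < p by exact: lt_le_trans p1.
set k := (4 / omega) `^ p * (2 `^ (p - 1) * omega).
have k0 : 0 <= k by rewrite !mulr_ge0 ?powR_ge0// ltW.
have e1 : 0 < e `^ p / (k + 1) by rewrite divr_gt0 ?powR_gt0//; lra.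
have [t1 t10 tail] := integral_tail orbit_powR_integrable (fun s _ => powR_ge0 (h s) p) e1.
near=> t; have tt : t1 <= t by near: t; apply: nbhs_pinfty_ge; exact: num_real.
rewrite subr0; have t0 : 0 <= t by exact: le_trans tt.
have mt : measurable (`]t, +oo[%classic : set R) by exact: measurable_itv.
have o4 : 0 <= 4 / omega by rewrite divr_ge0// ltW.
have ki := @integrableS _ _ _ mu D _ _ mD mt (@tD _ t0) (kern_integrable omega0 t0).
have hi := @integrableS _ _ _ mu D _ _ mD mt (@tD _ t0) orbit_powR_integrable.
have kk s : 0 <= kern omega t s by rewrite kern_ge0// ltW.
have mk : measurable_fun `]t, +oo[ (kern omega t) by apply: measurable_kern; exact: ltW.
have mht : measurable_fun `]t, +oo[ h.
  by apply: measurable_funS mh => //; exact: tD.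
have khi : mu.-integrable `]t, +oo[ (EFin \o (fun s => kern omega t s * h s `^ p)).
  apply: (@le_integrable _ _ _ mu _ mt _ (EFin \o (fun s => omega * h s `^ p))).
  - by apply/measurable_EFinP; apply: measurable_funM => //; exact: measurable_powR_comp.
  - move=> s _; rewrite lee_fin (ger0_norm (mulr_ge0 (kk s) (powR_ge0 _ _))).
    rewrite ger0_norm ?mulr_ge0 ?powR_ge0 ?(ltW omega0)//.
    by rewrite ler_wpM2r ?powR_ge0// kern_le// ltW.
  - exact: integrableRZ.
have k2 : \int[mu]_(s in `]t, +oo[) kern omega t s <= 2.
  apply: (@le_trans _ _ (\int[mu]_(s in D) kern omega t s)).
    by apply: Rintegral_subset_le => //; [exact: tD|exact: kern_integrable].
  rewrite -lee_fin fineK; first exact: kern_row.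
  exact: (@integrable_fin_num _ _ _ mu _ mD _ (kern_integrable omega0 t0)).
have J := @jensen R `]t, +oo[ (kern omega t) h p 2 mt p1 (@ltr0Sn R 1)
  (fun s _ => kk s) (fun s _ => h0 s) mk mht ki khi k2.
have I0 : 0 <= \int[mu]_(s in `]t, +oo[) (kern omega t s * h s).
  by apply: Rintegral_ge0 => s _; rewrite mulr_ge0.
have ge : rnorm (g t) `^ p <= e `^ p.
  apply: (@le_trans _ _ ((4 / omega * \int[mu]_(s in `]t, +oo[) (kern omega t s * h s)) `^ p)).
    apply: ge0_ler_powR; rewrite ?nnegrE ?rnorm_ge0 ?(mulr_ge0 o4 I0) ?(ltW p0)//.
    exact: resolvent_orbit_tail_le.
  rewrite powRM//; apply: (@le_trans _ _ (k * (e `^ p / (k + 1)))); last first.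
    by apply: mulr_le_eps => //; rewrite powR_gt0.
  rewrite /k -!mulrA ler_wpM2l ?powR_ge0//; apply: le_trans J _.
  rewrite ler_wpM2l ?powR_ge0//.
  apply: (@le_trans _ _ (\int[mu]_(s in `]t, +oo[) (omega * h s `^ p))).
    apply: le_Rintegral => //; first exact: integrableRZ.
    by move=> s _; rewrite ler_wpM2r ?powR_ge0// kern_le// ltW.
  by rewrite RintegralZl// ler_pM2l//; exact: tail.
rewrite leNgt; apply/negP => lt.
by move: ge; rewrite leNgt gt0_ltr_powR ?nnegrE ?rnorm_ge0 ?(ltW e0).
Unshelve. all: end_near. Qed.

Section Extension.
Variable G : (R[i])^o -> X.
Hypotheses (Ghol : forall l : R[i], 0 <= complex.Re l -> derivable G l 1)
  (Gres : forall l : R[i], omega < complex.Re l -> G l = B (resolvent T l z)).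

Lemma functional_holo Phi (l : R[i]) : unit_functional Phi -> derivable G l 1 ->
  holo (fun l => Phi (G l)) l.
Proof.
move=> P /derivable_epsP[d dP]; apply/holo_epsP; exists (Phi d) => e e0.
have [r r0 rP] := dP e e0; exists r => // w wr.
rewrite -(unit_functionalZ _ _ P) -!(unit_functionalB _ _ P).
by apply: le_trans (P.2 _) _; exact: rP.
Qed.

(** Both sides are holomorphic in the right half-plane, and they agree to the
    right of [omega] by the formula for the resolvent. *)
Lemma extension_laplace Phi (l : R[i]) : unit_functional Phi -> 0 < complex.Re l ->
  Phi (G l) = laplace D (fun s => Phi (f s)) l.
Proof.
move=> P l0; pose F (l : R[i]) := Phi (G l) - laplace D (fun s => Phi (f s)) l.
suff : F l = 0 by move/eqP; rewrite subr_eq0 => /eqP.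
apply: (@unique_continuation R F omega) => //.
- move=> w w0; apply: (@holoB R (fun l => Phi (G l)) (laplace D (fun s => Phi (f s)))).
    by apply: functional_holo => //; apply: Ghol; exact: ltW.
  apply: (@holo_laplace R D (fun s => Phi (f s)) h 0 mD D0) w0.
  + exact: functional_orbit_measurable.
  + by move=> s _; exact: functional_orbit_le.
  + exact: orbit_exp_integrable.
- move=> w wo; have aw : a < complex.Re w by exact: lt_trans wo.
  by rewrite /F Gres// (resolvent_laplace hT a0 c0 Tb aw z Bb P) subrr.
Qed.

Section Growth.
Variables (M : R -> R) (C : R) (N : nat).
Hypotheses (Mc : {within Rplus R, continuous M})
  (Mmono : forall s t, 0 <= s -> s <= t -> M s <= M t)
  (M2 : forall s, 0 <= s -> 2 <= M s) (C0 : 0 <= C)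
  (GOmega : forall l : R[i], Omega M l -> derivable G l 1)
  (Gle : forall l : R[i], Omega M l ->
     rnorm (G l) <= C * ((1 + `|complex.Im l|) * M `|complex.Im l|) ^+ N).

Let k : R := (2 * (N%:R + 6))^-1.
Let w t := w_M_log M (k * t).

Let k0 : 0 < k. Proof. by rewrite invr_gt0 mulr_gt0// ltr_wpDl. Qed.
Let k1 : k <= 1.
Proof. by rewrite invf_le1 ?mulr_gt0// ?ltr_wpDl//; have := ler0n R N; lra. Qed.

Lemma strip_bound (r x y : R) : 0 <= r -> - (2 * M r)^-1 <= x <= 0 -> - r <= y <= r ->
  Omega M (x +i* y) /\ rnorm (G (x +i* y)) <= C * ((1 + r) * M r) ^+ N.
Proof.
move=> r0 /andP[x1 x2] yr; have yr' : `|y| <= r by rewrite ler_norml.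
have y0 : 0 <= `|y| by [].
have My := Mmono y0 yr'; have M2y := M2 y0.
have My0 : 0 < M `|y| by lra.
have Mr0 : 0 < M r by lra.
have Oy : Omega M (x +i* y).
  rewrite /Omega /=; apply: lt_le_trans x1; rewrite ltrN2.
  by rewrite ltf_pV2 ?posrE ?mulr_gt0//; lra.
split => //; apply: le_trans (Gle Oy) _; rewrite ler_wpM2l//=.
by apply: lerXn2r; rewrite ?nnegrE ?mulr_ge0 ?addr_ge0 ?(ltW My0) ?(ltW Mr0)//;
  apply: ler_pM; rewrite ?addr_ge0 ?(ltW My0)// lerD2l.
Qed.

Let m := (N + 3)%N.
Let A1 : R := (2 * (contour_ratio omega + 1) + 4) * (4 * contour_ratio omega ^+ 2 * (contour_ratio omega + 2) ^+ (2 * m)).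
Let A2 : R := 3 ^+ m * m`!%:R.
Let A3 : R := 3 ^+ m / omega.

Let A10 : 0 <= A1.
Proof. by rewrite /A1 /contour_ratio !mulr_ge0 ?exprn_ge0 ?addr_ge0 ?mulr_ge0 ?addr_ge0 ?mulr_ge0// ltW. Qed.

Let kernV (r t s : R) : 0 < r -> h s / (1 + r * `|t - s|) ^+ 2 = r^-1 * (kern r t s * h s).
Proof.
move=> r0; rewrite -[kern r t s]/(r / (1 + r * `|t - s|) ^+ 2).
move: (h s) ((1 + r * `|t - s|) ^+ 2)^-1 => x q; field.
by rewrite gt_eqF.
Qed.

Lemma kern_integralE (r t : R) : 0 < r -> 0 <= t ->
  r * kernel_mean h r t = \int[mu]_(s in D) (kern r t s * h s).
Proof.
move=> r0 t0; have r1 : r != 0 by rewrite gt_eqF.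
rewrite /kernel_mean; under eq_Rintegral do rewrite kernV//.
by rewrite RintegralZl// ?mulrA ?divff ?mul1r//; exact: orbit_kern_integrable.
Qed.

(** The contour estimate at radius [r], with the left-hand contour pushed
    halfway to the boundary of the domain of [G]. *)
Lemma radius_estimate (r t : R) : 1 <= r -> 0 < t ->
  rnorm (g t) <= 2 * (A1 * kernel_mean h r t + C * ((1 + r) * M r) ^+ N *
    (2 * (A2 / (r ^+ m * t ^+ m)) + 2 * r * A3 * expR (- ((2 * M r)^-1 * t)))).
Proof.
move=> r1 t0; have r0 : 0 < r by exact: lt_le_trans r1.
have mr := M2 (ltW r0).
apply: functional_norm_le => Phi P.
rewrite resolvent_orbitE ?(ltW t0)// -(extension_laplace P)//.
have -> : A1 * kernel_mean h r t = (2 * (contour_ratio omega + 1) + 4) *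
    (4 * contour_ratio omega ^+ 2 * (contour_ratio omega + 2) ^+ (2 * m) * kernel_mean h r t) by rewrite /A1 -!mulrA.
apply: (@contour_estimate R (fun s => Phi (f s)) h (fun l => Phi (G l)) omega m) => //.
- by rewrite /m addn3.
- exact: functional_orbit_measurable.
- by move=> s _; exact: functional_orbit_le.
- exact: orbit_exp_integrable.
- exact: orbit_exp_local_integrable.
- by move=> l; exact: extension_laplace.
- by move=> l l0; apply: functional_holo => //; exact: Ghol.
- rewrite (_ : (fun s => _) = (fun s => r^-1 * (kern r t s * h s))); last first.
    by apply/funext => s; rewrite kernV.
  by apply: integrableRZ => //; apply: orbit_kern_integrable => //; exact: ltW.
- by rewrite invr_gt0; lra.
- by rewrite invf_le1; lra.
- move=> x y xr yr; have [Oy Gy] := strip_bound (ltW r0) xr yr.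
  split; first by apply: functional_holo => //; exact: GOmega.
  exact: le_trans (P.2 _) Gy.
Qed.

Let w1 t : 1 <= w t. Proof. exact: w_ge1. Qed.

Lemma kern_le_kern1 (t s : R) : kern omega t s <= (omega + omega^-1) * kern 1 t s.
Proof.
rewrite -[kern omega t s]/(omega / (1 + omega * `|t - s|) ^+ 2).
rewrite -[kern 1 t s]/(1 / (1 + 1 * `|t - s|) ^+ 2) mul1r.
set d := `|t - s|; have d0 : 0 <= d by exact: normr_ge0.
have o0 := ltW omega0.
have p2 : 0 < 1 + omega * d by rewrite ltr_wpDr// mulr_ge0.
have p3 : 0 < 1 + d by rewrite ltr_wpDr.
rewrite mul1r; apply: ler_div2; rewrite ?exprn_gt0//.
have [ge1|lt1] := leP 1 omega.
  apply: ler_pM; rewrite ?exprn_ge0 ?(ltW p3)//.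
    by rewrite lerDl invr_ge0.
  apply: lerXn2r; rewrite ?nnegrE ?(ltW p2) ?(ltW p3)//.
  by rewrite lerD2l ler_peMl.
apply: (@le_trans _ _ (omega^-1 * (1 + omega * d) ^+ 2)).
  rewrite -ler_pdivlMl//.
  have -> : omega^-1 * (omega^-1 * (1 + omega * d) ^+ 2) = (omega^-1 * (1 + omega * d)) ^+ 2.
    by rewrite exprMn expr2; ring.
  apply: lerXn2r; rewrite ?nnegrE ?(ltW p3) ?mulr_ge0 ?invr_ge0 ?(ltW p2)//.
  rewrite ler_pdivlMl// mulrDr mulr1 lerD2r; exact: ltW.
by rewrite ler_wpM2r ?exprn_ge0 ?(ltW p2)// lerDr.
Qed.

(** At the radius [r = w t], multiplication by [r] turns the mean of [h] in the
    contour estimate into the integral against [kern r t], and makes the other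
    terms [O(t ^ -2)]. As long as [k t < M_log M 1] the weight is [1] and the
    exponential average of [h] is enough. *)
Lemma weighted_orbit_estimate : exists K1 K2 : R, [/\ 0 <= K1, 0 <= K2 &
  forall t, 0 <= t -> w t * rnorm (g t) <=
    K1 * \int[mu]_(s in D) (kern (w t) t s * h s) + K2 * kern 1 t 0].
Proof.
pose K1 := 2 * A1 + 4 / omega * (omega + omega^-1).
pose K := 2 * A2 * C * 2 ^+ N + 8 * A3 * C * (N%:R + 6) ^+ 2.
have o0 := ltW omega0.
have A20 : 0 <= A2 by rewrite mulr_ge0 ?exprn_ge0.
have A30 : 0 <= A3 by rewrite divr_ge0 ?exprn_ge0.
have L0 : 0 <= 4 / omega * (omega + omega^-1).
  by rewrite mulr_ge0 ?divr_ge0 ?addr_ge0 ?invr_ge0.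
have K0 : 0 <= K.
  rewrite /K; apply: addr_ge0; apply: mulr_ge0; rewrite ?exprn_ge0 ?addr_ge0//.
    by apply: mulr_ge0 => //; exact: mulr_ge0.
  by apply: mulr_ge0 => //; exact: mulr_ge0.
exists K1, (8 * K); split; [|exact: mulr_ge0|].
  by apply: addr_ge0 => //; exact: mulr_ge0.
move=> t t0; have kt0 : 0 <= kern 1 t 0 by exact: kern_ge0.
have I0 (r : R) : 0 <= r -> 0 <= \int[mu]_(s in D) (kern r t s * h s).
  by move=> r0; apply: Rintegral_ge0 => s _; rewrite mulr_ge0// kern_ge0.
have [_ [wbig wsmall]] := w_M_log_spec Mc Mmono M2 (k * t).
have [big|small] := leP (M_log M 1) (k * t); last first.
  have wE : w t = 1 by exact: wsmall.
  rewrite wE mul1r; apply: (@le_trans _ _ (4 / omega * \int[mu]_(s in D) (kern omega t s * h s))).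
    exact: resolvent_orbit_le.
  apply: (@le_trans _ _ (K1 * \int[mu]_(s in D) (kern 1 t s * h s))); last first.
    by rewrite lerDl; apply: mulr_ge0 => //; exact: mulr_ge0.
  apply: (@le_trans _ _ (4 / omega * ((omega + omega^-1) * \int[mu]_(s in D) (kern 1 t s * h s)))).
    rewrite ler_wpM2l ?divr_ge0// -RintegralZl//; last exact: orbit_kern_integrable.
    apply: le_Rintegral => //.
    - exact: orbit_kern_integrable.
    - by apply: integrableRZ => //; exact: orbit_kern_integrable.
    - by move=> s _; rewrite mulrA ler_wpM2r// kern_le_kern1.
  rewrite mulrA; apply: ler_wpM2r; first exact: I0.
  by rewrite /K1 lerDr mulr_ge0.
have r1 := w1 t; have rE : M_log M (w t) = k * t by exact: wbig.
(* [M_log M 0 >= 0] and [M_log M (w t) = k t] exclude [t = 0]. *)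
have t1 : 0 < t.
  rewrite lt_neqAle t0 andbT; apply/eqP => t00.
  have rE0 : M_log M (w t) = 0 by rewrite rE -t00 mulr0.
  have := M_log_strict Mmono M2 (lexx 0) (lt_le_trans (@ltr01 R) r1); rewrite rE0.
  by rewrite /M_log addr0 ln1 addr0 ltNge mulr_ge0 ?ln1D_ge0 //; have := M2 (lexx 0); lra.
have [t11 rem] := remainder_le M2 r1 rE C0 A20 A30.
have r0 : 0 < w t by exact: lt_le_trans r1.
have E1 := radius_estimate r1 t1.
apply: le_trans (ler_wpM2l (ltW r0) E1) _.
set Q := C * _ ^+ N * _ in E1 *; rewrite -/Q in rem.
have -> : w t * (2 * (A1 * kernel_mean h (w t) t + Q)) =
    2 * A1 * (w t * kernel_mean h (w t) t) + 2 * (w t * Q) by ring.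
rewrite kern_integralE//; apply: lerD.
  by apply: ler_wpM2r; [exact: I0 (ltW r0)|rewrite /K1 lerDl].
have -> : 8 * K * kern 1 t 0 = 2 * (K * (4 * kern 1 t 0)) by ring.
rewrite ler_pM2l//; apply: le_trans rem _; rewrite -/K ler_wpM2l//.
rewrite -[kern 1 t 0]/(1 / (1 + 1 * `|t - 0|) ^+ 2) subr0 ger0_norm// mul1r mul1r.
rewrite -[(t ^+ 2)^-1]mul1r; apply: ler_div2; rewrite ?exprn_gt0 ?ltr_wpDr// mul1r.
have -> : 4 * t ^+ 2 = (2 * t) ^+ 2 by rewrite exprMn; congr (_ * _); ring.
by apply: lerXn2r; rewrite ?nnegrE ?addr_ge0 ?mulr_ge0//; lra.
Qed.

Let w_continuous_scaled : continuous w.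
Proof.
move=> t; apply: (@continuous_comp _ _ _ (fun t : R => k * t) (w_M_log M)).
  by apply: cvgM; [exact: cvg_cst|exact: cvg_id].
exact: w_continuous.
Qed.

(** Subtracting the remainder [K2 * kern 1 t 0], which is in every [L^p], leaves
    a function dominated by an integral operator whose kernel has bounded rows
    and columns. *)
Lemma weighted_orbit_Lp : in_weighted_Lp p w g.
Proof.
have p0 : 0 < p by exact: lt_le_trans p1.
have [K1 [K2 [K10 K20 est]]] := weighted_orbit_estimate.
split.
  apply: halfline_continuous_strongly_measurable.
  by apply: halfline_continuousZ => //; exact: orbit_halfline_continuous.
have w0 t : 0 < w t by exact: lt_le_trans (w1 t).
have mw : measurable_fun setT w by exact: continuous_measurable_fun.
have mg : measurable_fun D (fun t => w t * rnorm (g t)).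
  apply: measurable_funM; first exact: measurable_funTS.
  exact: resolvent_orbit_measurable.
pose y t := K2 * kern 1 t 0; pose q t := Num.max 0 (w t * rnorm (g t) - y t).
have my : measurable_fun D y.
  apply: measurable_funM => //; rewrite (_ : (fun _ => _) = kern 1 0); last first.
    by apply/funext => t; rewrite kernC.
  exact: measurable_kern.
have y0 t : 0 <= y t by apply: mulr_ge0 => //; exact: kern_ge0.
have mq : measurable_fun D q by apply: measurable_maxr => //; exact: measurable_funB.
have q0 t : 0 <= q t by rewrite le_max lexx.
have qp : (\int[mu]_(t in D) (q t `^ p)%:E < +oo)%E.
  apply: (@schur R w h q p 40 K1) => //.
  - move=> s s0; apply: kern_column => //.
    + by move=> t t' tt; apply: w_mono => //; rewrite ler_pM2l.
    + move=> t t' tt t1; apply: w_double => //; first by rewrite ler_pM2l.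
      rewrite -mulrBr; apply: le_trans t1; rewrite ler_piMl// subr_ge0//.
  - move=> t t0; rewrite ge_max; apply/andP; split.
      apply: mulr_ge0 => //; apply: Rintegral_ge0 => s _; apply: mulr_ge0 => //.
      by apply: kern_ge0; exact: ltW.
    by rewrite lerBlDr; exact: est.
(* [w t |g t| <= q t + y t], and [kern 1 t 0 <= 1] is integrable. *)
pose v t := 2 `^ p * (q t `^ p) + 2 `^ p * (K2 `^ p * kern 1 t 0).
have vi : mu.-integrable D (EFin \o v).
  apply: integrableRD => //; apply: integrableRZ => //.
    apply: ge0_lty_integrable => //; first exact: measurable_powR_comp.
    by move=> s _; exact: powR_ge0.
  apply: integrableRZ => //; rewrite (_ : (fun _ => _) = kern 1 0); last first.
    by apply/funext => t; rewrite kernC.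
  exact: kern_integrable.
rewrite RplusE; have [_] := integrableP _ _ _ vi; apply: le_lt_trans.
apply: ge0_le_integral.
- exact: mD.
- by move=> t _; rewrite lee_fin powR_ge0.
- apply/measurable_EFinP; apply: measurable_powR_comp.
  rewrite (_ : (fun t => _) = (fun t => w t * rnorm (g t))) //.
  by apply/funext => t; rewrite rnormZ cabs_real gtr0_norm.
- by apply: measurableT_comp => //; exact: (measurable_int mu vi).
- move=> t _; rewrite lee_fin rnormZ cabs_real (gtr0_norm (w0 t)).
  apply: le_trans (ler_norm _).
  apply: (@le_trans _ _ ((q t + y t) `^ p)).
    apply: ge0_ler_powR; rewrite ?nnegrE ?(ltW p0)//.
    + by apply: mulr_ge0; [exact: ltW|exact: rnorm_ge0].
    + exact: addr_ge0.
    + by rewrite -lerBlDr /q le_max lexx orbT.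
  apply: le_trans (powR_add_le (ltW p0) (q0 t) (y0 t)) _.
  rewrite /v -mulrDr ler_wpM2l ?powR_ge0// lerD2l /y powRM//; last exact: kern_ge0.
  rewrite ler_wpM2l ?powR_ge0//.
  have k01 : 0 <= kern 1 t 0 <= 1 by rewrite kern_ge0// kern_le.
  by case/andP: k01 => ka kb; apply: powR_le_id.
Qed.

End Growth.

End Extension.

End OrbitEstimates.

(** * The extension and its growth *)

Section Assembly.
Context {R : realType} {X : completeNormedModType R[i]}.

Lemma bounded_operator_linear (B : {linear X -> X}) : bounded_operator B ->
  exists b : R, bounded_linear B b.
Proof.
move=> [b H]; exists (`|b| + 1); split.
- by rewrite ltr_wpDl.
- by move=> k x y; rewrite linearP.
- move=> x; apply: le_trans (H x) _; rewrite ler_wpM2r ?rnorm_ge0//.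
  by apply: le_trans (ler_norm _) _; rewrite lerDl.
Qed.

Lemma closed_half_plane (l : R[i]) : 0 <= complex.Re l -> closure (right_half_plane R) l.
Proof.
move=> l0 B /nbhs_ballP[e /= e0 eB].
have er : e = (complex.Re e)%:C by rewrite RRe_real// gtr0_real.
have e0' : 0 < complex.Re e by rewrite -ltcR -er.
exists (l + (complex.Re e / 2)%:C); split.
  by rewrite /right_half_plane /= ReD /= ltr_wpDl// divr_gt0.
apply: eB; rewrite -ball_normE /ball_ /= opprD addNKr normrN cabsE er ltcR.
rewrite cabs_real gtr0_norm ?divr_gt0//.
by rewrite ltr_pdivrMr// mulr_natr mulr2n ltrDl.
Qed.

Lemma polynomial_growth (C alpha beta s m : R) (N : nat) : 0 <= C -> alpha <= N%:R ->
  beta <= N%:R -> 0 <= s -> 1 <= m ->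
  C * (1 + s) `^ alpha * m `^ beta <= C * ((1 + s) * m) ^+ N.
Proof.
move=> C0 aN bN s0 m1; rewrite -mulrA ler_wpM2l// exprMn.
have s1 : 1 <= 1 + s by rewrite lerDl.
rewrite -!powR_mulrn ?addr_ge0 ?(le_trans ler01 m1)//.
by apply: ler_pM; rewrite ?powR_ge0// ler_powR.
Qed.

End Assembly.

Theorem theorem6p1 (R : realType) (X : completeNormedModType R[i])
    (T : R -> {linear X -> X}) (T1 T2 : {linear X -> X})
    (omega p : R) (x : X) (Om : set (R[i])^o) (G : (R[i])^o -> X)
    (hT : C0_semigroup T)
    (hT1 : bounded_operator T1) (hT2 : bounded_operator T2)
    (homega : (maxe (growth_bound T) 0 < omega%:E)%E)
    (hp : 1 <= p)
    (hLp : in_Lp p (fun t => T1 (T t (T2 x))))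
    (hOm : open Om) (hOmC : closure (right_half_plane R) `<=` Om)
    (hG : analytic_on Om G)
    (hGext : forall lam, Om lam -> (growth_bound T < (complex.Re lam)%:E)%E ->
       G lam = T1 (resolvent T lam (T2 x))) :
  (in_Lp p (fun t => T1 (T t (resolvent T omega%:C (T2 x)))) /\
   in_C0 (fun t => T1 (T t (resolvent T omega%:C (T2 x))))) /\
  (forall (M : R -> R) (C alpha beta : R),
     {within Rplus R, continuous M} ->
     (forall s t, 0 <= s -> s <= t -> M s <= M t) ->
     (forall s, 0 <= s -> 2 <= M s) ->
     Om = Omega M ->
     0 <= C -> 0 <= alpha -> 0 <= beta ->
     (forall lam, Omega M lam ->
        rnorm (G lam) <= C * (1 + `|complex.Im lam|) `^ alpha
                           * M `|complex.Im lam| `^ beta) ->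
     exists k : R, 0 < k /\
       in_weighted_Lp p (fun t => w_M_log M (k * t))
         (fun t => T1 (T t (resolvent T omega%:C (T2 x))))).
Proof.
have [go o0] : (growth_bound T < omega%:E)%E /\ 0 < omega.
  by move: homega; rewrite gt_max lte_fin => /andP[].
have [a [c [a0 ao c0 Tb]]] := growth_bound_lt o0 go.
have [b Bb] := bounded_operator_linear hT1.
have hLp' := hLp.2; rewrite RplusE in hLp'.
have Ghol (l : R[i]) : 0 <= complex.Re l -> derivable G l 1.
  by move=> l0; apply: hG; apply: hOmC; exact: closed_half_plane.
have Gres (l : R[i]) : omega < complex.Re l -> G l = T1 (resolvent T l (T2 x)).
  move=> ol; apply: hGext; last by apply: lt_trans go _; rewrite lte_fin.
  by apply: hOmC; apply: closed_half_plane; rewrite ltW// (lt_trans o0).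
split; first split.
- exact: (resolvent_orbit_Lp hT a0 c0 Tb Bb o0 ao hp hLp').
- exact: (resolvent_orbit_C0 hT a0 c0 Tb Bb o0 ao hp hLp').
move=> M C alpha beta Mc Mmono M2 OmE C0 al0 be0 Gle.
(* The contour estimate uses the order [N + 3] of the zeros of [chi], with [N] a
   natural number above both exponents. *)
pose N := (Num.Def.trunc (alpha + beta)).+1.
have abN : alpha + beta < N%:R by exact: truncnS_gt.
have aN : alpha <= N%:R by apply: le_trans (ltW abN); rewrite lerDl.
have bN : beta <= N%:R by apply: le_trans (ltW abN); rewrite lerDr.
exists (2 * (N%:R + 6))^-1; split; first by rewrite invr_gt0 mulr_gt0// ltr_wpDl.
apply: (weighted_orbit_Lp hT a0 c0 Tb Bb o0 ao hp hLp' Ghol Gres Mc Mmono M2 C0).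
- by move=> l Ol; apply: hG; rewrite OmE.
- move=> l Ol; apply: le_trans (Gle _ Ol) _; apply: polynomial_growth => //.
  by apply: le_trans (M2 _ (normr_ge0 _)); rewrite ler1n.
Qed.
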